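(* Let $(\tilde p_1,\tilde p_2)$ be a GM-dependent normalized completely random measure with parameters $(c,z,\rho,P_0)$ and let $n_1,n_2\ge1$. For any nonnegative integers $k_1,k_2,k_0$ such that $k_l+k_0\in\{1,\dots,n_l\}$ for $l=1,2$, with $k=k_1+k_2+k_0$, and for any $(\mathbf n^{(i)},\mathbf q^{(i)})\in\Delta_{n_i,k_i,k_0}$, $i=1,2$, the partially exchangeable partition probability function induced by $(\tilde p_1,\tilde p_2)$ is $$\begin{aligned}\Pi_k^{(n_1+n_2)}&(\mathbf n^{(1)},\mathbf n^{(2)},\mathbf q^{(1)},\mathbf q^{(2)})=\frac{c^k}{\Gamma(n_1)\Gamma(n_2)}\sum_{\mathbf i\in\{0,1\}^{k_1}}\ \sum_{\mathbf l\in\{0,1\}^{k_2}}(1-z)^{k_0+|\mathbf i|+|\mathbf l|}\,z^{k_1+k_2-|\mathbf i|-|\mathbf l|}\\&\times\int_0^\infty\!\!\int_0^\infty u^{n_1-1}v^{n_2-1}e^{-cz[\psi(u)+\psi(v)]-c(1-z)\psi(u+v)}\prod_{j=1}^{k_1}\tau_{n_{j,1}}(u+i_jv)\prod_{j=1}^{k_2}\tau_{n_{j,2}}(l_ju+v)\prod_{r=1}^{k_0}\tau_{q_{r,1}+q_{r,2}}(u+v)\,du\,dv,\end{aligned}$$ where $|\mathbf i|=\sum_{j=1}^{k_1}i_j$ and $|\mathbf l|=\sum_{j=1}^{k_2}l_j$.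
   Context: $\mathbb{X}$ is a complete separable metric space with Borel $\sigma$-algebra $\mathscr{X}$; $P_0$ is a nonatomic probability measure on $(\mathbb{X},\mathscr{X})$; $c>0$; $z\in[0,1]$ is fixed (with $0^0=1$); $\rho:(0,\infty)\to[0,\infty)$ is measurable with $\int_0^\infty\min(1,s)\rho(s)\,ds<\infty$ and $\int_0^\infty\rho(s)\,ds=\infty$. For $u>0$ and integers $q\ge1$: $\psi(u)=\int_0^\infty(1-e^{-us})\rho(s)\,ds$ and $\tau_q(u)=\int_0^\infty s^qe^{-us}\rho(s)\,ds$. GM-dependent normalized CRM with parameters $(c,z,\rho,P_0)$: a completely random measure (CRM) is a random measure whose values on pairwise disjoint measurable sets are mutually independent. Let $\mu_0,\mu_1,\mu_2$ be independent CRMs on $(\mathbb{X},\mathscr{X})$, each of the form $\mu(B)=\int_{(0,\infty)\times B}s\,N(ds,dx)$ with $N$ a Poisson random measure, the intensity of $N$ being $cz\,\rho(s)\,ds\,P_0(dx)$ for $\mu_1$ and for $\mu_2$, and $c(1-z)\,\rho(s)\,ds\,P_0(dx)$ for $\mu_0$. Set $\tilde\mu_i=\mu_i+\mu_0$ and $\tilde p_i=\tilde\mu_i/\tilde\mu_i(\mathbb{X})$, $i=1,2$. Sampling: conditionally on $(\tilde p_1,\tilde p_2)$, the random variables $X_1,\dots,X_{n_1},Y_1,\dots,Y_{n_2}$ are independent, each $X_i$ having law $\tilde p_1$ and each $Y_j$ having law $\tilde p_2$. Equality of values partitions the $n_1+n_2$ observations into clusters: $k_1$ clusters containing only $X$'s,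 with sizes $\mathbf n^{(1)}=(n_{1,1},\dots,n_{k_1,1})$; $k_2$ clusters containing only $Y$'s, with sizes $\mathbf n^{(2)}=(n_{1,2},\dots,n_{k_2,2})$; and $k_0$ clusters shared by both samples, the $r$-th of which contains $q_{r,1}\ge1$ of the $X$'s and $q_{r,2}\ge1$ of the $Y$'s, $\mathbf q^{(i)}=(q_{1,i},\dots,q_{k_0,i})$. The set $\Delta_{n_i,k_i,k_0}$ consists of the pairs $(\mathbf n^{(i)},\mathbf q^{(i)})$ of vectors of positive integers, of lengths $k_i$ and $k_0$, with $\sum_{l=1}^{k_i}n_{l,i}+\sum_{r=1}^{k_0}q_{r,i}=n_i$. The partially exchangeable partition probability function $\Pi_k^{(n_1+n_2)}(\mathbf n^{(1)},\mathbf n^{(2)},\mathbf q^{(1)},\mathbf q^{(2)})$ is the probability that the partition of the $n_1+n_2$ observations equals a given (fixed) set partition having these cluster frequencies. *)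

(* Defs.v *)
From HB Require Import structures.
From mathcomp Require Import all_boot all_order all_algebra.
From mathcomp Require Import all_classical all_reals all_analysis measurable_realfun.

Set Implicit Arguments.
Unset Strict Implicit.
Unset Printing Implicit Defensive.

Import Order.TTheory GRing.Theory Num.Theory.
Import numFieldNormedType.Exports.

Local Open Scope classical_set_scope.
Local Open Scope ring_scope.

#[short(type="completeMetricType")]
HB.structure Definition CompleteMetric (K : numDomainType) :=
  { M of Metric K M & CompletePseudoMetric K M }.

Definition separable (T : topologicalType) : Prop :=
  exists2 D : set T, countable D & dense D.

Notation borel X := (g_sigma_algebraType (@open X)).

Definition nonatomic d (Y : measurableType d) (R : realType)
    (nu : set Y -> \bar R) : Prop :=
  forall A, measurable A -> (0 < nu A)%E ->
    exists B, [/\ measurable B, B `<=` A, (0 < nu B)%E & (nu B < nu A)%E].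

Section independence.
Context d (T : measurableType d) (R : realType) (P : probability T R).

Definition mutual_independence (I : finType) (F : I -> set (set T)) : Prop :=
  forall (J : {set I}) (A : I -> set T), (forall i, i \in J -> F i (A i)) ->
    P (\bigcap_(i in [set` J]) A i) = (\prod_(i in J) P (A i))%E.

(* f is a version of the conditional probability of E given the sigma-algebra
   G. *)
Definition is_cond_prob (G : set (set T)) (E : set T) (f : T -> \bar R) :
    Prop :=
  (forall C : set (\bar R), measurable C -> G (f @^-1` C)) /\
  (forall D, G D -> P (D `&` E) = \int[P]_(w in D) f w)%E.

End independence.

(* A random measure on Y is a kernel from the sample space T to Y. *)
Section random_measures.
Context d (T : measurableType d) d' (Y : measurableType d') (R : realType).
Variable P : probability T R.

Definition sigma_random_measure (mu : R.-ker T ~> Y) : set (set T) :=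
  <<s \bigcup_(B in measurable)
        preimage_set_system setT (fun w => mu w B) measurable >>.

Definition completely_random (mu : R.-ker T ~> Y) : Prop :=
  forall (n : nat) (B : 'I_n -> set Y),
    (forall i, measurable (B i)) -> trivIset setT B ->
    mutual_independence P
      (fun i => preimage_set_system setT (fun w => mu w (B i)) measurable).

(* The second argument of poisson_prob is a dummy; poisson_prob 0 is the Dirac
   mass at 0, whereas poisson_pmf 0 is not its mass function. *)
Definition poisson_random_measure (N : R.-ker T ~> Y) (nu : set Y -> \bar R) :
    Prop :=
  completely_random N /\
  forall B, measurable B ->
    ((nu B < +oo)%E -> forall n : nat,
       P [set w | N w B = n%:R%:E] = poisson_prob (fine (nu B)) 0 [set n]) /\
    (nu B = +oo%E -> P [set w | N w B = +oo%E] = 1%E).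

End random_measures.

Section gm_dependent.
Context d (T : measurableType d) d' (Y : measurableType d') (R : realType).
Variable P : probability T R.

Local Notation leb := (@lebesgue_measure R).

(* The measure a rho(s) ds P0(dx) on (0, oo) x Y, seen as a measure on R x Y
   that does not charge (-oo, 0] x Y. *)
Definition intensity (a : R) (rho : R -> R) (P0 : probability Y R)
    (A : set (R * Y)) : \bar R :=
  (\int[leb]_(s in `]0%R, +oo[) \int[P0]_x (a * rho s * \1_A (s, x))%:E)%E.

Definition poissonian_crm (a : R) (rho : R -> R) (P0 : probability Y R)
    (mu : R.-ker T ~> Y) : Prop :=
  completely_random P mu /\
  exists N : R.-ker T ~> (R * Y)%type,
    poisson_random_measure P N (intensity a rho P0) /\
    forall w B, measurable B ->
      (mu w B = \int[N w]_(p in `]0%R, +oo[ `*` B) (p.1)%:E)%E.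

(* Normalization is only required where the total mass lies in (0, oo). *)
Definition normalization_of (mt : R.-ker T ~> Y) (p : R.-pker T ~> Y) : Prop :=
  forall w B, measurable B -> (0 < mt w setT < +oo)%E ->
    p w B = (mt w B / mt w setT)%E.

Definition GM_dependent_NCRM (c z : R) (rho : R -> R) (P0 : probability Y R)
    (p1 p2 : R.-pker T ~> Y) : Prop :=
  exists mu0 mu1 mu2 : R.-ker T ~> Y,
    [/\ [/\ poissonian_crm (c * (1 - z)) rho P0 mu0,
            poissonian_crm (c * z) rho P0 mu1 &
            poissonian_crm (c * z) rho P0 mu2],
        mutual_independence P (fun i : 'I_3 =>
          sigma_random_measure (tnth [tuple mu0; mu1; mu2] i)),
        normalization_of (kadd mu1 mu0) p1 &
        normalization_of (kadd mu2 mu0) p2].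

Definition sigma_pair (p1 p2 : R.-ker T ~> Y) : set (set T) :=
  <<s sigma_random_measure p1 `|` sigma_random_measure p2 >>.

Definition cond_independent_samples (p1 p2 : R.-pker T ~> Y) (n1 n2 : nat)
    (xs : 'I_n1 -> {RV P >-> Y}) (ys : 'I_n2 -> {RV P >-> Y}) : Prop :=
  forall (A : 'I_n1 -> set Y) (B : 'I_n2 -> set Y),
    (forall i, measurable (A i)) -> (forall j, measurable (B j)) ->
    is_cond_prob P (sigma_pair p1 p2)
      ((\bigcap_i (xs i @^-1` A i)) `&` (\bigcap_j (ys j @^-1` B j)))
      (fun w => (\prod_(i < n1) p1 w (A i)) * (\prod_(j < n2) p2 w (B j)))%E.

End gm_dependent.

Section partitions.
Variables n1 n2 : nat.

Definition obs d (T : measurableType d) d' (Y : measurableType d')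
    (R : realType) (P : probability T R)
    (xs : 'I_n1 -> {RV P >-> Y}) (ys : 'I_n2 -> {RV P >-> Y}) (w : T)
    (a : 'I_n1 + 'I_n2) : Y :=
  match a with inl i => xs i w | inr j => ys j w end.

Definition numX (C : {set 'I_n1 + 'I_n2}) : nat :=
  #|[pred i : 'I_n1 | inl i \in C]|.
Definition numY (C : {set 'I_n1 + 'I_n2}) : nat :=
  #|[pred j : 'I_n2 | inr j \in C]|.

(* The clusters of ptn can be listed as X-only, Y-only and shared clusters with
   the given frequencies. *)
Definition has_frequencies (k1 k2 k0 : nat)
    (nn1 : 'I_k1 -> nat) (nn2 : 'I_k2 -> nat) (q1 q2 : 'I_k0 -> nat)
    (ptn : {set {set 'I_n1 + 'I_n2}}) : Prop :=
  finset.partition ptn finset.setT /\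
  exists (CX : 'I_k1 -> {set 'I_n1 + 'I_n2})
         (CY : 'I_k2 -> {set 'I_n1 + 'I_n2})
         (CS : 'I_k0 -> {set 'I_n1 + 'I_n2}),
    [/\ uniq (codom CX ++ codom CY ++ codom CS),
        ptn =i codom CX ++ codom CY ++ codom CS,
        forall j, numX (CX j) = nn1 j /\ numY (CX j) = 0%N,
        forall j, numX (CY j) = 0%N /\ numY (CY j) = nn2 j &
        forall r, numX (CS r) = q1 r /\ numY (CS r) = q2 r].

End partitions.

Definition Delta (n k k0 : nat) (nn : 'I_k -> nat) (q : 'I_k0 -> nat) : Prop :=
  [/\ forall j, (0 < nn j)%N, forall r, (0 < q r)%N &
      (\sum_(j < k) nn j + \sum_(r < k0) q r)%N = n].

Section integrals.
Context (R : realType).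
Local Notation leb := (@lebesgue_measure R).

Definition Gamma (x : R) : R :=
  \int[leb]_(t in `]0, +oo[) (t `^ (x - 1) * expR (- t)).

Definition psi (rho : R -> R) (u : R) : R :=
  \int[leb]_(s in `]0, +oo[) ((1 - expR (- (u * s))) * rho s).

Definition tau (rho : R -> R) (q : nat) (u : R) : R :=
  \int[leb]_(s in `]0, +oo[) (s ^+ q * expR (- (u * s)) * rho s).

Definition integrand (c z : R) (rho : R -> R) (n1 n2 k1 k2 k0 : nat)
    (nn1 : 'I_k1 -> nat) (nn2 : 'I_k2 -> nat) (q1 q2 : 'I_k0 -> nat)
    (i : {ffun 'I_k1 -> bool}) (l : {ffun 'I_k2 -> bool}) (u v : R) : R :=
  u ^+ (n1 - 1) * v ^+ (n2 - 1)
  * expR (- (c * z * (psi rho u + psi rho v)) - c * (1 - z) * psi rho (u + v))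
  * (\prod_(j < k1) tau rho (nn1 j) (u + (i j)%:R * v))
  * (\prod_(j < k2) tau rho (nn2 j) ((l j)%:R * u + v))
  * (\prod_(r < k0) tau rho (q1 r + q2 r) (u + v)).

End integrals.

(* Main.v *)
Require Import Defs.
From HB Require Import structures.
From mathcomp Require Import all_boot all_order all_algebra.
From mathcomp Require Import all_classical all_reals all_analysis measurable_realfun.
From mathcomp Require Import ring lra zify.

Set Implicit Arguments.
Unset Strict Implicit.
Unset Printing Implicit Defensive.

Import Order.TTheory GRing.Theory Num.Theory.
Import numFieldNormedType.Exports.

Local Open Scope classical_set_scope.
Local Open Scope ring_scope.

(* The first m sets of a countable separating family cut the space into 2^m
   cells, and the given partition of the observations is the limit as m tends
   to infinity of the event that observations share a cell exactly when they
   share a cluster. Conditionally on the random measures this event has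
   probability
     sum over b of prod_r (mu~_1 (b r) / M1)^(fX r) * (mu~_2 (b r) / M2)^(fY r),
   where b runs over the injective assignments of cells to clusters, fX r and
   fY r count the X's and the Y's in cluster r, and M1, M2 are the total masses.
   Writing 1 / M1^n1 and 1 / M2^n2 as Gamma integrals in u and v turns its
   expectation into joint Laplace moments, which factorize over cells; each
   cluster r contributes a polynomial without constant term in the P0-mass of
   its cell. As P0 is nonatomic, in the limit the sum over b keeps only the
   linear coefficients of these polynomials. For an X-only cluster of size q
   the coefficient is c z tau_q(u) + c (1 - z) tau_q(u + v), and expanding the
   product of these binomials gives the sum over i and l. *)

(** Only Laplace transforms of single masses are computed directly, from the Poisson law through
    simple functions. Moments E[S^n exp(-u S)] follow by differentiating in u. The Laplace exponent
    is linear in the P0-mass x of the set, so each derivative is a polynomial in x times the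
    exponential: a complete Bell polynomial whose linear coefficient is the single cumulant a
    tau_n(u). Higher powers of x stand for clusters fed by several atoms of one cell; they disappear
    as the cells shrink. Two difficulties shape the rest. Exchanging the limit in m with the
    integrals in u and v needs an envelope: the unnormalized sum over b is at most M1^n1 M2^n2,
    whose own mixture integrates to the finite number Gamma(n1) Gamma(n2). Dividing by M1 and M2
    needs both to lie in (0, oo) almost surely: finiteness comes from psi(u) -> 0 as u -> 0,
    positivity from psi(u) -> oo as u -> oo, that is, from the infinite integral of rho. As z may be
    0 or 1, a component may vanish, so positivity is claimed only for mu1 + mu0 and mu2 + mu0. *)

(** * Expectations of products of independent nonnegative variables *)

Section independent_products.
Import HBNNSimple.
Local Open Scope ereal_scope.

(** The point is the case [c = +oo]: positive terms decreasing to 0 would break it, but monotonicity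
    forces [u] to vanish identically when its limit is 0. *)
Lemma nondecreasing_cvgeZr (R : realType) (u : (\bar R)^nat) (l c : \bar R) :
  (forall n, 0 <= u n) -> nondecreasing_seq u -> 0 <= c ->
  u @ \oo --> l -> (fun n => u n * c) @ \oo --> l * c.
Proof.
move=> u0 ndu c0 ul.
have [cf|] := boolP (c \is a fin_num); first exact: cvgeZr.
rewrite ge0_fin_numE// -leNgt leye_eq => /eqP ->.
have ule n : u n <= l.
  rewrite -(cvg_lim _ ul)// (cvg_lim _ (ereal_nondecreasing_cvgn ndu))//.
  by apply: ereal_sup_ubound; exists n.
have [l0|l0] := eqVneq l 0; last first.
  apply: cvgeM => //; last exact: cvg_cst.
  by exact: mule_def_neq0_infty.
rewrite l0 mul0e [X in X @ _ --> _](_ : _ = cst 0); first exact: cvg_cst.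
apply/funext => n; suff -> : u n = 0 by rewrite mul0e.
by apply/eqP; rewrite eq_le u0 andbT -l0.
Qed.

Context d (T : measurableType d) (R : realType) (P : probability T R).
Context d' (E : measurableType d').

Lemma nonneg_measurable_ind (K : (E -> \bar R) -> Prop) :
  (forall A, measurable A -> K (fun x => (\1_A x)%:E)) ->
  (forall f g : E -> \bar R, measurable_fun setT f -> measurable_fun setT g ->
    (forall x, 0 <= f x) -> (forall x, 0 <= g x) ->
    K f -> K g -> K (fun x => f x + g x)) ->
  (forall (r : R) (f : E -> \bar R), (0 <= r)%R -> measurable_fun setT f ->
    (forall x, 0 <= f x) -> K f -> K (fun x => r%:E * f x)) ->
  (forall (f_ : (E -> \bar R)^nat) (f : E -> \bar R), (forall n, measurable_fun setT (f_ n)) ->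
    (forall n x, 0 <= f_ n x) ->
    (forall x, nondecreasing_seq (f_ ^~ x)) ->
    (forall x, f_ ^~ x @ \oo --> f x) ->
    (forall n, K (f_ n)) -> K f) ->
  forall f : E -> \bar R, measurable_fun setT f -> (forall x, 0 <= f x) -> K f.
Proof.
move=> K1 KD KZ Klim f mf f0.
have K0 : K (cst 0).
  suff -> : cst 0 = (fun x : E => (\1_set0 x)%:E : \bar R) by exact: K1.
  by apply/funext => x; rewrite indicE in_set0.
pose g := nnsfun_approx measurableT mf.
apply: (Klim (fun n => EFin \o g n)).
- by move=> n; exact/measurable_EFinP.
- by move=> n x; rewrite lee_fin.
- by move=> x m n mn; rewrite lee_fin; exact/lefP/nd_nnsfun_approx.
- by move=> x; exact: cvg_nnsfun_approx.
move=> n.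
(* Writing [Num.max 0 y] for the value [y] makes every summand nonnegative, so the induction on the
   list of values need not remember that they come from the range of [g n]. *)
have -> : EFin \o g n =
    (fun x => \sum_(y <- finmap.enum_fset (fset_set (range (g n))))
      ((Num.max 0 y)%:E * (\1_(g n @^-1` [set y]) x)%:E)).
  apply/funext => x /=; rewrite fimfunE fsbig_finite//= -sumEFin.
  apply: eq_big_seq => y; rewrite in_fset_set// inE => -[t _ <-].
  by rewrite EFinM max_r.
elim: (finmap.enum_fset _) => [|y s ih].
  by under eq_fun do rewrite big_nil.
under eq_fun do rewrite big_cons.
have mi (a : R) :
    measurable_fun setT (fun x => (\1_(g n @^-1` [set a]) x)%:E : \bar R).
  by apply/measurable_EFinP; exact: measurable_indic.
have m0 (a : R) : (0 <= Num.max 0 a)%R by rewrite le_max lexx.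
apply: KD => //.
- exact: measurable_funeM.
- by apply: emeasurable_sum => a; exact: measurable_funeM.
- by move=> x; rewrite mule_ge0// lee_fin.
- by move=> x; apply: sume_ge0 => a _; rewrite mule_ge0// lee_fin.
- by apply: KZ => //; apply: K1; exact: measurable_funPTI.
Qed.

(** [W] stands for the product of the remaining factors and [C] for the product of their integrals,
    which may be [+oo]; this is why the limit step relies on [nondecreasing_cvgeZr]. *)
Lemma integral_mul_indep (W : T -> \bar R) (V : T -> E) (C : \bar R)
    (f : E -> \bar R) :
  measurable_fun setT W -> (forall w, 0 <= W w) -> measurable_fun setT V ->
  0 <= C ->
  (forall A, measurable A ->
    \int[P]_w ((\1_A (V w))%:E * W w) = (\int[P]_w (\1_A (V w))%:E) * C) ->
  measurable_fun setT f -> (forall x, 0 <= f x) ->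
  \int[P]_w (f (V w) * W w) = (\int[P]_w f (V w)) * C.
Proof.
move=> mW W0 mV C0 VC mf f0; move: f mf f0; apply: nonneg_measurable_ind => //.
- move=> f g mf mg f0 g0 fC gC.
  have mfV : measurable_fun setT (fun w => f (V w)) by exact: measurableT_comp.
  have mgV : measurable_fun setT (fun w => g (V w)) by exact: measurableT_comp.
  under eq_integral do rewrite ge0_muleDl//.
  rewrite ge0_integralD//; [|by move=> *; rewrite mule_ge0
    |exact: emeasurable_funM|by move=> *; rewrite mule_ge0
    |exact: emeasurable_funM].
  by rewrite fC gC ge0_integralD// [RHS]ge0_muleDl//; apply: integral_ge0.
- move=> r f r0 mf f0 fC.
  have mfV : measurable_fun setT (fun w => f (V w)) by exact: measurableT_comp.
  under eq_integral do rewrite -muleA.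
  rewrite !ge0_integralZl_EFin// ?fC ?muleA//.
    by move=> *; rewrite mule_ge0.
  exact: emeasurable_funM.
- move=> g f mg g0 ndg gf gC.
  have mgV n : measurable_fun setT (fun w => g n (V w)).
    exact: measurableT_comp.
  have ndgW w : nondecreasing_seq (fun n => g n (V w) * W w).
    by move=> m n mn; apply: lee_pmul => //; exact: ndg.
  have gfW w : (fun n => g n (V w) * W w) @ \oo --> f (V w) * W w.
    exact: nondecreasing_cvgeZr.
  have mgW n : measurable_fun setT (fun w => g n (V w) * W w).
    exact: emeasurable_funM.
  have -> : \int[P]_w (f (V w) * W w) =
      limn (fun n => \int[P]_w (g n (V w) * W w)).
    rewrite -monotone_convergence//.
    - by apply: eq_integral => w _; apply/esym/cvg_lim.
    - by move=> n w _; exact: mule_ge0.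
  under eq_fun do rewrite gC.
  apply/cvg_lim => //; apply: nondecreasing_cvgeZr => //.
  - by move=> n; apply: integral_ge0 => w _.
  - move=> m n mn; apply: ge0_le_integral => // w _.
    exact: ndg.
  - have -> : (fun w => f (V w)) = (fun w => limn (fun n => g n (V w))).
      by apply/funext => w; apply/esym/cvg_lim.
    exact: cvg_monotone_convergence.
Qed.

(* The functions h_i are turned from indicators into g_i one index at a
   time. *)
Lemma integral_prod_indep (I : finType) (V : I -> T -> E)
    (g : I -> E -> \bar R) :
  (forall i, measurable_fun setT (V i)) ->
  (forall A : I -> set E, (forall i, measurable (A i)) ->
    P (\bigcap_(i in setT) V i @^-1` A i) = \prod_i P (V i @^-1` A i)) ->
  (forall i, measurable_fun setT (g i)) -> (forall i x, 0 <= g i x) ->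
  \int[P]_w \prod_i g i (V i w) = \prod_i \int[P]_w g i (V i w).
Proof.
move=> mV indV mg g0.
pose nice (h : I -> E -> \bar R) :=
  (forall i, measurable_fun setT (h i)) /\ (forall i x, 0 <= h i x).
suff H (s : seq I) : forall h, nice h ->
    (forall i, i \notin s -> exists2 A, measurable A &
      h i = (fun x => (\1_A x)%:E)) ->
    \int[P]_w \prod_i h i (V i w) = \prod_i \int[P]_w h i (V i w).
  by apply: (H (enum I)) => // i; rewrite mem_enum.
elim: s => [|j s ih] h [mh h0] hs.
  have /choice [A hA] : forall i, exists A, measurable A /\
      h i = (fun x => (\1_A x)%:E).
    by move=> i; have [//|A mA ->] := hs i; exists A.
  have mA i := (hA i).1.
  have -> : (fun w => \prod_i h i (V i w)) =
      (fun w => (\1_(\bigcap_(i in setT) V i @^-1` A i) w)%:E).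
    apply/funext => w; rewrite indicE.
    have [/set_mem wA|/negP wA] := boolP (w \in _).
      rewrite big1// => i _; rewrite (hA i).2 indicE mem_set//.
      exact: wA.
    have /existsNP[i /not_implyP[_ Ni]] : ~ forall i, setT i -> A i (V i w).
      by move=> H; apply: wA; rewrite inE.
    by rewrite (bigD1 i)//= (hA i).2 indicE memNset// mul0e.
  rewrite integral_indic//; last first.
    apply: fin_bigcap_measurable => // i _.
    by rewrite -[X in measurable X]setTI; exact: mV.
  rewrite setIT; transitivity (\prod_i P (V i @^-1` A i)); first exact: indV.
  apply: eq_bigr => i _; rewrite (hA i).2.
  rewrite (_ : (fun w => _) = (fun w => (\1_(V i @^-1` A i) w)%:E))//.
  rewrite integral_indic ?setIT//.
  by rewrite -[X in measurable X]setTI; exact: mV.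
have mprod (Q : pred I) (k : I -> E -> \bar R) : nice k ->
    measurable_fun setT (fun w => \prod_(i | Q i) k i (V i w)).
  move=> [mk k0].
  have mprods (t : seq I) :
      measurable_fun setT (fun w => \prod_(i <- t) k i (V i w)).
    elim: t => [|i t iht].
      rewrite (_ : (fun w => _) = cst 1); first exact: measurable_cst.
      by apply/funext => w; rewrite big_nil.
    rewrite (_ : (fun w => _) =
        (fun w => k i (V i w) * \prod_(i <- t) k i (V i w))).
      by apply: emeasurable_funM => //; exact: measurableT_comp.
    by apply/funext => w; rewrite big_cons.
  rewrite (_ : (fun w => _) =
    (fun w => \prod_(i <- [seq i <- enum I | Q i]) k i (V i w)))//.
  by apply/funext => w; rewrite big_filter big_enum_cond.
pose upd f := (fun i => if i == j then f else h i).
have updE f w : \prod_i upd f i (V i w) =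
    f (V j w) * \prod_(i | i != j) h i (V i w).
  rewrite (bigD1 j)//= /upd eqxx; congr (_ * _).
  by apply: eq_bigr => i /negbTE ->.
have updI f : \prod_i \int[P]_w upd f i (V i w) =
    (\int[P]_w f (V j w)) * \prod_(i | i != j) \int[P]_w h i (V i w).
  rewrite (bigD1 j)//= /upd eqxx; congr (_ * _).
  by apply: eq_bigr => i /negbTE ->.
have hE : h = upd (h j).
  by apply/funext => i; rewrite /upd; case: eqP => [->|].
rewrite hE updI; under eq_integral do rewrite updE.
apply: integral_mul_indep => //.
- exact: mprod.
- by move=> w; exact: prode_ge0.
- by apply: prode_ge0 => i _; apply: integral_ge0 => w _; exact: h0.
move=> A mA.
have := ih (upd (fun x => (\1_A x)%:E)).
rewrite updI; under eq_integral do rewrite updE.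
apply.
  split=> i; rewrite /upd; case: eqP => // _.
    by apply/measurable_EFinP; exact: measurable_indic.
move=> i s_i; rewrite /upd; case: eqP => [_|/eqP ij]; first by exists A.
by apply: hs; rewrite inE negb_or ij.
Qed.

End independent_products.

(** * The function exp(-x) on [0, +oo] *)

Lemma continuous_expRN {R : realType} : continuous (fun a : R => expR (- a)).
Proof.
move=> a; apply: (@continuous_comp _ _ _ (-%R) (@expR R)).
  exact: opp_continuous.
exact: continuous_expR.
Qed.

Section laplace_exponential.
Local Open Scope ereal_scope.
Context {R : realType}.
Implicit Types x y : \bar R.

Lemma measurable_expeR : measurable_fun setT (@expeR R).
Proof.
rewrite (_ : @expeR R = (fun x => if x == -oo then 0 else
  if x == +oo then +oo else (expR (fine x))%:E)); last first.
  by apply/funext => -[r| |].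
have mset1 (a : \bar R) : measurable_fun setT (fun x => x == a).
  apply: (measurable_fun_bool true).
  rewrite setTI (_ : _ @^-1` _ = [set a]); first exact: emeasurable_set1.
  by apply/seteqP; split => x /= /eqP.
apply: measurable_fun_ifT => //; apply: measurable_fun_ifT => //.
apply/measurable_EFinP.
by apply: measurableT_comp => //.
Qed.

Lemma measurable_laplace (r : R) :
  measurable_fun setT (fun x => expeR (- (r%:E * x))).
Proof.
apply: measurableT_comp measurable_expeR _.
by apply: measurableT_comp => //; exact: measurable_funeM.
Qed.

Lemma expeRN_le1 x : 0 <= x -> expeR (- x) <= 1.
Proof. by move=> x0; rewrite -expeR0 lee_expeR leeNl oppe0. Qed.

Lemma expeRN_fin x : 0 <= x -> expeR (- x) \is a fin_num.
Proof.
move=> x0; rewrite ge0_fin_numE ?expeR_ge0//.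
by rewrite (le_lt_trans (expeRN_le1 x0))// ltry.
Qed.

Lemma expeRN_sum (I : Type) (s : seq I) (f : I -> \bar R) :
  (forall i, 0 <= f i) ->
  expeR (- \sum_(i <- s) f i) = \prod_(i <- s) expeR (- f i).
Proof.
move=> f0; elim: s => [|i s ih]; first by rewrite !big_nil oppe0 expeR0.
rewrite !big_cons -ih -expeRD oppeD//.
by rewrite ge0_adde_def// inE ?f0// sume_ge0.
Qed.

(** The limit [+oo] must be covered, because integrals against a random measure can be infinite;
    nonnegativity excludes [-oo]. *)
Lemma cvg_expeRN (u : (\bar R)^nat) x :
  (forall n, 0 <= u n) -> u @ \oo --> x ->
  (fun n => expeR (- u n)) @ \oo --> expeR (- x).
Proof.
move=> u0; case: x => [r| |] ux /=.
- move/fine_cvgP : (ux) => [ufin uc].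
  rewrite -[_%:E]/((fun a => (expR (- a))%:E) r).
  apply: cvg_trans; last first.
    apply: (@continuous_cvg _ _ _ _ _ _ (fun a : R => (expR (- a))%:E)) uc.
    apply: cvg_EFin; first exact: nearW.
    exact: continuous_expRN.
  apply: near_eq_cvg; near=> n; rewrite /=.
  have un : u n \is a fin_num by near: n.
  by rewrite -[in RHS](fineK un).
- apply/fine_cvgP; split.
    by apply: nearW => n; exact: expeRN_fin.
  apply/cvgrPdist_le => e e0.
  have ule : \forall n \near \oo, (- ln e)%:E <= u n by exact: cvgey_ge.
  near=> n; have une : (- ln e)%:E <= u n by near: n.
  rewrite sub0r normrN ger0_norm; last first.
    by rewrite fine_ge0// expeR_ge0.
  rewrite -lee_fin fineK ?expeRN_fin//.
  rewrite -[leRHS]/(e%:E) -[e in leRHS](@lnK R)// -[leRHS]/(expeR (ln e)%:E).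
  by rewrite lee_expeR leeNl.
- suff : 0 <= -oo :> \bar R by [].
  by refine (cvge_to_ge ux _); exact: nearW.
Unshelve. all: by end_near. Qed.

End laplace_exponential.

(** * Laplace transform of a Poisson variable *)

Section poisson_laplace.
Local Open Scope ereal_scope.
Context d (T : measurableType d) (R : realType) (P : probability T R).

(** Exponential tilting turns one Poisson law into another, so the Laplace transform can be read off
    from the total mass 1 of the tilted law. *)
Lemma poisson_prob_tilt (r s : R) n : (0 <= r)%R ->
  (expR (- s *+ n))%:E * poisson_prob r 0 [set n] =
  (expR (- (r * (1 - expR (- s)))))%:E *
    poisson_prob (r * expR (- s)) 0 [set n].
Proof.
rewrite le_eqVlt => /predU1P[<-|r0].
  rewrite !mul0r oppr0 expR0 mul1e /poisson_prob ltxx diracE.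
  have [/set_mem/= <-|] := boolP (0%N \in _); first by rewrite mulr0n expR0 mul1e.
  by rewrite mule0.
rewrite /poisson_prob r0 mulr_gt0 ?expR_gt0//.
rewrite !esum_set1 ?lee_fin ?poisson_pmf_ge0// -!EFinM; congr (_%:E).
rewrite /poisson_pmf r0 mulr_gt0 ?expR_gt0// exprMn -expRM_natl mulr_natl.
rewrite (_ : expR (- (r * (1 - expR (- s)))) =
  expR (- r) * expR (r * expR (- s)))%R; last by rewrite -expRD; congr expR; ring.
have := mulfV (negbT (gt_eqF (expR_gt0 (r * expR (- s)))%R)).
rewrite -expRN => eN.
transitivity (expR (- s *+ n) * (r ^+ n / n`!%:R * expR (- r)) *
  (expR (r * expR (- s)) * expR (- (r * expR (- s)))))%R; first by rewrite eN mulr1.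
ring.
Qed.

Lemma laplace_poisson (V : T -> \bar R) (r s : R) : measurable_fun setT V ->
  (0 <= r)%R -> (0 <= s)%R ->
  (forall n : nat, P [set w | V w = n%:R%:E] = poisson_prob r 0 [set n]) ->
  \int[P]_w expeR (- (s%:E * V w)) = (expR (- (r * (1 - expR (- s)))))%:E.
Proof.
move=> mV r0 s0 PV.
pose A n := [set w | V w = n%:R%:E].
have mA n : measurable (A n).
  by rewrite -[A n]setTI; exact: mV (emeasurable_set1 _).
have tA : trivIset setT A.
  apply/trivIsetP => i j _ _ ij; apply/seteqP; split => // w [] /= Vi.
  by rewrite /A/= Vi => -[] /eqP; rewrite eqr_nat (negbTE ij).
have sumP (t : R) : \sum_(n <oo) poisson_prob t 0 [set n] = 1.
  rewrite -(probability_setT (poisson_prob t 0)).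
  rewrite (_ : setT = \bigcup_n [set n]); last first.
    by apply/seteqP; split => // n _; exists n.
  rewrite measure_semi_bigcup//.
  by apply/trivIsetP => i j _ _ /eqP ij; apply/seteqP; split => // k [/= -> /ij].
have PA : P (\bigcup_n A n) = 1.
  rewrite measure_semi_bigcup//; last exact: bigcupT_measurable.
  rewrite -(sumP r); congr (limn _).
  by apply/funext => n; apply: eq_bigr => i _; exact: PV.
have mf := measurableT_comp (measurable_laplace s) mV.
have mUA : measurable (\bigcup_n A n) by exact: bigcupT_measurable.
have PN : P (~` (\bigcup_n A n)) = 0 by rewrite probability_setC// PA subee.
transitivity (\int[P]_(w in (\bigcup_n A n) `|` ~` (\bigcup_n A n)) expeR (- (s%:E * V w))).
  by rewrite setUv.
rewrite ge0_integral_setU//=; last 4 first.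
- exact: measurableC.
- by rewrite setUv.
- by move=> w _; exact: expeR_ge0.
- exact/disj_setPCl.
rewrite [X in _ + X]null_set_integral ?adde0; last 3 first.
- exact: measurableC.
- exact: measurable_funTS.
- exact: PN.
rewrite ge0_integral_bigcup//; last 2 first.
- exact: measurable_funTS.
- by move=> w _; exact: expeR_ge0.
transitivity (\sum_(n <oo) (expR (- (r * (1 - expR (- s)))))%:E *
    poisson_prob (r * expR (- s)) 0 [set n]); last first.
  by rewrite nneseriesZl// sumP mule1.
apply: eq_eseriesr => n _; rewrite -poisson_prob_tilt// -PV.
transitivity (\int[P]_(w in A n) cst (expR (- s *+ n))%:E w).
  by apply: eq_integral => w /set_mem /= ->; rewrite /= mulNrn mulr_natr.
exact: integral_cst.
Qed.

Lemma laplace_poisson_infty (V : T -> \bar R) (s : R) :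
  measurable_fun setT V -> (0 < s)%R -> P [set w | V w = +oo] = 1 ->
  \int[P]_w expeR (- (s%:E * V w)) = 0.
Proof.
move=> mV s0 PV.
have mA : measurable [set w | V w = +oo].
  by rewrite -[X in measurable X]setTI; exact: mV (emeasurable_set1 _).
have mf := measurableT_comp (measurable_laplace s) mV.
have PN : P (~` [set w | V w = +oo]) = 0.
  by rewrite probability_setC// PV subee.
transitivity (\int[P]_(w in [set w | V w = +oo] `|` ~` [set w | V w = +oo]) expeR (- (s%:E * V w))).
  by rewrite setUv.
rewrite ge0_integral_setU//=; last 4 first.
- exact: measurableC.
- by rewrite setUv.
- by move=> w _; exact: expeR_ge0.
- exact/disj_setPCl.
rewrite [X in _ + X]null_set_integral ?adde0; last 3 first.
- exact: measurableC.
- exact: measurable_funTS.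
- exact: PN.
by apply: integral0_eq => w /= ->; rewrite gt0_muley ?lte_fin.
Qed.

End poisson_laplace.

(** * Laplace functional of a Poisson random measure at simple functions *)

Section poisson_laplace_functional.
Import HBNNSimple.
Local Open Scope ereal_scope.
Context d (T : measurableType d) d' (Y : measurableType d') (R : realType).
Variables (P : probability T R) (N : R.-ker T ~> (R * Y)%type).
Variables (a : R) (rho : R -> R) (P0 : probability Y R).
Hypothesis a_ge0 : (0 <= a)%R.
Local Notation D := (`]0%R, +oo[%classic : set R).
Local Notation leb := (@lebesgue_measure R).
Hypothesis rho_meas : measurable_fun D rho.
Hypothesis rho_ge0 : forall s, (0 < s)%R -> (0 <= rho s)%R.
Hypothesis NP : poisson_random_measure P N (intensity a rho P0).
Variable A : set Y.
Hypothesis mA : measurable A.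

Let D_gt0 s : D s -> (0 < s)%R.
Proof. by rewrite /= in_itv/= andbT. Qed.

Let arho_ge0 s : D s -> (0 <= a * rho s)%R.
Proof. by move=> /D_gt0 s0; rewrite mulr_ge0// rho_ge0. Qed.

Let marho : measurable_fun D (fun s => a * rho s)%R.
Proof. exact: measurable_funM. Qed.

Lemma intensity_rect (B : set R) : measurable B ->
  intensity a rho P0 ((B `&` D) `*` A) =
  \int[leb]_(s in D) (\1_B s * (a * rho s))%:E * P0 A.
Proof.
move=> mB; rewrite /intensity -ge0_integralZr//; last 2 first.
- by apply/measurable_EFinP; apply: measurable_funM => //; exact: measurable_funTS.
- by move=> s /arho_ge0 ?; rewrite lee_fin mulr_ge0.
apply: eq_integral => s /set_mem Ds.
rewrite (_ : (fun x => _) =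
    (fun x => (\1_B s * (a * rho s))%:E * (\1_A x)%:E)); last first.
  apply/funext => x; rewrite -EFinM; congr (_%:E).
  suff -> : \1_((B `&` D) `*` A) (s, x) = (\1_B s * \1_A x)%R :> R.
    by rewrite mulrCA mulrA.
  rewrite !indicE -natrM mulnb; congr ((nat_of_bool _)%:R)%R.
  by apply/idP/andP; rewrite !inE/= => -[]; [move=> [? _]|move=> ?].
rewrite ge0_integralZl//; last 2 first.
- by apply/measurable_EFinP; exact: measurable_indic.
- by rewrite lee_fin mulr_ge0// arho_ge0.
by rewrite integral_indic// setIT.
Qed.

Section simple.
Variable h : {nnsfun R >-> R}.

Variable r : seq R.
Hypothesis r_uniq : uniq r.
Hypothesis range_h : range h = [set` r].

Let n := size r.
Let y (i : 'I_n) : R := r`_i.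
Let B (i : 'I_n) := h @^-1` [set y i].

Let y_ge0 i : (0 <= y i)%R.
Proof.
have : [set` r] (y i) by exact: mem_nth.
by rewrite -range_h => -[s _ <-].
Qed.

Let y_inj : injective y.
Proof.
by move=> i j /eqP; rewrite nth_uniq// => /eqP/val_inj.
Qed.

Let mB i : measurable (B i).
Proof. exact: measurable_funPTI. Qed.

(** Used for [phi = id], to split the random integral, and for 1 - exp(-x), to reassemble the
    Laplace exponent. *)
Let sum_level (phi : R -> R) s :
  phi (h s) = (\sum_(i < n) phi (y i) * \1_(B i) s)%R.
Proof.
have hs : [set` r] (h s) by rewrite -range_h; exists s.
have hn : (index (h s) r < n)%N by rewrite index_mem.
have yi : y (Ordinal hn) = h s by rewrite /y/= nth_index.
rewrite (bigD1 (Ordinal hn))//= big1 ?addr0.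
  by rewrite indicE mem_set ?mulr1 ?yi// /B/= yi.
move=> i ii; rewrite indicE memNset ?mulr0// /B /= => his.
by move/eqP: ii; apply; apply: y_inj; rewrite yi.
Qed.

Let Z i := (B i `&` D) `*` A.

Let mZ i : measurable (Z i).
Proof. by apply: measurableX => //; exact: measurableI. Qed.

Lemma integral_random_nnsfun w :
  \int[N w]_(p in D `*` A) (h p.1)%:E = \sum_(i < n) (y i)%:E * N w (Z i).
Proof.
have mDA : measurable (D `*` A) by exact: measurableX.
under eq_integral do rewrite (sum_level id) -sumEFin.
have m1 i : measurable_fun setT (fun p : R * Y => (\1_(B i) p.1)%:E : \bar R).
  apply/measurable_EFinP.
  have m1 : measurable_fun setT (\1_(B i) : R -> R) by exact: measurable_indic.
  exact: (measurableT_comp m1 measurable_fst).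
rewrite ge0_integral_sum//; last 2 first.
- move=> i; apply: measurable_funTS.
  rewrite (_ : (fun p => _) = (fun p => (y i)%:E * (\1_(B i) p.1)%:E))//.
  exact: measurable_funeM.
- by move=> i p _; rewrite lee_fin mulr_ge0.
apply: eq_bigr => i _; under eq_integral do rewrite EFinM.
rewrite ge0_integralZl_EFin//; last exact: measurable_funTS.
congr (_ * _).
rewrite (_ : (fun p => _) = (fun p => (\1_(B i `*` setT) p)%:E)); last first.
  by apply/funext => p; rewrite !indicE; congr ((nat_of_bool _)%:R%:E);
    apply/idP/idP; rewrite !inE/=; [|case].
rewrite integral_indic//; last exact: measurableX.
by congr (N w _); rewrite /Z -setXI setTI.
Qed.

(** The sets [Z i] are disjoint, so complete randomness makes the expectation a product of Laplace
    transforms of single counts; their exponents then add up to one integral over the level sets of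
    [h]. *)
Lemma laplace_random_nnsfun_seq :
  \int[P]_w expeR (- \int[N w]_(p in D `*` A) (h p.1)%:E) =
  expeR (- (\int[leb]_(s in D) ((1 - expR (- h s)) * (a * rho s))%:E * P0 A)).
Proof.
have [NC NQ] := NP.
have ybound i : (0 <= 1 - expR (- y i))%R by rewrite subr_ge0 -expR0 ler_expR oppr_le0.
rewrite (_ : (fun w => _) =
    (fun w => \prod_(i < n) expeR (- ((y i)%:E * N w (Z i))))); last first.
  apply/funext => w; rewrite integral_random_nnsfun expeRN_sum//.
  by move=> i; rewrite mule_ge0// lee_fin.
rewrite (integral_prod_indep (V := fun i w => N w (Z i))
  (g := fun i x => expeR (- ((y i)%:E * x)))); last 4 first.
- by move=> i; exact: measurable_kernel.
- move=> G mG.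
  have tZ : trivIset setT Z.
    apply/trivIsetP => i j _ _ ij; apply/seteqP; split => // -[s x] [] /=.
    by move=> [[/= si _] _] [[/= sj _] _]; move/eqP: ij; apply; apply: y_inj; rewrite -si sj.
  have := NC n Z mZ tZ finset.setT (fun i => (fun w => N w (Z i)) @^-1` G i).
  rewrite (_ : [set` finset.setT] = setT); last first.
    by apply/seteqP; split => // i _; rewrite /= finset.inE.
  move=> ->; first by apply: eq_bigl => i; rewrite finset.inE.
  by move=> i _; exists (G i) => //; rewrite setTI.
- by move=> i; exact: measurable_laplace.
- by move=> i x; exact: expeR_ge0.
have fact i : \int[P]_w expeR (- ((y i)%:E * N w (Z i))) =
    expeR (- ((1 - expR (- y i))%:E * intensity a rho P0 (Z i))).
  have mNZ : measurable_fun setT (fun w => N w (Z i)) by exact: measurable_kernel.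
  have nu0 : 0 <= intensity a rho P0 (Z i).
    rewrite intensity_rect// mule_ge0//; apply: integral_ge0 => s Ds.
    by rewrite lee_fin mulr_ge0// arho_ge0.
  have [NQ1 NQ2] := NQ _ (mZ i).
  have [nuy|] := ltP (intensity a rho P0 (Z i)) +oo.
    rewrite (laplace_poisson (r := fine (intensity a rho P0 (Z i))))//.
    - have nuf : intensity a rho P0 (Z i) \is a fin_num by rewrite ge0_fin_numE.
      by rewrite -{2}(fineK nuf) -EFinM -EFinN /= mulrC.
    - exact: fine_ge0.
    - exact: NQ1.
  (* A level set of infinite intensity: at level 0 both sides are 1, by the convention 0 * oo = 0;
     at a positive level the count is almost surely infinite and both sides are 0. *)
  rewrite leye_eq => /eqP nuy.
  have := y_ge0 i; rewrite le_eqVlt => /predU1P[y0|y0].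
    rewrite -y0; under eq_integral do rewrite mul0e oppe0 expeR0.
    rewrite oppr0 expR0 subrr mul0e oppe0 expeR0.
    transitivity (1 * P setT); first exact: integral_cst.
    by rewrite probability_setT mule1.
  rewrite laplace_poisson_infty//; last exact: NQ2.
  by rewrite nuy gt0_muley// lte_fin subr_gt0 -expR0 ltr_expR oppr_lt0.
rewrite (eq_bigr _ (fun i _ => fact i)) -expeRN_sum; last first.
  move=> i; rewrite mule_ge0 ?lee_fin// intensity_rect// mule_ge0//.
  by apply: integral_ge0 => s Ds; rewrite lee_fin mulr_ge0// arho_ge0.
congr (expeR (- _)).
have mf i : measurable_fun D (fun s => (\1_(B i) s * (a * rho s))%:E).
  by apply/measurable_EFinP; apply: measurable_funM => //; exact: measurable_funTS.
have i0 i s : D s -> 0 <= (\1_(B i) s * (a * rho s))%:E.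
  by move=> Ds; rewrite lee_fin mulr_ge0// arho_ge0.
have pull i : (1 - expR (- y i))%:E * intensity a rho P0 (Z i) =
    \int[leb]_(s in D) ((1 - expR (- y i))%:E * (\1_(B i) s * (a * rho s))%:E)
      * P0 A.
  rewrite intensity_rect// muleA -ge0_integralZl_EFin//; first exact: i0.
  exact: mf.
rewrite (eq_bigr _ (fun i _ => pull i)).
rewrite -ge0_sume_distrl; last first.
  move=> i _; apply: integral_ge0 => s Ds; rewrite mule_ge0 ?lee_fin//.
  exact: i0.
congr (_ * _); rewrite -ge0_integral_sum//; last 2 first.
- by move=> i; exact: measurable_funeM (mf i).
- by move=> i s Ds; rewrite mule_ge0 ?lee_fin//; exact: i0.
apply: eq_integral => s _; rewrite (sum_level (fun x => 1 - expR (- x))%R).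
rewrite big_distrl/= -sumEFin; apply: eq_bigr => i _.
by rewrite -EFinM mulrA.
Qed.

End simple.

Lemma laplace_random_nnsfun (h : {nnsfun R >-> R}) :
  \int[P]_w expeR (- \int[N w]_(p in D `*` A) (h p.1)%:E) =
  expeR (- (\int[leb]_(s in D) ((1 - expR (- h s)) * (a * rho s))%:E * P0 A)).
Proof.
have /finite_seqP[r hr] := fimfunP h.
apply: (laplace_random_nnsfun_seq (r := undup r)); first exact: undup_uniq.
by rewrite hr; apply/seteqP; split => x /=; rewrite mem_undup.
Qed.

End poisson_laplace_functional.

(** * Finiteness of psi and tau *)

Section levy_integrals.
Context {R : realType}.
Variable rho : R -> R.
Local Notation D := (`]0%R, +oo[%classic : set R).
Local Notation leb := (@lebesgue_measure R).
Hypothesis rho_meas : measurable_fun D rho.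
Hypothesis rho_ge0 : forall s, 0 < s -> 0 <= rho s.
Hypothesis rho_int : (\int[leb]_(s in D) (Num.min 1 s * rho s)%:E < +oo)%E.

Let D_gt0 (s : R) : D s -> 0 < s.
Proof. by rewrite /= in_itv/= andbT. Qed.

Lemma levy_integrable (f : R -> R) (K : R) : measurable_fun D f -> 0 <= K ->
  (forall s, 0 < s -> `|f s| <= K * Num.min 1 s) ->
  leb.-integrable D (fun s => (f s * rho s)%:E).
Proof.
move=> mf K0 fK.
have mmin : measurable_fun D (fun s : R => Num.min 1 s).
  by apply: measurable_funTS; exact: measurable_minr.
have i1 : leb.-integrable D (fun s => (Num.min 1 s * rho s)%:E).
  apply/integrableP; split.
    by apply/measurable_EFinP; exact: measurable_funM.
  apply: le_lt_trans rho_int; apply: ge0_le_integral => //.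
  - apply: measurableT_comp => //.
    by apply/measurable_EFinP; exact: measurable_funM.
  - by apply/measurable_EFinP; exact: measurable_funM.
  - move=> s /D_gt0 s0; rewrite /= lee_fin ger0_norm// mulr_ge0 ?rho_ge0//.
    by rewrite le_min ler01 ltW.
have iK : leb.-integrable D (fun s => K%:E * (Num.min 1 s * rho s)%:E)%E.
  exact: integrableZl.
apply: le_integrable iK => //.
  by apply/measurable_EFinP; exact: measurable_funM.
move=> s /D_gt0 s0 /=; rewrite lee_fin !normrM.
rewrite (ger0_norm (rho_ge0 s0)) mulrA ler_wpM2r ?rho_ge0//.
by apply: le_trans (fK _ s0) _; rewrite (ger0_norm K0) ler_wpM2l// ler_norm.
Qed.

(** The left side is at most 1 and at most u s; the constant 1 + u serves both s >= 1 and s < 1. *)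
Lemma psi_integrand_bound (u s : R) : 0 < u -> 0 < s ->
  `|1 - expR (- (u * s))| <= (1 + u) * Num.min 1 s.
Proof.
move=> u0 s0; have us0 : 0 < u * s by exact: mulr_gt0.
have e1 : expR (- (u * s)) <= 1 by rewrite -expR0 ler_expR oppr_le0 ltW.
rewrite ger0_norm ?subr_ge0//.
have h1 : 1 - expR (- (u * s)) <= u * s.
  by have := expR_ge1Dx (- (u * s)); lra.
have h2 : 1 - expR (- (u * s)) <= 1 by rewrite gerBl expR_ge0.
have [s1|s1] := leP 1 s; first by rewrite mulr1; lra.
by rewrite mulrDl mul1r; nra.
Qed.

(** For s >= 1, (u s)^q / q! <= exp(u s) gives the constant q! / u^q. For s < 1, s^q <= s because q
    >= 1, which accounts for the summand 1. *)
Lemma tau_integrand_bound q (u s : R) : (0 < q)%N -> 0 < u -> 0 < s ->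
  `|s ^+ q * expR (- (u * s))| <= (1 + q`!%:R / u ^+ q) * Num.min 1 s.
Proof.
case: q => // q _ u0 s0; have us0 : 0 < u * s by exact: mulr_gt0.
have e0 := expR_ge0 (- (u * s)).
have e1 : expR (- (u * s)) <= 1 by rewrite -expR0 ler_expR oppr_le0 ltW.
have uq : 0 < u ^+ q.+1 by exact: exprn_gt0.
have K0 : 0 <= q.+1`!%:R / u ^+ q.+1 by rewrite divr_ge0// ltW.
rewrite ger0_norm; last by rewrite mulr_ge0// exprn_ge0// ltW.
have [s1|s1] := leP 1 s.
  rewrite mulr1 -(ler_pM2l uq) mulrA -exprMn.
  have := expR_ge1Dxn q (ltW us0).
  move=> h; have {}h : (u * s) ^+ q.+1 <= q.+1`!%:R * expR (u * s).
    rewrite -ler_pdivrMl// mulrC; apply: le_trans h; first by rewrite lerDr.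
  have := ler_wpM2r e0 h; rewrite -mulrA -expRD subrr expR0 mulr1 => {}h.
  rewrite (le_trans h)// mulrDr mulrCA divff ?gt_eqF// !mulr1.
  by rewrite lerDr ltW.
rewrite mulrDl mul1r (le_trans _ (_ : s <= _))//; last first.
  by rewrite lerDl mulr_ge0// ltW.
rewrite -[leRHS]mulr1; apply: ler_pM => //; first by rewrite exprn_ge0 ?ltW.
by rewrite exprS ger_pMr// exprn_ile1// ltW.
Qed.

Let mexp (u : R) : measurable_fun D (fun s => expR (- (u * s))).
Proof.
apply: measurable_funTS; apply: continuous_measurable_fun => s.
apply: (@continuous_comp _ _ _ ( *%R u) (fun x => expR (- x))).
  exact: mulrl_continuous.
exact: continuous_expRN.
Qed.

Lemma psi_integrable (u : R) : 0 < u ->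
  leb.-integrable D (fun s => ((1 - expR (- (u * s))) * rho s)%:E).
Proof.
move=> u0; apply: (@levy_integrable _ (1 + u)).
- by apply: measurable_funB => //; exact: mexp.
- by rewrite addr_ge0// ltW.
- by move=> s; exact: psi_integrand_bound.
Qed.

Lemma tau_integrable q (u : R) : (0 < q)%N -> 0 < u ->
  leb.-integrable D (fun s => (s ^+ q * expR (- (u * s)) * rho s)%:E).
Proof.
move=> q0 u0; apply: (@levy_integrable _ (1 + q`!%:R / u ^+ q)).
- apply: measurable_funM; last exact: mexp.
  by apply: measurable_funTS; exact: exprn_measurable.
- by rewrite addr_ge0// divr_ge0// exprn_ge0// ltW.
- by move=> s; exact: tau_integrand_bound.
Qed.

Lemma psiE (u : R) : 0 < u ->
  (\int[leb]_(s in D) ((1 - expR (- (u * s))) * rho s)%:E = (psi rho u)%:E)%E.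
Proof.
move=> u0; rewrite /psi /Rintegral fineK//.
exact/integrable_fin_num/psi_integrable.
Qed.

Lemma tau_ge0 q (u : R) : 0 <= tau rho q u.
Proof.
rewrite /tau /Rintegral fine_ge0//; apply: integral_ge0 => s /D_gt0 s0.
by rewrite lee_fin mulr_ge0 ?rho_ge0// mulr_ge0 ?expR_ge0// exprn_ge0// ltW.
Qed.

End levy_integrals.

(** * Laplace transform of the mass of a set *)

Section laplace_random_measure.
Import HBNNSimple.
Local Open Scope ereal_scope.
Context d (T : measurableType d) d' (Y : measurableType d') (R : realType).
Variables (P : probability T R) (N : R.-ker T ~> (R * Y)%type).
Variables (a : R) (rho : R -> R) (P0 : probability Y R).
Hypothesis a_ge0 : (0 <= a)%R.
Local Notation D := (`]0%R, +oo[%classic : set R).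
Local Notation leb := (@lebesgue_measure R).
Hypothesis rho_meas : measurable_fun D rho.
Hypothesis rho_ge0 : forall s, (0 < s)%R -> (0 <= rho s)%R.
Hypothesis rho_int : (\int[leb]_(s in D) (Num.min 1 s * rho s)%:E < +oo)%E.
Hypothesis NP : poisson_random_measure P N (intensity a rho P0).
Variable A : set Y.
Hypothesis mA : measurable A.

Let D_gt0 (s : R) : D s -> (0 < s)%R.
Proof. by rewrite /= in_itv/= andbT. Qed.

(** Simple functions increasing to u s reduce this to the previous part. The integrals against [N w]
    and against the intensity converge monotonically; the expectation converges by domination with
    the constant 1. *)
Lemma laplace_random_measure (u : R) : (0 < u)%R ->
  \int[P]_w expeR (- (u%:E * \int[N w]_(p in D `*` A) p.1%:E)) =
  (expR (- (a * fine (P0 A) * psi rho u)))%:E.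
Proof.
move=> u0.
have mD : measurable D by exact: measurable_itv.
have mDA : measurable (D `*` A) by exact: measurableX.
have mf : measurable_fun D (fun s => (u * s)%:E).
  by apply/measurable_EFinP; exact: measurable_funM.
have f0 (s : R) : D s -> 0 <= (u * s)%:E.
  by move=> /D_gt0 s0; rewrite lee_fin mulr_ge0// ltW.
pose g := nnsfun_approx mD mf.
pose S n w := \int[N w]_(p in D `*` A) (g n p.1)%:E.
have mg1 n : measurable_fun setT (fun p : R * Y => (g n p.1)%:E).
  apply/measurable_EFinP; apply: (measurableT_comp (f := g n)) => //.
have mfst : measurable_fun (D `*` A) (fun p : R * Y => p.1%:E).
  by apply: measurable_funTS; apply/measurable_EFinP; exact: measurable_fst.
have Scvg w : S n w @[n --> \oo] --> u%:E * \int[N w]_(p in D `*` A) p.1%:E.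
  rewrite -ge0_integralZl_EFin//; last 2 first.
  - by move=> p [/D_gt0 p0 _]; rewrite lee_fin ltW.
  - exact: ltW.
  have -> : \int[N w]_(p in D `*` A) (u%:E * p.1%:E) =
      \int[N w]_(p in D `*` A) limn (fun n => (g n p.1)%:E).
    apply: eq_integral => p /set_mem[Dp _]; apply/esym/cvg_lim => //.
    by rewrite -EFinM; exact: (cvg_nnsfun_approx mD mf f0 Dp).
  apply: cvg_monotone_convergence => //.
  - by move=> n; exact: measurable_funTS (mg1 n).
  - by move=> n p _; rewrite lee_fin.
  - by move=> p _ m n mn; rewrite lee_fin; exact/lefP/nd_nnsfun_approx.
have S0 n w : 0 <= S n w by apply: integral_ge0 => p _; rewrite lee_fin.
have mS n : measurable_fun setT (S n).
  rewrite (_ : S n = fun w =>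
      \int[N w]_p ((fun p => (g n p.1)%:E) \_ (D `*` A)) p); last first.
    by apply/funext => w; rewrite /S integral_mkcond.
  apply: measurable_fun_integral_kernel.
  - by move=> U mU; exact: measurable_kernel.
  - by move=> p; apply: erestrict_ge0 => q _; rewrite lee_fin.
  - by apply/(measurable_restrictT _ _).1 => //; exact: measurable_funTS (mg1 n).
have lhs : \int[P]_w expeR (- S n w) @[n --> \oo] -->
    \int[P]_w expeR (- (u%:E * \int[N w]_(p in D `*` A) p.1%:E)).
  apply: (@dominated_cvg _ _ _ P setT measurableT (fun n w => expeR (- S n w))
    _ (cst 1)).
  - move=> n; apply: measurableT_comp measurable_expeR _.
    exact: measurableT_comp (mS n).
  - by move=> w _; exact: cvg_expeRN.
  - by [].
  - exact: (finite_measure_integrable_cst P 1 measurableT).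
  - by move=> n w _; rewrite gee0_abs ?expeR_ge0// expeRN_le1.
have rhs : expeR (- (\int[leb]_(s in D) ((1 - expR (- g n s)) * (a * rho s))%:E
    * P0 A)) @[n --> \oo] --> (expR (- (a * fine (P0 A) * psi rho u)))%:E.
  have P0f : P0 A \is a fin_num by rewrite fin_num_measure.
  have -> : (expR (- (a * fine (P0 A) * psi rho u)))%:E =
      expeR (- ((a * psi rho u)%:E * P0 A)).
    by rewrite -{2}(fineK P0f) -EFinM -EFinN /= mulrAC.
  have ge0 n s : D s -> 0 <= ((1 - expR (- g n s)) * (a * rho s))%:E.
    move=> /D_gt0 s0; rewrite lee_fin mulr_ge0 ?mulr_ge0 ?rho_ge0//.
    by rewrite subr_ge0 -expR0 ler_expR oppr_le0.
  apply: cvg_expeRN.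
    move=> n; rewrite mule_ge0//; apply: integral_ge0 => s Ds; exact: ge0.
  apply: cvgeZr => //.
  rewrite EFinM -psiE// -ge0_integralZl_EFin//; last 2 first.
  - move=> s /D_gt0 s0; rewrite lee_fin mulr_ge0 ?rho_ge0//.
    by rewrite subr_ge0 -expR0 ler_expR oppr_le0 mulr_ge0// ltW.
  - by have /integrableP[] := psi_integrable rho_meas rho_ge0 rho_int u0.
  have gcvg s : D s -> ((1 - expR (- g n s)) * (a * rho s))%:E @[n --> \oo] -->
      a%:E * ((1 - expR (- (u * s))) * rho s)%:E.
    move=> Ds; rewrite -EFinM mulrCA; apply: cvg_EFin; first exact: nearW.
    apply: cvgMl; apply: cvgB; first exact: cvg_cst.
    have := cvg_nnsfun_approx mD mf f0 Ds.
    move=> /fine_cvgP[_ gs].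
    apply: (cvg_comp (fun n => g n s) (fun x : R => expR (- x)) gs).
    exact: continuous_expRN.
  have -> : \int[leb]_(s in D) (a%:E * ((1 - expR (- (u * s))) * rho s)%:E) =
      \int[leb]_(s in D)
        limn (fun n => ((1 - expR (- g n s)) * (a * rho s))%:E).
    apply: eq_integral => s /set_mem Ds.
    by apply/esym/cvg_lim => //; exact: gcvg.
  apply: cvg_monotone_convergence => //.
  - move=> n; apply/measurable_EFinP; apply: measurable_funM; last first.
      exact: measurable_funM.
    apply: measurable_funB => //; apply: measurable_funTS.
    apply: (measurableT_comp (f := fun x : R => expR (- x))) => //.
      exact: continuous_measurable_fun continuous_expRN.
    exact: (measurable_funPT (g n)).
  - move=> s /[dup] Ds /D_gt0 s0 m n mn; rewrite lee_fin ler_wpM2r//.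
      by rewrite mulr_ge0// rho_ge0.
    rewrite lerD2l lerN2 ler_expR lerN2.
    by have /lefP := nd_nnsfun_approx mD mf mn; apply.
have := cvg_unique _ lhs; apply => //.
rewrite (_ : (fun n => _) = fun n => expeR (-
  (\int[leb]_(s in D) ((1 - expR (- g n s)) * (a * rho s))%:E * P0 A)))//.
by apply/funext => n; rewrite /S (laplace_random_nnsfun a_ge0 rho_meas rho_ge0 NP mA).
Qed.

End laplace_random_measure.

(** * Differentiating Laplace-type integrals in their parameter *)

Section laplace_integral_derivative.
Context d (W : measurableType d) (R : realType).
Variables (m : {measure set W -> \bar R}) (D : set W) (s g : W -> R).
Hypothesis mD : measurable D.
Hypothesis s_ge0 : forall y, D y -> 0 <= s y.

(* The constant b is 0 for moments and -1 for Laplace exponents. *)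
Lemma is_derive_laplace_integral (b : R) (n : nat) (a : R) : 0 < a ->
  (forall u, 0 < u -> m.-integrable D
     (fun y => ((b + s y ^+ n * expR (- (u * s y))) * g y)%:E)) ->
  (forall u, 0 < u -> m.-integrable D
     (fun y => (s y ^+ n.+1 * expR (- (u * s y)) * g y)%:E)) ->
  is_derive a 1
    (fun u => \int[m]_(y in D) ((b + s y ^+ n * expR (- (u * s y))) * g y))
    (- \int[m]_(y in D) (s y ^+ n.+1 * expR (- (a * s y)) * g y)).
Proof.
move=> a0 int0 int1.
pose f (u : R) y := (b + s y ^+ n * expR (- (u * s y))) * g y.
have df (u : R) y : is_derive u 1 (f ^~ y) (- (s y ^+ n.+1 * expR (- (u * s y)) * g y)).
  have -> : f ^~ y = (g y * s y ^+ n) \*: ((fun x : R => expR x) \o (- s y \*: id))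
      + cst (b * g y) :> (R -> R).
    apply/funext => v; rewrite /f !fctE /= /GRing.scale/=.
    by rewrite (_ : - s y * v = - (v * s y)); ring.
  apply: is_derive_eq.
  rewrite -[(_ \*: _) u]/(- s y * u) /GRing.scale/=.
  by rewrite (_ : - s y * u = - (u * s y)) ?exprS; ring.
have d1 (u : R) y : partial1of2 f u y = - (s y ^+ n.+1 * expR (- (u * s y)) * g y).
  by rewrite partial1of2E; exact: derive_val.
have a2 : 0 < a / 2 by rewrite divr_gt0.
have aI : `]a / 2, a * 2[%classic a by rewrite /= in_itv/=; apply/andP; lra.
have I_gt0 (u : R) : `]a / 2, a * 2[%classic u -> 0 < u.
  by rewrite /= in_itv/= => /andP[au _]; apply: lt_trans au.
(* As [s] is nonnegative, the derivative at any u in ]a/2, 2a[ is bounded by its absolute value at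
   the left endpoint, which is integrable by [int1]. *)
pose G y := `|s y ^+ n.+1 * expR (- (a / 2 * s y)) * g y|.
have key : [/\ forall x, `]a / 2, a * 2[%classic x -> m.-integrable D (EFin \o f x),
    forall x y, `]a / 2, a * 2[%classic x -> D y -> derivable (f ^~ y) x 1,
    forall y, 0 <= G y, m.-integrable D (EFin \o G) &
    forall x y, `]a / 2, a * 2[%classic x -> D y -> `|partial1of2 f x y| <= G y].
  split.
  - by move=> x /I_gt0 x0; exact: int0.
  - by move=> x y _ _; exact: ex_derive.
  - by move=> y; exact: normr_ge0.
  - exact: integrable_abse (int1 _ a2).
  - move=> x y; rewrite /= in_itv/= => /andP[ax _] Dy.
    rewrite d1 normrN /G !normrM ler_wpM2r// ler_wpM2l//.
    rewrite !ger0_norm ?expR_ge0// ler_expR lerN2 ler_wpM2r ?s_ge0//.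
    exact: ltW.
have [k1 k2 k3 k4 k5] := key.
apply: DeriveDef; first exact: (derivable_under_integral mD aI k1 k2 k3 k4 k5).
rewrite -derive1E (differentiation_under_integral mD aI k1 k2 k3 k4 k5).
under eq_Rintegral do rewrite d1 -mulN1r.
rewrite RintegralZl//; last exact: int1.
by rewrite mulN1r.
Qed.

End laplace_integral_derivative.

(** * Moments expressed through cumulants *)

Section levy_poly.
Context {R : realType}.

(* levy_poly t n is the n-th complete Bell polynomial in the cumulants
   x t_1, x t_2, ..., as a polynomial in x. The first argument of levy_poly_rec is
   fuel. *)
Fixpoint levy_poly_rec (t : nat -> R) (k n : nat) : {poly R} :=
  match k, n with
  | k.+1, n.+1 =>
    'X * \sum_(i < n.+1) ('C(n, i)%:R * t i.+1) *: levy_poly_rec t k (n - i)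
  | _, _ => 1
  end.

Definition levy_poly (t : nat -> R) (n : nat) := levy_poly_rec t n n.

Lemma levy_poly_recE t k n : (n <= k)%N -> levy_poly_rec t k n = levy_poly t n.
Proof.
rewrite /levy_poly.
have [N] := ubnP n; elim: N n k => // N ih [|n] [|k]//= nN nk.
congr (_ * _); apply: eq_bigr => i _; congr (_ *: _).
by rewrite !ih ?leq_subr// ?(leq_trans (leq_subr _ _))// (leq_ltn_trans (leq_subr _ _)).
Qed.

Lemma levy_poly0 t : levy_poly t 0 = 1.
Proof. by []. Qed.

Lemma levy_polyS t n : levy_poly t n.+1 =
  'X * \sum_(i < n.+1) ('C(n, i)%:R * t i.+1) *: levy_poly t (n - i).
Proof.
rewrite {1}/levy_poly /=; congr (_ * _); apply: eq_bigr => i _.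
by rewrite levy_poly_recE// leq_subr.
Qed.

Lemma coef0_levy_poly t n : (levy_poly t n)`_0 = (n == 0)%:R.
Proof. by case: n => [|n]; rewrite ?levy_poly0 ?coef1// levy_polyS coefXM. Qed.

(** Apart from i = n, every term of the recursion carries a Bell polynomial of positive index, which
    has no constant coefficient. The linear part of the n-th moment is therefore the n-th cumulant
    alone. *)
Lemma coef1_levy_poly t n : (levy_poly t n)`_1 = (n != 0)%:R * t n.
Proof.
case: n => [|n]; first by rewrite levy_poly0 coef1 mul0r.
rewrite levy_polyS coefXM/= coef_sum big_ord_recr/= subnn levy_poly0 binn.
rewrite coefZ coef1 !mul1r mulr1 big1 ?add0r// => i _.
by rewrite coefZ coef0_levy_poly subn_eq0 leqNgt ltn_ord mulr0.
Qed.

Variables (x : R) (Psi : R -> R) (t M : nat -> R -> R).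
Hypothesis dPsi : forall u : R, 0 < u -> is_derive u 1 Psi (t 1%N u).
Hypothesis dt : forall q (u : R), (0 < q)%N -> 0 < u ->
  is_derive u 1 (t q) (- t q.+1 u).
Hypothesis dM : forall n (u : R), 0 < u -> is_derive u 1 (M n) (- M n.+1 u).
Hypothesis M0 : forall u : R, 0 < u -> M 0 u = expR (- (x * Psi u)).

(** [M n] is (-1)^n times the n-th derivative of exp(-x Psi). The case n = 0 is the chain rule; each
    further case differentiates the preceding identity, which is Leibniz's rule in inductive
    form. *)
Let moment_recursion n u : 0 < u ->
  M n.+1 u = x * \sum_(i < n.+1) 'C(n, i)%:R * t i.+1 u * M (n - i) u.
Proof.
elim: n u => [|n ih] u u0.
  rewrite big_ord1 bin0 mul1r subn0.
  have d1 : is_derive u 1 (M 0) (- (x * t 1%N u) * M 0 u).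
    rewrite M0//.
    apply: (near_eq_is_derive (f := (fun y : R => expR y) \o (- x \*: Psi))).
      near=> v; rewrite M0; last by near: v; exact: lt_nbhsr.
      by rewrite !fctE /= /GRing.scale/= mulNr.
    have dP := dPsi u0.
    apply: is_derive_eq.
    rewrite -[(_ \*: _) u]/(- x * Psi u) /GRing.scale/= mulNr.
    by rewrite mulrC !mulNr.
  have d2 := dM 0 u0.
  have := @derive_val _ _ _ _ _ _ _ d1; rewrite (@derive_val _ _ _ _ _ _ _ d2).
  by rewrite mulNr => /oppr_inj ->; rewrite mulrA.
pose F := x \*: \sum_(i < n.+1) ('C(n, i)%:R \*: (t i.+1 * M (n - i)%N)) : R -> R.
have FE v : F v = x * \sum_(i < n.+1) 'C(n, i)%:R * t i.+1 v * M (n - i) v.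
  rewrite -[F v]/(x * (\sum_(i < n.+1)
    ('C(n, i)%:R \*: (t i.+1 * M (n - i)%N))) v) fct_sumE; congr (_ * _).
  by apply: eq_bigr => i _; rewrite -mulrA.
have d1 : is_derive u 1 (M n.+1) (x * \sum_(i < n.+1) 'C(n, i)%:R *
    (t i.+1 u * - M (n - i).+1 u + M (n - i) u * - t i.+2 u)).
  apply: (near_eq_is_derive (f := F)).
    near=> v; rewrite FE ih//; near: v; exact: lt_nbhsr.
  apply: is_deriveZ; apply: is_derive_sum => i; apply: is_deriveZ.
  by apply: is_deriveM; [exact: dt|exact: dM].
have := @derive_val _ _ _ _ _ _ _ d1.
rewrite (@derive_val _ _ _ _ _ _ _ (dM n.+1 u0)) => /(congr1 -%R).
rewrite opprK -mulrN => ->; congr (_ * _).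
(* Pascal's rule produces the two sums that the product rule gave: one with the derivative on [M],
   one with the derivative on [t]. *)
have -> : \sum_(i < n.+2) 'C(n.+1, i)%:R * t i.+1 u * M (n.+1 - i) u =
    \sum_(i < n.+2) 'C(n, i)%:R * t i.+1 u * M (n.+1 - i) u +
    \sum_(i < n.+1) 'C(n, i)%:R * t i.+2 u * M (n - i) u.
  rewrite big_ord_recl [in RHS]big_ord_recl !bin0 -addrA; congr (_ + _).
  rewrite -big_split; apply: eq_bigr => i _ /=; rewrite /bump/= !add1n.
  by rewrite binS natrD !mulrDl subSS.
rewrite [in RHS]big_ord_recr/= bin_small// !mul0r addr0 -big_split/=.
rewrite -sumrN; apply: eq_bigr => i _; rewrite -subSn ?leq_ord//; ring.
Unshelve. all: by end_near. Qed.

Lemma moment_levy_poly n u : 0 < u ->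
  M n u = (levy_poly (t ^~ u) n).[x] * M 0 u.
Proof.
have [N] := ubnP n; elim: N n => // N ih [|n] nN u0.
  by rewrite levy_poly0 hornerE mul1r.
rewrite levy_polyS moment_recursion// hornerM hornerX horner_sum -mulrA.
congr (_ * _); rewrite mulr_suml; apply: eq_bigr => i _.
by rewrite hornerZ -[RHS]mulrA -ih//; exact: leq_ltn_trans (leq_subr _ _) _.
Qed.

End levy_poly.

(** * Limits of psi, derivatives of psi and tau *)

Section psi_limits.
Context {R : realType}.
Variable rho : R -> R.
Local Notation D := (`]0%R, +oo[%classic : set R).
Local Notation leb := (@lebesgue_measure R).
Hypothesis rho_meas : measurable_fun D rho.
Hypothesis rho_ge0 : forall s : R, 0 < s -> 0 <= rho s.
Hypothesis rho_int : (\int[leb]_(s in D) (Num.min 1 s * rho s)%:E < +oo)%E.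

Let D_gt0 (s : R) : D s -> 0 < s.
Proof. by rewrite /= in_itv/= andbT. Qed.

(** Makes the total mass of a CRM almost surely finite. The integrand at u = 1 dominates, since 1 /
    (n + 1) <= 1. *)
Lemma psi_cvg0 : psi rho n.+1%:R^-1 @[n --> \oo] --> 0.
Proof.
suff : (psi rho n.+1%:R^-1)%:E @[n --> \oo] --> 0%E by move=> /fine_cvgP[].
rewrite (_ : (fun n => _) = (fun n =>
  \int[leb]_(s in D) ((1 - expR (- (n.+1%:R^-1 * s))) * rho s)%:E)%E); last first.
  by apply/funext => n; rewrite (psiE rho_meas rho_ge0 rho_int).
rewrite [X in _ --> X](_ : _ = \int[leb]_(s in D) (0 * rho s)%:E)%E; last first.
  by apply/esym/integral0_eq => s _; rewrite mul0r.
have i1 := psi_integrable rho_meas rho_ge0 rho_int (@ltr01 R).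
apply: (@dominated_cvg _ _ _ leb D (measurable_itv _) _ _
  (fun s => ((1 - expR (- (1 * s))) * rho s)%:E)).
- move=> n; have n0 : 0 < n.+1%:R^-1 :> R by [].
  by have /integrableP[] := psi_integrable rho_meas rho_ge0 rho_int n0.
- move=> s Ds; apply: cvg_EFin; first exact: nearW.
  apply: cvgM; last exact: cvg_cst.
  rewrite -[X in _ --> X](subrr (1 : R)).
  apply: cvgB; first exact: cvg_cst.
  have ns : - (n.+1%:R^-1 * s) @[n --> \oo] --> (0 : R).
    rewrite -oppr0 -[in X in _ --> X](mul0r s).
    by apply: cvgN; apply: cvgM; [exact: (@cvg_harmonic R)|exact: cvg_cst].
  rewrite -[X in _ --> X](@expR0 R).
  apply: (cvg_comp (fun n => - (n.+1%:R^-1 * s)) (@expR R) ns).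
  exact: continuous_expR.
- by [].
- exact: i1.
- move=> n s /D_gt0 s0; rewrite gee0_abs lee_fin; last first.
    rewrite mulr_ge0 ?rho_ge0// subr_ge0 -expR0 ler_expR oppr_le0.
    by rewrite mulr_ge0// ltW.
  rewrite ler_wpM2r ?rho_ge0// lerD2l lerN2 ler_expR lerN2 ler_wpM2r ?(ltW s0)//.
  by rewrite invf_le1// ler1n.
Qed.

(** Makes the total mass almost surely positive: the integrand increases to rho, whose integral is
    infinite. *)
Lemma psi_cvgy : (\int[leb]_(s in D) (rho s)%:E = +oo)%E ->
  (psi rho n.+1%:R)%:E @[n --> \oo] --> +oo%E.
Proof.
move=> rhoy.
rewrite (_ : (fun n => _) = (fun n =>
  \int[leb]_(s in D) ((1 - expR (- (n.+1%:R * s))) * rho s)%:E)%E); last first.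
  by apply/funext => n; rewrite (psiE rho_meas rho_ge0 rho_int).
rewrite -rhoy.
have c s : D s -> ((1 - expR (- (n.+1%:R * s))) * rho s)%:E @[n --> \oo] -->
    (rho s)%:E.
  move=> /D_gt0 s0; apply: cvg_EFin; first exact: nearW.
  rewrite -[X in _ --> X]mul1r; apply: cvgM; last exact: cvg_cst.
  rewrite -[X in _ --> X](subr0 (1 : R)).
  apply: cvgB; first exact: cvg_cst.
  have ns : n.+1%:R * s @[n --> \oo] --> +oo.
    have nn : (n.+1%:R : R) @[n --> \oo] --> +oo.
      by rewrite (cvg_shiftS (fun n => n%:R : R)); exact: cvgr_idn.
    by apply/cvgryPge => A; move/cvgryPge : nn => /(_ (A / s)); apply: filterS => n; rewrite ler_pdivrMr.
  exact: (cvg_comp (fun n => n.+1%:R * s) (fun x : R => expR (- x)) ns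
    (@cvgr_expR R)).
have -> : (\int[leb]_(s in D) (rho s)%:E = \int[leb]_(s in D)
    limn (fun n => ((1 - expR (- (n.+1%:R * s))) * rho s)%:E))%E.
  apply: eq_integral => s /set_mem Ds.
  by apply/esym/cvg_lim => //; exact: c.
apply: cvg_monotone_convergence => //.
- move=> n; have n0 : 0 < n.+1%:R :> R by [].
  by have /integrableP[] := psi_integrable rho_meas rho_ge0 rho_int n0.
- move=> n s /D_gt0 s0; rewrite lee_fin.
  rewrite mulr_ge0 ?rho_ge0// subr_ge0 -expR0 ler_expR oppr_le0.
  by rewrite mulr_ge0// ltW.
- move=> s /D_gt0 s0 n m nm; rewrite lee_fin.
  rewrite ler_wpM2r ?rho_ge0// lerD2l lerN2 ler_expR lerN2 ler_wpM2r ?(ltW s0)//.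
  by rewrite ler_nat.
Qed.

Lemma is_derive_psi (u : R) : 0 < u -> is_derive u 1 (psi rho) (tau rho 1 u).
Proof.
move=> u0.
(* This is -psi near [u], in the shape of [is_derive_laplace_integral] with b = -1 and n = 0. *)
pose F u := \int[leb]_(s in D) ((- 1 + s ^+ 0 * expR (- (u * s))) * rho s).
have int0 (v : R) : 0 < v -> leb.-integrable D
    (fun s => ((- 1 + s ^+ 0 * expR (- (v * s))) * rho s)%:E).
  move=> v0; have i1 := psi_integrable rho_meas rho_ge0 rho_int v0.
  have : leb.-integrable D
      (fun s => (-1)%:E * ((1 - expR (- (v * s))) * rho s)%:E)%E.
    exact: integrableZl.
  apply: eq_integrable => // s _; rewrite -EFinM mul1r mulrA mulN1r opprB.
  by rewrite addrC.
have int1 (v : R) : 0 < v -> leb.-integrable D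
    (fun s => (s ^+ 1 * expR (- (v * s)) * rho s)%:E).
  by move=> v0; exact: tau_integrable.
have dF : is_derive u 1 F (- tau rho 1 u).
  apply: is_derive_laplace_integral => //.
  by move=> s /D_gt0 /ltW.
apply: (near_eq_is_derive (f := - F)).
  near=> v; have v0 : 0 < v by near: v; exact: lt_nbhsr.
  transitivity (-1 * F v); first by rewrite mulN1r.
  rewrite /F -RintegralZl//; last exact: int0.
  by apply: eq_Rintegral => s _; rewrite mul1r mulrA mulN1r opprD opprK.
rewrite -[X in is_derive _ _ _ X]opprK; exact: is_deriveN.
Unshelve. all: by end_near. Qed.

Lemma is_derive_tau q (u : R) : (0 < q)%N -> 0 < u ->
  is_derive u 1 (tau rho q) (- tau rho q.+1 u).
Proof.
move=> q0 u0; rewrite (_ : tau rho q = fun u =>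
    \int[leb]_(s in D) ((0 + s ^+ q * expR (- (u * s))) * rho s)).
  apply: is_derive_laplace_integral => //.
  - by move=> s /D_gt0 /ltW.
  - move=> v v0; have := tau_integrable rho_meas rho_ge0 rho_int q0 v0.
    by apply: eq_integrable => // s _; rewrite add0r.
  - by move=> v v0; exact: tau_integrable.
by apply/funext => v; apply: eq_Rintegral => s _; rewrite add0r.
Qed.

End psi_limits.

(** One term of the exponential series: (u s)^n / n! <= exp(u s). The bound is uniform in [s], so
    tilted moments of any nonnegative variable are finite. *)
Lemma exp_moment_bound (R : realType) n (u s : R) : 0 < u -> 0 <= s ->
  s ^+ n * expR (- (u * s)) <= n`!%:R / u ^+ n.
Proof.
move=> u0 s0; have us0 : 0 <= u * s by rewrite mulr_ge0// ltW.
have un : 0 < u ^+ n by exact: exprn_gt0.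
have f0 : 0 < n`!%:R :> R by rewrite ltr0n fact_gt0.
rewrite ler_pdivlMr// (_ : _ * _ * _ = (u * s) ^+ n * expR (- (u * s))); last first.
  by rewrite exprMn; ring.
rewrite expRN ler_pdivrMr ?expR_gt0// -ler_pdivrMl// mulrC.
case: n {un f0} => [|n]; first by rewrite expr0 fact0 divr1 -expR0 ler_expR.
by apply: le_trans (expR_ge1Dxn n us0); rewrite lerDr.
Qed.

(** * A single CRM: finite total mass and tilted moments *)

Section crm.
Context d (T : measurableType d) d' (Y : measurableType d') (R : realType).
Variables (P : probability T R) (mu : R.-ker T ~> Y).
Variables (a : R) (rho : R -> R) (P0 : probability Y R).
Hypothesis a_ge0 : 0 <= a.
Local Notation D := (`]0%R, +oo[%classic : set R).
Local Notation leb := (@lebesgue_measure R).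
Hypothesis rho_meas : measurable_fun D rho.
Hypothesis rho_ge0 : forall s : R, 0 < s -> 0 <= rho s.
Hypothesis rho_int : (\int[leb]_(s in D) (Num.min 1 s * rho s)%:E < +oo)%E.
Hypothesis crm : poissonian_crm P a rho P0 mu.

Lemma crm_laplace (A : set Y) (u : R) : measurable A -> 0 < u ->
  (\int[P]_w expeR (- (u%:E * mu w A)) =
   (expR (- (a * fine (P0 A) * psi rho u)))%:E)%E.
Proof.
move=> mA u0; have [_ [N [NP muN]]] := crm.
rewrite -(laplace_random_measure a_ge0 rho_meas rho_ge0 rho_int NP mA u0).
by apply: eq_integral => w _; rewrite muN.
Qed.

Let F := [set w | mu w setT = +oo%E].

Let mF : measurable F.
Proof.
have mk : measurable_fun setT (fun w => mu w setT) by exact: measurable_kernel.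
by rewrite -[F]setTI; exact: mk (emeasurable_set1 _).
Qed.

(** exp(-u mu) vanishes where the total mass is infinite, so that event has probability at most 1 -
    exp(-a psi(u)) <= a psi(u), which tends to 0 as u decreases to 0. *)
Lemma crm_ae_finite : P [set w | mu w setT = +oo%E] = 0%E.
Proof.
have PFf : P F \is a fin_num by rewrite fin_num_measure.
have bound (u : R) : 0 < u -> fine (P F) <= a * psi rho u.
  move=> u0.
  have : (expR (- (a * psi rho u)) <= fine (P (~` F)))%R.
    rewrite -lee_fin fineK ?fin_num_measure//; last exact: measurableC.
    have := crm_laplace measurableT u0.
    rewrite probability_setT /= mulr1 => <-.
    have PE : P (~` F) = (\int[P]_w (\1_(~` F) w)%:E)%E.
      by rewrite integral_indic ?setIT//; exact: measurableC.
    rewrite PE.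
    apply: ge0_le_integral => //.
    - by move=> w _; exact: expeR_ge0.
    - have mk : measurable_fun setT (fun w => mu w setT) by exact: measurable_kernel.
      exact: measurableT_comp (measurable_laplace u) mk.
    - by apply/measurable_EFinP; apply: measurable_indic; exact: measurableC.
    - move=> w _; rewrite indicE.
      have [Fw|Fw] := pselect (F w).
        by rewrite Fw memNset ?gt0_muley ?lte_fin//=; apply.
      by rewrite mem_set// expeRN_le1// mule_ge0// lee_fin ltW.
  have -> : fine (P (~` F)) = 1 - fine (P F).
    by rewrite probability_setC// fineB.
  have := expR_ge1Dx (- (a * psi rho u)); lra.
have PF0 : fine (P F) <= 0.
  have -> : 0 = a * 0 :> R by rewrite mulr0.
  have c : a * psi rho n.+1%:R^-1 @[n --> \oo] --> a * 0.
    apply: cvgM; first exact: cvg_cst.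
    exact: psi_cvg0.
  have cl : limn (fun n => a * psi rho n.+1%:R^-1) = a * 0 by exact/cvg_lim.
  rewrite -cl; apply: limr_ge; first by apply/cvg_ex; eexists; exact: c.
  by apply: nearW => n; apply: bound.
rewrite -[LHS](fineK PFf); congr (_%:E); apply/eqP.
by rewrite eq_le PF0/= fine_ge0.
Qed.

Variable A : set Y.
Hypothesis mA : measurable A.
Let S w : R := fine (mu w A).

Let mS : measurable_fun setT S.
Proof.
have mk : measurable_fun setT (fun w => mu w A) by exact: measurable_kernel.
by apply: measurableT_comp => //.
Qed.

Let S0 w : 0 <= S w. Proof. exact: fine_ge0. Qed.

Lemma measurable_exp_moment n (u : R) :
  measurable_fun setT (fun w => (S w ^+ n * expR (- (u * S w)))).
Proof.
apply: measurable_funM.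
  by apply: (measurableT_comp (f := fun x : R => x ^+ n)) => //; exact: exprn_measurable.
apply: (measurableT_comp (f := fun x : R => expR (- (u * x)))) => //.
apply: continuous_measurable_fun => s.
apply: (@continuous_comp _ _ _ ( *%R u) (fun x => expR (- x))).
  exact: mulrl_continuous.
exact: continuous_expRN.
Qed.

Let iS n (u : R) : 0 < u ->
  P.-integrable setT (fun w => (S w ^+ n * expR (- (u * S w)))%:E).
Proof.
move=> u0.
have ic := finite_measure_integrable_cst P (n`!%:R / u ^+ n) measurableT.
apply: le_integrable ic => //.
  by apply/measurable_EFinP; exact: measurable_exp_moment.
move=> w _ /=; rewrite lee_fin !ger0_norm ?exp_moment_bound//.
  by rewrite divr_ge0// exprn_ge0// ltW.
by rewrite mulr_ge0 ?expR_ge0// exprn_ge0.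
Qed.

(** [moment_levy_poly] with x = P0(A): all cumulants of the mass of [A] are proportional to P0(A),
    which becomes the variable of the polynomial. *)
Lemma crm_moment n (u : R) : 0 < u ->
  (\int[P]_w (S w ^+ n * expR (- (u * S w)))%:E =
   ((levy_poly (fun q => a * tau rho q u) n).[fine (P0 A)] *
    expR (- (fine (P0 A) * (a * psi rho u))))%:E)%E.
Proof.
move=> u0.
pose M n (u : R) := \int[P]_w (S w ^+ n * expR (- (u * S w))).
have ME n' (v : R) : 0 < v ->
    (\int[P]_w (S w ^+ n' * expR (- (v * S w)))%:E = (M n' v)%:E)%E.
  by move=> v0; rewrite /M /Rintegral fineK//; exact/integrable_fin_num/iS.
rewrite ME//; congr (_%:E).
have M0 (v : R) : 0 < v -> M 0 v = expR (- (fine (P0 A) * (a * psi rho v))).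
  move=> v0; apply/EFin_inj; rewrite -ME//.
  rewrite (_ : fine (P0 A) * (a * _) = a * fine (P0 A) * psi rho v); last by ring.
  rewrite -crm_laplace//; apply: ge0_ae_eq_integral => //.
  - by apply/measurable_EFinP; exact: measurable_exp_moment.
  - have mk : measurable_fun setT (fun w => mu w A) by exact: measurable_kernel.
    exact: measurableT_comp (measurable_laplace v) mk.
  - by move=> w _; rewrite lee_fin mulr_ge0 ?expR_ge0// exprn_ge0.
  - by move=> w _; exact: expeR_ge0.
  (* [S] and the mass of [A] can differ only where [fine] replaces an infinite value by 0, and this
     happens inside the null set [F]. *)
  - exists F; split => //; first exact: crm_ae_finite.
    move=> w /= /not_implyP[_]; apply: contra_notP => Fw.
    rewrite expr0 mul1r.
    have mwA : mu w A \is a fin_num.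
      rewrite ge0_fin_numE// (@le_lt_trans _ _ (mu w setT))//.
        by rewrite le_measure// inE.
      by rewrite ltey; apply/eqP.
    by rewrite -[in RHS](fineK mwA).
rewrite -M0//.
apply: (@moment_levy_poly _ (fine (P0 A)) (fun v => a * psi rho v)
  (fun q v => a * tau rho q v) M) => //.
- move=> v v0; apply: is_deriveZ; exact: is_derive_psi.
- move=> q v q0 v0; rewrite -mulrN; apply: is_deriveZ; exact: is_derive_tau.
- move=> k v v0.
  have H := @is_derive_laplace_integral _ _ _ P setT S (cst 1) measurableT
    (fun w _ => S0 w) 0 k v v0.
  rewrite (_ : M k = fun u =>
      \int[P]_w ((0 + S w ^+ k * expR (- (u * S w))) * cst 1 w)); last first.
    by apply/funext => r; apply: eq_Rintegral => w _; rewrite add0r mulr1.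
  rewrite (_ : M k.+1 v =
      \int[P]_w (S w ^+ k.+1 * expR (- (v * S w)) * cst 1 w)); last first.
    by apply: eq_Rintegral => w _; rewrite mulr1.
  apply: H => r r0.
    by under eq_fun do rewrite add0r mulr1; exact: iS.
  by under eq_fun do rewrite mulr1; exact: iS.
Qed.

End crm.

(** * Gamma integrals *)

Section gamma_integral.
Context {R : realType}.
Local Notation D := (`]0%R, +oo[%classic : set R).
Local Notation leb := (@lebesgue_measure R).

Let D_gt0 (s : R) : D s -> 0 < s.
Proof. by rewrite /= in_itv/= andbT. Qed.

Let mexp n (M : R) : measurable_fun D (fun u => u ^+ n * expR (- (M * u))).
Proof.
apply: measurable_funTS; apply: measurable_funM; first exact: exprn_measurable.
apply: continuous_measurable_fun => s.
apply: (@continuous_comp _ _ _ ( *%R M) (fun x => expR (- x))).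
  exact: mulrl_continuous.
exact: continuous_expRN.
Qed.

Let mexp0 (M : R) : measurable_fun D (fun u => (expR (- (M * u)))%:E).
Proof.
apply/measurable_EFinP; apply: eq_measurable_fun (mexp 0 M) => u _.
by rewrite expr0 mul1r.
Qed.

Let exp_integral (M : R) : 0 < M ->
  (\int[leb]_(u in D) (expR (- (M * u)))%:E = M^-1%:E)%E.
Proof.
move=> M0.
have mf := mexp0 M.
have := integral_exponential_pdf M0.
rewrite /exponential_pdf.
rewrite [X in X = _ -> _](_ : _ =
    \int[leb]_(u in `[0%R, +oo[) (M * expR (- M * u))%:E)%E; last first.
  rewrite [RHS]integral_mkcond; apply: eq_integral => u _.
  by rewrite !patchE; case: ifP.
rewrite -integral_itv_obnd_cbnd; last first.
  apply: (eq_measurable_fun (fun u => M%:E * (expR (- (M * u)))%:E)%E).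
    by move=> u _; rewrite -EFinM mulNr.
  exact: measurable_funeM.
under eq_integral do rewrite EFinM mulNr.
rewrite ge0_integralZl//; last by rewrite lee_fin ltW.
move=> /(congr1 (fun x => M^-1%:E * x)%E).
by rewrite mule1 muleA -EFinM mulVf ?gt_eqF// mul1e.
Qed.

Let iexp n (M : R) : 0 < M ->
  leb.-integrable D (fun u => (u ^+ n * expR (- (M * u)))%:E).
Proof.
move=> M0; have M2 : 0 < M / 2 by rewrite divr_gt0.
have K0 : 0 <= n`!%:R / (M / 2) ^+ n :> R.
  by rewrite divr_ge0// exprn_ge0// ltW.
have mf := mexp0.
apply/integrableP; split; first by apply/measurable_EFinP; exact: mexp.
apply: (@le_lt_trans _ _ (\int[leb]_(u in D)
    ((n`!%:R / (M / 2) ^+ n)%:E * (expR (- (M / 2 * u)))%:E))%E).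
  apply: ge0_le_integral => //.
  - by apply: measurableT_comp => //; apply/measurable_EFinP; exact: mexp.
  - exact: measurable_funeM (mf (M / 2)).
  - move=> u /D_gt0 u0; rewrite -EFinM /= lee_fin.
    rewrite ger0_norm; last by rewrite mulr_ge0 ?expR_ge0// exprn_ge0// ltW.
    (* Half of the exponent absorbs the power of u through [exp_moment_bound]; the other half
       remains integrable. *)
    rewrite (_ : - (M * u) = - (M / 2 * u) + - (M / 2 * u)); last by field.
    rewrite expRD mulrA ler_wpM2r ?expR_ge0//.
    by apply: exp_moment_bound => //; exact: ltW.
rewrite ge0_integralZl//.
  by rewrite exp_integral// -EFinM ltry.
exact: mf.
Qed.

(** Differentiating in [M] brings down a factor -u, which gives the induction step; the case n = 0
    is the normalization of the exponential density. *)
Lemma gamma_integral n (M : R) : 0 < M ->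
  (\int[leb]_(u in D) (u ^+ n * expR (- (M * u)))%:E =
   (n`!%:R / M ^+ n.+1)%:E)%E.
Proof.
pose F n M := \int[leb]_(u in D) (u ^+ n * expR (- (M * u))).
have FE k (N : R) : 0 < N ->
    (\int[leb]_(u in D) (u ^+ k * expR (- (N * u)))%:E = (F k N)%:E)%E.
  by move=> N0; rewrite /F /Rintegral fineK//; exact/integrable_fin_num/iexp.
suff H k : forall N, 0 < N -> F k N = k`!%:R / N ^+ k.+1.
  by move=> M0; rewrite FE// H.
elim: k => [N N0|k ih N N0].
  apply: EFin_inj; rewrite -FE// fact0 expr1 div1r -exp_integral//.
  by apply: eq_integral => u _; rewrite mul1r.
have dF : is_derive N 1 (F k) (- F k.+1 N).
  have H := @is_derive_laplace_integral _ _ _ leb D id (cst 1)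
    (measurable_itv _) (fun u Du => ltW (D_gt0 Du)) 0 k N N0.
  rewrite (_ : F k = fun v =>
      \int[leb]_(u in D) ((0 + u ^+ k * expR (- (v * u))) * cst 1 u)); last first.
    by apply/funext => r; apply: eq_Rintegral => w _; rewrite add0r mulr1.
  rewrite (_ : F k.+1 N =
      \int[leb]_(u in D) (u ^+ k.+1 * expR (- (N * u)) * cst 1 u)); last first.
    by apply: eq_Rintegral => w _; rewrite mulr1.
  apply: H => r r0.
    by apply: eq_integrable (iexp k r0) => // u _; rewrite add0r mulr1.
  by apply: eq_integrable (iexp k.+1 r0) => // u _; rewrite mulr1.
have dG : is_derive N 1 (F k) (- (k.+1`!%:R / N ^+ k.+2)).
  have pE (v : R) : ((id : R -> R) ^+ k.+1) v = v ^+ k.+1.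
    by elim: (k.+1) => // j jh; rewrite !exprS -jh.
  apply: (near_eq_is_derive (f := (k`!%:R : R) \*:
      (fun v => (((id : R -> R) ^+ k.+1) v)^-1))).
    near=> v; rewrite ih; first by rewrite -pE.
    near: v; exact: lt_nbhsr.
  have NK : N ^+ k.+1 != 0 by rewrite expf_neq0// gt_eqF.
  have NK' : ((id : R -> R) ^+ k.+1) N != 0 by rewrite pE.
  apply: is_derive_eq; rewrite pE /GRing.scale/= factS natrM !exprS.
  by field; rewrite expf_neq0 gt_eqF.
have := @derive_val _ _ _ _ _ _ _ dF; rewrite (@derive_val _ _ _ _ _ _ _ dG).
by move=> /oppr_inj.
Unshelve. all: by end_near. Qed.

Lemma GammaE n : Gamma (n.+1%:R : R) = n`!%:R.
Proof.
apply: EFin_inj.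
transitivity (\int[leb]_(u in D) (u ^+ n * expR (- (1 * u)))%:E)%E; last first.
  by rewrite gamma_integral// expr1n divr1.
rewrite /Gamma /Rintegral.
rewrite (_ : (\int[leb]_(t in D) _)%E =
    \int[leb]_(u in D) (u ^+ n * expR (- (1 * u)))%:E)%E.
  by rewrite fineK// gamma_integral.
apply: eq_integral => u /set_mem/D_gt0 u0; rewrite mul1r; congr (_ * _)%:E.
by rewrite -natr1 addrK powR_mulrn// ltW.
Qed.

End gamma_integral.

(** * Sums over injective assignments of cells, as the cells become small *)

Section distinct_cell_sums.
Context {R : realType}.

Lemma poly_bound01 (p : {poly R}) : p`_0 = 0 ->
  exists2 C, 0 <= C & forall x, 0 <= x <= 1 ->
    `|p.[x]| <= C * x /\ `|p.[x] - p`_1 * x| <= C * x ^+ 2.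
Proof.
(* The constant is the sum of the absolute coefficients; the range [(size p).+2] guarantees that the
   indices 0 and 1 can be split off even for short [p]. *)
move=> p0; exists (\sum_(i < (size p).+2) `|p`_i|); first exact: sumr_ge0.
move=> x /andP[x0 x1].
have pE : p.[x] = \sum_(i < (size p).+2) p`_i * x ^+ i.
  by rewrite (horner_coef_wide _ (leqW (leqnSn _))).
split.
  rewrite pE (le_trans (ler_norm_sum _ _ _))// mulr_suml; apply: ler_sum => i _.
  rewrite normrM (ger0_norm (exprn_ge0 _ x0)).
  case: i => -[|i] /= _; first by rewrite p0 normr0 !mul0r.
  by rewrite ler_wpM2l// exprS ler_piMr// exprn_ile1.
rewrite pE big_ord_recl big_ord_recl /= p0 mul0r add0r expr1 addrC addKr.
rewrite [in leRHS]big_ord_recl [in leRHS]big_ord_recl/= p0 normr0 add0r.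
rewrite (le_trans (ler_norm_sum _ _ _))// mulrDl.
rewrite (@le_trans _ _ (\sum_(i < size p) `|p`_(bump 0 (bump 0 i))| * x ^+ 2))//.
  apply: ler_sum => i _; rewrite normrM (ger0_norm (exprn_ge0 _ x0)).
  rewrite ler_wpM2l// /bump/= !add1n exprS exprS expr2 mulrA.
  by rewrite ler_piMr ?mulr_ge0// exprn_ile1.
by rewrite -mulr_suml lerDr mulr_ge0// exprn_ge0.
Qed.

Variable I : finType.

Section fixed_weights.
Variables (K : finType) (x : K -> R).
Hypothesis x_ge0 : forall k, 0 <= x k.
Hypothesis x_sum1 : \sum_k x k = 1.

(** If the cells b(i) are drawn independently with law [x], both sides are the probability that b(r)
    and b(r') coincide. *)
Lemma sum_coincidence (r r' : I) : r != r' ->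
  \sum_(b : {ffun I -> K} | b r == b r') \prod_i x (b i) = \sum_k x k ^+ 2.
Proof.
move=> rr'.
(* The weights [F k] force both [r] and [r'] into cell [k] and keep the product form, so the sum
   over [b] factorizes again. *)
pose F k i j := if (i == r) || (i == r') then (j == k)%:R * x j else x j.
have FE k (b : {ffun I -> K}) : \prod_i F k i (b i) =
    ((b r == k) && (b r' == k))%:R * \prod_i x (b i).
  have r'r : r' != r by rewrite eq_sym.
  rewrite (bigD1 r)//= (bigD1 r')//= [in RHS](bigD1 r)//= [in RHS](bigD1 r')//=.
  rewrite /F !eqxx orbT/=.
  under eq_bigr => i /andP[/negbTE-> /negbTE->] do rewrite /=.
  by rewrite -mulnb natrM; ring.
transitivity (\sum_k \sum_(b : {ffun I -> K}) \prod_i F k i (b i)).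
  rewrite exchange_big/= big_mkcond; apply: eq_bigr => b _.
  rewrite (eq_bigr _ (fun k _ => FE k b)) -mulr_suml (bigD1 (b r))//= eqxx/= [X in _ + X]big1 ?addr0.
    by rewrite [b r' == _]eq_sym; case: (b r == b r'); rewrite ?mul1r ?mul0r.
  by move=> k; rewrite eq_sym => /negbTE ->.
apply: eq_bigr => k _.
rewrite -(bigA_distr_bigA (F k)) (bigD1 r)//= (bigD1 r')/=; last by rewrite eq_sym.
rewrite [X in _ * (_ * X)]big1 ?mulr1; last first.
  by move=> i /andP[/negbTE ir /negbTE ir']; rewrite /F ir ir'.
have S i : (i == r) || (i == r') -> \sum_j F k i j = x k.
  move=> ii; rewrite /F ii (bigD1 k)//= eqxx mul1r big1 ?addr0//.
  by move=> j /negbTE ->; rewrite mul0r.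
by rewrite !S ?eqxx ?orbT// expr2.
Qed.

(** The product of sums is the sum over all [b], so the error is carried by the non-injective ones.
    A union bound over ordered pairs, at most #|I|^2 of them, controls it by coincidence
    probabilities. *)
Lemma distinct_cell_sum_bound (Q : I -> {poly R}) (C : R) :
  0 <= C ->
  (forall r k, `|(Q r).[x k]| <= C * x k) ->
  `|\sum_(b : {ffun I -> K} | injectiveb b) \prod_r (Q r).[x (b r)] -
    \prod_r \sum_k (Q r).[x k]| <=
  (#|I| ^ 2)%:R * C ^+ #|I| * \sum_k x k ^+ 2.
Proof.
move=> C0 QC; rewrite bigA_distr_bigA/= [X in _ - X](bigID (fun b : {ffun I -> K} => injectiveb b))/=.
rewrite opprD addrA subrr sub0r normrN (le_trans (ler_norm_sum _ _ _))//.
have B (b : {ffun I -> K}) :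
    `|\prod_r (Q r).[x (b r)]| <= C ^+ #|I| * \prod_r x (b r).
  rewrite -prodr_const -big_split normr_prod/=.
  by apply: ler_prod => r _; rewrite normr_ge0 QC.
rewrite (le_trans (ler_sum _ (fun b _ => B b)))// -mulr_sumr.
rewrite -mulrA mulrCA ler_wpM2l ?exprn_ge0//.
have x2 : 0 <= \sum_k x k ^+ 2 by apply: sumr_ge0 => k _; exact: exprn_ge0.
have pge b : 0 <= \prod_i x (b i) by apply: prodr_ge0.
apply: (@le_trans _ _ (\sum_(b : {ffun I -> K}) \sum_(p : I * I | p.1 != p.2)
    (b p.1 == b p.2)%:R * \prod_i x (b i))).
  rewrite big_mkcond/=; apply: ler_sum => b _.
  case: ifPn => [/injectivePn[r [r' rr' brr']]|_]; last first.
    by apply: sumr_ge0 => p _; rewrite mulr_ge0.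
  rewrite (bigD1 (r, r'))//= brr' eqxx mul1r lerDl.
  by apply: sumr_ge0 => p _; rewrite mulr_ge0.
rewrite exchange_big/= mulr_natl.
rewrite (@le_trans _ _ (\sum_(p : I * I | p.1 != p.2) \sum_k x k ^+ 2))//.
  apply: ler_sum => p pp; rewrite -(sum_coincidence pp) [leRHS]big_mkcond/=.
  by apply: ler_sum => b _; case: eqP; rewrite ?mul1r ?mul0r.
rewrite sumr_const ler_wpMn2l// (leq_trans (max_card _))//.
by rewrite card_prod expnS expn1.
Qed.

End fixed_weights.

(** Each factor sum_k Q_r(x_k) equals the linear coefficient, because the x_k sum to 1, up to an
    error of order sum_k x_k^2. The restriction to injective [b] costs an error of the same
    order. *)
Lemma cvg_distinct_cell_sum (K : nat -> finType) (x : forall m, K m -> R)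
    (Q : I -> {poly R}) :
  (forall m k, 0 <= x m k) -> (forall m, \sum_k x m k = 1) ->
  (\sum_k x m k ^+ 2) @[m --> \oo] --> 0 ->
  (forall r, (Q r)`_0 = 0) ->
  (\sum_(b : {ffun I -> K m} | injectiveb b) \prod_r (Q r).[x m (b r)])
    @[m --> \oo] --> \prod_r (Q r)`_1.
Proof.
move=> x0 x1 x20 Q0.
have /choice[c hc] : forall r, exists C, 0 <= C /\ forall x, 0 <= x <= 1 ->
    `|(Q r).[x]| <= C * x /\ `|(Q r).[x] - (Q r)`_1 * x| <= C * x ^+ 2.
  by move=> r; have [C] := poly_bound01 (Q0 r); exists C.
pose C := \sum_r c r.
have C0 : 0 <= C by apply: sumr_ge0 => r _; have [] := hc r.
have cC r : c r <= C.
  rewrite /C (bigD1 r)//= lerDl; apply: sumr_ge0 => i _; by have [] := hc i.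
have x01 m k : 0 <= x m k <= 1.
  rewrite x0/= -(x1 m) (bigD1 k)//= lerDl; exact: sumr_ge0.
have lim1 : \prod_r \sum_k (Q r).[x m k] @[m --> \oo] --> \prod_r (Q r)`_1.
  have cr r : \sum_k (Q r).[x m k] @[m --> \oo] --> (Q r)`_1.
    apply/subr_cvg0; apply: norm_cvg0.
    have ch : C * \sum_k x m k ^+ 2 @[m --> \oo] --> 0.
      by rewrite -[X in _ --> X](mulr0 C); apply: cvgM; [exact: cvg_cst|exact: x20].
    apply: (@squeeze_cvgr _ _ _ _ (cst 0) _ _ _ _ _ ch).
    - apply: nearW => m; rewrite normr_ge0/=.
      rewrite -[(Q r)`_1 in leLHS]mulr1 -(x1 m) mulr_sumr -sumrB.
      rewrite (le_trans (ler_norm_sum _ _ _))// mulr_sumr; apply: ler_sum => k _.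
      have [_ /(_ _ (x01 m k))[_ h]] := hc r.
      by rewrite (le_trans h)// ler_wpM2r// exprn_ge0.
    - exact: cvg_cst.
  exact: (@cvg_big R I *%R 1 xpredT (@mul_continuous R) nat \oo (index_enum I)
    (fun r m => \sum_k (Q r).[x m k]) (fun r => (Q r)`_1) _ (fun r _ => cr r)).
rewrite -[X in _ --> X]add0r.
rewrite (_ : (fun m => _) = (fun m =>
  (\sum_(b : {ffun I -> K m} | injectiveb b) \prod_r (Q r).[x m (b r)] -
   \prod_r \sum_k (Q r).[x m k]) + \prod_r \sum_k (Q r).[x m k])); last first.
  by apply/funext => m; rewrite subrK.
apply: cvgD => //; apply: norm_cvg0.
have ch : (#|I| ^ 2)%:R * C ^+ #|I| * \sum_k x m k ^+ 2 @[m --> \oo] --> 0.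
  rewrite -[X in _ --> X](mulr0 ((#|I| ^ 2)%:R * C ^+ #|I|)).
  by apply: cvgM; [exact: cvg_cst|exact: x20].
apply: (@squeeze_cvgr _ _ _ _ (cst 0) _ _ _ _ _ ch).
- apply: nearW => m; rewrite normr_ge0/=; apply: distinct_cell_sum_bound => //.
  move=> r k; have [_ /(_ _ (x01 m k))[h _]] := hc r.
  by rewrite (le_trans h)// ler_wpM2r.
- exact: cvg_cst.
Qed.

End distinct_cell_sums.

(** * Cells of a separating family *)

Section cells.
Context d (Y : measurableType d) (R : realType).
Variable U : nat -> set Y.
Hypothesis mU : forall i, measurable (U i).
Hypothesis U_sep : forall x y, x <> y -> exists i, U i x /\ ~ U i y.

Definition code m (x : Y) : {ffun 'I_m -> bool} := [ffun i : 'I_m => x \in U i].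

Definition cell m (b : {ffun 'I_m -> bool}) : set Y := [set x | code m x = b].

Lemma measurable_cell m b : measurable (@cell m b).
Proof.
rewrite (_ : cell b = \bigcap_(i in [set: 'I_m]) (if b i then U i else ~` U i)).
  by apply: fin_bigcap_measurable => // i _; case: ifP => // _; exact: measurableC.
apply/seteqP; split => x.
  move=> <- i _; rewrite ffunE; case: ifPn => [/set_mem//|].
  by move=> /negP xU Ux; apply: xU; rewrite inE.
move=> xb; apply/ffunP => i; rewrite ffunE; have := xb i I.
by case: ifP => _ Ux; [rewrite mem_set|rewrite memNset].
Qed.

Lemma sum_indic_cell m x : \sum_b (\1_(@cell m b) x : R) = 1.
Proof.
rewrite (bigD1 (code m x))//= indicE mem_set// big1 ?addr0// => b bx.
rewrite indicE memNset//= => xb; move/eqP: bx; apply; exact/esym.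
Qed.

Lemma measure_cells m (nu : {measure set Y -> \bar R}) :
  (nu setT = \sum_b nu (@cell m b))%E.
Proof.
transitivity (\int[nu]_x (\1_setT x)%:E)%E; first by rewrite integral_indic ?setIT.
transitivity (\int[nu]_x \sum_b (\1_(@cell m b) x)%:E)%E.
  by apply: eq_integral => x _; rewrite sumEFin sum_indic_cell indicT.
rewrite ge0_integral_sum//; last first.
  by move=> b; apply/measurable_EFinP; exact/measurable_indic/measurable_cell.
by apply: eq_bigr => b _; rewrite integral_indic ?setIT//; exact: measurable_cell.
Qed.

Lemma code_sep x y : x <> y -> exists m0, forall m, (m0 <= m)%N ->
  code m x <> code m y.
Proof.
move=> /U_sep[i [Ux Uy]]; exists i.+1 => m im /ffunP/(_ (Ordinal im)).
by rewrite !ffunE mem_set// memNset.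
Qed.

Lemma bigcap_cell x : \bigcap_m (cell (code m x)) = [set x].
Proof.
apply/seteqP; split => [y xy|_ -> m _//].
apply: contrapT => /nesym/code_sep[m /(_ m (leqnn _))]; apply.
exact/esym/xy.
Qed.

Variable P0 : probability Y R.
Hypothesis P0_points : forall x, P0 [set x] = 0%E.

Lemma sum_cell_mass m : \sum_b fine (P0 (@cell m b)) = 1.
Proof.
apply: EFin_inj; rewrite -sumEFin -(probability_setT P0) (measure_cells m).
by apply: eq_bigr => b _; rewrite fineK// fin_num_measure//; exact: measurable_cell.
Qed.

(** The sum is the P0-integral of P0(cell of x). The cells of x decrease to {x}, which has mass 0,
    so dominated convergence applies. *)
Lemma cvg_sum_sqr_cell_mass :
  (\sum_b fine (P0 (@cell m b)) ^+ 2) @[m --> \oo] --> 0.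
Proof.
suff : (\sum_b fine (P0 (@cell m b)) ^+ 2)%:E @[m --> \oo] --> 0%E.
  by move=> /fine_cvgP[].
have mc m := @measurable_cell m.
have PF m (b : {ffun 'I_m -> bool}) : P0 (cell b) \is a fin_num.
  by rewrite fin_num_measure.
have sE m x : (P0 (cell (code m x)) = \sum_b (P0 (@cell m b) * (\1_(@cell m b) x)%:E))%E.
  rewrite (bigD1 (code m x))//= indicE mem_set// mule1 big1 ?adde0// => b bx.
  rewrite indicE memNset//= ?mule0// => xb; move/eqP: bx; apply; exact/esym.
have mP m b : measurable_fun setT (fun x => P0 (@cell m b) * (\1_(@cell m b) x)%:E)%E.
  by apply: measurable_funeM; apply/measurable_EFinP; exact: measurable_indic.
rewrite (_ : (fun m => _) = (fun m => \int[P0]_x P0 (cell (code m x)))%E); last first.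
  apply/funext => m.
  under eq_integral do rewrite sE.
  rewrite ge0_integral_sum//; last by move=> b x _; rewrite mule_ge0// lee_fin.
  rewrite -sumEFin; apply: eq_bigr => b _.
  rewrite ge0_integralZl//.
  have -> : (fine (P0 (cell b)) ^+ 2)%:E = (P0 (cell b) * P0 (cell b))%E.
    by rewrite expr2 EFinM fineK.
  by congr (_ * _)%E; rewrite integral_indic ?setIT.
  by apply/measurable_EFinP; exact: measurable_indic.
rewrite [X in _ --> X](_ : _ = \int[P0]_x cst 0 x)%E; last by rewrite integral0.
apply: (@dominated_cvg _ _ _ P0 setT measurableT
  (fun m x => P0 (cell (code m x))) _ (cst 1%E)).
- move=> m; rewrite (_ : (fun x => _) =
    (fun x => \sum_b P0 (@cell m b) * (\1_(@cell m b) x)%:E)%E); last first.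
    by apply/funext => x; rewrite sE.
  exact: emeasurable_sum.
- move=> x _; rewrite -(P0_points x) -bigcap_cell.
  apply: nonincreasing_cvg_mu => //.
  + by rewrite -ge0_fin_numE// PF.
  + exact: bigcapT_measurable.
  + move=> m n mn; apply/subsetPset => y /= xy.
    apply/ffunP => i; move/ffunP : xy => /(_ (widen_ord mn i)).
    by rewrite !ffunE.
- by [].
- exact: (finite_measure_integrable_cst P0 1 measurableT).
- by move=> m x _; rewrite gee0_abs// probability_le1.
Qed.

End cells.

(** * Countable separating families in separable metric spaces *)

Section separating_family.
Context (R : realType) (X : completeMetricType R).

Lemma separable_separating_family : separable X ->
  exists U : nat -> set X, (forall i, open (U i)) /\
    forall x y, x <> y -> exists i, U i x /\ ~ U i y.
Proof.
move=> [D /countable_injP[g g_inj] denseD].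
(* [g] is injective on [D], so the union contains at most one ball interior: that of radius 1 / (j +
   1) about the point of code [k], if there is one. *)
pose V (k j : nat) : set X :=
  \bigcup_(p in [set p | D p /\ g p = k]) (ball p j.+1%:R^-1)°.
exists (fun n => if unpickle n is Some (k, j) then V k j else setT).
split.
  move=> n; case: unpickle => [[k j]|]; last exact: openT.
  by apply: bigcup_open => p _; exact: open_interior.
move=> x y xy.
have r0 : 0 < mdist x y by rewrite mdist_gt0; apply/eqP.
(* With r = 1 / (j + 1), [x] will lie within r / 2 of [p]; if [y] were within r of [p], the distance
   from x to y would be below 3r/2, hence below 2r. *)
have [j jr] : exists j, 2 / j.+1%:R < mdist x y.
  pose j := Num.truncn (2 / mdist x y); exists j.
  by rewrite ltr_pdivrMr// mulrC -ltr_pdivrMr// truncnS_gt.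
have [p [xp Dp]] : (ball x (j.+1%:R^-1 / 2))° `&` D !=set0.
  apply: denseD; last exact: open_interior.
  by exists x; exact: nbhsx_ballx.
have {}xp : ball x (j.+1%:R^-1 / 2) p by exact: interior_subset.
have xV : V (g p) j x.
  exists p => //; apply: (@filterS _ _ _ (ball x (j.+1%:R^-1 / 2))).
    move=> z xz; rewrite (splitr j.+1%:R^-1).
    by apply: ball_triangle xz; exact: ball_sym xp.
  exact: nbhsx_ballx.
have yV : ~ V (g p) j y.
  move=> [q [Dq gq] qy].
  have pq : q = p by apply: g_inj => //; rewrite inE.
  have {}qy : ball p j.+1%:R^-1 y by rewrite -pq; exact: interior_subset.
  have := ball_triangle xp qy; rewrite ballEmdist/= => xyr.
  have : mdist x y < 2 / j.+1%:R.
    apply: lt_le_trans xyr _; rewrite mulrDl mul1r lerD2r.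
    by rewrite ler_pdivrMr// ler_peMr// ler1n.
  by move/(lt_trans jr); rewrite ltxx.
by exists (pickle (g p, j)); rewrite pickleK.
Qed.

End separating_family.

(** * Partitions as labellings of the observations *)

Section clusters.
Variables (A I : finType) (cl : A -> I).

(** Turns an equality of kernels into the existence of an injective assignment of cells to clusters,
    over which probabilities can be summed. *)
Lemma kernel_factors (K : finType) (f : A -> K) :
  (forall r, exists a, cl a = r) ->
  (forall x y, (f x == f y) = (cl x == cl y)) <->
  exists2 b : {ffun I -> K}, injectiveb b & forall a, f a = b (cl a).
Proof.
move=> /choice[s sK]; split=> [fcl|[b /injectiveP b_inj fb] x y]; last first.
  by rewrite !fb (inj_eq b_inj).
exists [ffun r => f (s r)].
  apply/injectiveP => r r'; rewrite !ffunE => /eqP.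
  by rewrite fcl !sK => /eqP.
by move=> a; rewrite ffunE; apply/eqP; rewrite fcl sK.
Qed.

Lemma prod_cluster (R : comRingType) (F : I -> R) (J : finType) (g : J -> A)
    (freq : I -> nat) :
  (forall r, #|[pred j | cl (g j) == r]| = freq r) ->
  \prod_j F (cl (g j)) = \prod_r F r ^+ freq r.
Proof.
move=> fr; rewrite (partition_big (fun j => cl (g j)) xpredT)//=.
apply: eq_bigr => r _; rewrite (eq_bigr (fun=> F r)); last by move=> j /eqP ->.
by rewrite prodr_const -fr.
Qed.

End clusters.

Section has_frequencies.
Variables (n1 n2 k1 k2 k0 : nat).
Variables (nn1 : 'I_k1 -> nat) (nn2 : 'I_k2 -> nat) (q1 q2 : 'I_k0 -> nat).

Definition freqX (r : 'I_k1 + 'I_k2 + 'I_k0) : nat :=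
  match r with inl (inl j) => nn1 j | inl (inr _) => 0 | inr r => q1 r end.
Definition freqY (r : 'I_k1 + 'I_k2 + 'I_k0) : nat :=
  match r with inl (inl _) => 0 | inl (inr j) => nn2 j | inr r => q2 r end.

(** Replaces the set partition by a map [cl] to cluster labels; equality of partitions becomes
    equality of the kernels of two maps, which can be tested pair by pair. *)
Lemma cluster_map (ptn : {set {set 'I_n1 + 'I_n2}}) :
  has_frequencies nn1 nn2 q1 q2 ptn ->
  exists cl : 'I_n1 + 'I_n2 -> 'I_k1 + 'I_k2 + 'I_k0,
    [/\ forall (K : eqType) (f : 'I_n1 + 'I_n2 -> K),
          preim_partition f finset.setT = ptn <->
          (forall x y, (f x == f y) = (cl x == cl y)),
        forall r, exists a, cl a = r,
        forall r, #|[pred i | cl (inl i) == r]| = freqX r &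
        forall r, #|[pred i | cl (inr i) == r]| = freqY r].
Proof.
move=> [ptn_part [CX [CY [CS [uC memC fX fY fS]]]]].
pose C (r : 'I_k1 + 'I_k2 + 'I_k0) :=
  match r with inl (inl j) => CX j | inl (inr j) => CY j | inr j => CS j end.
have /and3P[/eqP covP trivP P0] := ptn_part.
have C_ptn r : C r \in ptn.
  rewrite memC !mem_cat; by case: r => [[j|j]|j] /=; rewrite codom_f ?orbT.
have C_inj : injective C.
  move: uC; rewrite !cat_uniq => /and3P[uX /hasPn XYS /and3P[uY /hasPn YS uS]].
  move=> [[i|i]|i] [[j|j]|j] //= ij.
  - by congr (inl (inl _)); exact: (injectiveP _ uX).
  - have := XYS (CY j); rewrite mem_cat codom_f => /(_ isT).
    by rewrite -ij /= codom_f.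
  - have := XYS (CS j); rewrite mem_cat codom_f orbT => /(_ isT).
    by rewrite -ij /= codom_f.
  - have := XYS (CY i); rewrite mem_cat codom_f => /(_ isT).
    by rewrite ij /= codom_f.
  - by congr (inl (inr _)); exact: (injectiveP _ uY).
  - have := YS (CS j); rewrite codom_f => /(_ isT).
    by rewrite -ij /= codom_f.
  - have := XYS (CS i); rewrite mem_cat codom_f orbT => /(_ isT).
    by rewrite ij /= codom_f.
  - have := YS (CS i); rewrite codom_f => /(_ isT).
    by rewrite ij /= codom_f.
  - by congr inr; exact: (injectiveP _ uS).
have ptn_C B : B \in ptn -> exists r, B = C r.
  rewrite memC !mem_cat => /or3P[] /codomP[j ->].
  - by exists (inl (inl j)).
  - by exists (inl (inr j)).
  - by exists (inr j).
have /choice[cl cl_mem] : forall a, exists r, a \in C r.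
  move=> a; have : a \in finset.cover ptn by rewrite covP finset.inE.
  move=> /finset.bigcupP[B Bptn aB]; have [r Br] := ptn_C _ Bptn.
  by exists r; rewrite -Br.
have memCE a r : (a \in C r) = (cl a == r).
  apply/idP/eqP => [ar|<-//]; apply: C_inj.
  rewrite -(finset.def_pblock trivP (C_ptn _) (cl_mem a)).
  exact: finset.def_pblock.
have pbE x y : (y \in finset.pblock ptn x) = (cl x == cl y).
  by rewrite (finset.def_pblock trivP (C_ptn _) (cl_mem x)) memCE eq_sym.
exists cl; split.
- move=> K f; split => [fptn x y|fcl].
    rewrite -pbE -fptn finset.pblock_equivalence_partition ?finset.inE//.
    by split => //; rewrite ?eqxx// => /eqP ->.
  rewrite -(finset.equivalence_partition_pblock ptn_part).
  rewrite /preim_partition /finset.equivalence_partition.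
  apply: finset.eq_in_imset => x _; apply/finset.setP => y.
  by rewrite !finset.inE /= pbE fcl.
- move=> r; have : C r != finset.set0.
    by apply: contraNneq P0 => <-.
  by move=> /finset.set0Pn[a]; rewrite memCE => /eqP <-; exists a.
- move=> r; have -> : #|[pred i | cl (inl i) == r]| = numX (C r).
    by apply: eq_card => i; rewrite !inE memCE.
  by case: r => [[j|j]|j] /=; [have [] := fX j|have [] := fY j|have [] := fS j].
- move=> r; have -> : #|[pred i | cl (inr i) == r]| = numY (C r).
    by apply: eq_card => i; rewrite !inE memCE.
  by case: r => [[j|j]|j] /=; [have [] := fX j|have [] := fY j|have [] := fS j].
Qed.

End has_frequencies.

(** * The partition event and its approximation by cells *)

Section cell_patterns.
Local Open Scope ereal_scope.

(** The limit event is the liminf of the [E_ m], hence measurable; this provides the measurability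
    of coincidences of observations. *)
Lemma cvg_prob_eventually d (T : measurableType d) (R : realType)
    (P : probability T R) (E_ : nat -> set T) (E : set T) :
  (forall m, measurable (E_ m)) ->
  (forall w, exists M, forall m, (M <= m)%N -> E_ m w <-> E w) ->
  P (E_ m) @[m --> \oo] --> P E.
Proof.
move=> mE EE.
have cE w : ((\1_(E_ m) w)%:E : \bar R) @[m --> \oo] --> ((\1_E w)%:E : \bar R).
  have [M hM] := EE w; apply: cvg_near_cst; exists M => // m /= Mm.
  rewrite !indicE; congr ((nat_of_bool _)%:R%:E).
  by apply/idP/idP; rewrite !inE; move/hM : Mm => [].
have mE' : measurable E.
  rewrite (_ : E = \bigcup_M \bigcap_(m in [set m | (M <= m)%N]) E_ m); last first.
    apply/seteqP; split => w.
      move=> Ew; have [M hM] := EE w; exists M => // m /= Mm.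
      exact/(hM _ Mm).
    move=> [M0 _ h]; have [M hM] := EE w.
    apply/(hM (maxn M0 M)); first exact: leq_maxr.
    by apply: h; exact: leq_maxl.
  apply: bigcupT_measurable => M; apply: bigcap_measurable => //.
  by exists M => /=.
have PE B : measurable B -> P B = \int[P]_w (\1_B w)%:E.
  by move=> mB; rewrite integral_indic ?setIT.
rewrite PE//; under eq_fun do rewrite PE//.
apply: (@dominated_cvg _ _ _ P setT measurableT
  (fun m w => (\1_(E_ m) w)%:E) _ (cst 1)) => //.
- by move=> m; apply/measurable_EFinP; exact: measurable_indic.
- exact: (finite_measure_integrable_cst P 1 measurableT).
- move=> m w _; rewrite gee0_abs ?lee_fin// indicE; case: (w \in _) => //.
Qed.

Context d (T : measurableType d) d' (Y : measurableType d') (R : realType).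
Variables (P : probability T R) (p1 p2 : R.-pker T ~> Y) (n1 n2 : nat).
Variables (xs : 'I_n1 -> {RV P >-> Y}) (ys : 'I_n2 -> {RV P >-> Y}).
Hypothesis xys : cond_independent_samples p1 p2 xs ys.
Variable U : nat -> set Y.
Hypothesis mU : forall i, measurable (U i).
Variables (I : finType) (cl : 'I_n1 + 'I_n2 -> I) (fX fY : I -> nat).
Hypothesis cl_surj : forall r, exists a, cl a = r.
Hypothesis cl_X : forall r, #|[pred i | cl (inl i) == r]| = fX r.
Hypothesis cl_Y : forall r, #|[pred j | cl (inr j) == r]| = fY r.

Definition cell_pattern m : set T :=
  [set w | forall x y,
    (code U m (obs xs ys w x) == code U m (obs xs ys w y)) = (cl x == cl y)].

Let rect m (b : {ffun I -> {ffun 'I_m -> bool}}) : set T :=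
  (\bigcap_i (xs i @^-1` cell U (b (cl (inl i))))) `&`
  (\bigcap_j (ys j @^-1` cell U (b (cl (inr j))))).

Let rectE m b w : @rect m b w <-> forall a, code U m (obs xs ys w a) = b (cl a).
Proof.
split => [[wx wy] [i|j]|wb]; [exact: (wx i Logic.I)|exact: (wy j Logic.I)|].
by split => [i _|j _]; [exact: (wb (inl i))|exact: (wb (inr j))].
Qed.

Let mrect m b : measurable (@rect m b).
Proof.
apply: measurableI; apply: fin_bigcap_measurable => // i _.
  exact: measurable_funPTI (measurable_cell mU _).
exact: measurable_funPTI (measurable_cell mU _).
Qed.

(** The rectangles of distinct [b] are disjoint: [cl] is onto, so [b] can be recovered from the
    cells of the observations. *)
Let cell_patternE m w : (\1_(cell_pattern m) w)%:E =
  \sum_(b : {ffun I -> {ffun 'I_m -> bool}} | injectiveb b) (\1_(rect b) w)%:E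
  :> \bar R.
Proof.
have [wE|wE] := pselect (cell_pattern m w).
  have [b bi wb] := (kernel_factors _ cl_surj).1 wE.
  rewrite indicE mem_set// (bigD1 b)//= indicE mem_set ?big1 ?adde0//.
    move=> b' /andP[_ b'b]; rewrite indicE memNset// => /rectE wb'.
    move/eqP : b'b; apply; apply/ffunP => r; have [a <-] := cl_surj r.
    by rewrite -wb' wb.
  exact/rectE.
rewrite indicE memNset// big1// => b bi; rewrite indicE memNset// => /rectE wb.
by apply: wE; apply/(kernel_factors _ cl_surj); exists b.
Qed.

Lemma measurable_cell_pattern m : measurable (cell_pattern m).
Proof.
rewrite (_ : cell_pattern m = \bigcup_(b in [set b : {ffun I -> {ffun 'I_m -> bool}} | injectiveb b]) rect b).
  by apply: fin_bigcup_measurable => // b _; exact: mrect.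
apply/seteqP; split => w.
  move=> /(kernel_factors _ cl_surj)[b bi wb]; exists b => //; exact/rectE.
move=> [b /= bi /rectE wb]; apply/(kernel_factors _ cl_surj); by exists b.
Qed.

Lemma prob_cell_pattern m : P (cell_pattern m) =
  \sum_(b : {ffun I -> {ffun 'I_m -> bool}} | injectiveb b)
    \int[P]_w ((\prod_r (fine (p1 w (cell U (b r))) ^+ fX r)) *
              (\prod_r (fine (p2 w (cell U (b r))) ^+ fY r)))%:E.
Proof.
transitivity (\int[P]_w (\1_(cell_pattern m) w)%:E).
  by rewrite integral_indic ?setIT//; exact: measurable_cell_pattern.
under eq_integral do rewrite cell_patternE -big_filter.
rewrite ge0_integral_sum//; last first.
  by move=> b; apply/measurable_EFinP; exact: measurable_indic.
rewrite big_filter; apply: eq_bigr => b _; rewrite integral_indic// setIT.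
(* Integrating the conditional probability over the whole space gives the probability of the
   rectangle. *)
have [_ /(_ setT)] := xys
  (fun i => measurable_cell mU (b (cl (inl i))))
  (fun j => measurable_cell mU (b (cl (inr j)))).
rewrite setTI => rect_prob; rewrite [LHS]rect_prob; last first.
  have [s0 sC _] := smallest_sigma_algebra setT
    (sigma_random_measure p1 `|` sigma_random_measure p2).
  by rewrite -(setD0 setT); exact: sC.
have pf (p : R.-pker T ~> Y) w B : measurable B -> (fine (p w B))%:E = p w B.
  move=> mB; rewrite fineK// ge0_fin_numE// (@le_lt_trans _ _ 1)//.
    by rewrite -(@prob_kernel _ _ _ _ _ p w) le_measure// inE.
  by rewrite ltry.
have mc k := measurable_cell mU k.
apply: eq_integral => w _.
rewrite (eq_bigr (fun i => (fine (p1 w (cell U (b (cl (inl i))))))%:E)); last first.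
  by move=> i _; rewrite pf.
rewrite [X in _ * X](eq_bigr (fun i => (fine (p2 w (cell U (b (cl (inr i))))))%:E)); last first.
  by move=> i _; rewrite pf.
rewrite !prodEFin -EFinM; congr (_ * _)%:E.
  exact: (prod_cluster (fun r => fine (p1 w (cell U (b r)))) cl_X).
exact: (prod_cluster (fun r => fine (p2 w (cell U (b r)))) cl_Y).
Qed.

Hypothesis U_sep : forall x y, x <> y -> exists i, U i x /\ ~ U i y.

Lemma cvg_prob_cell_pattern :
  P (cell_pattern m) @[m --> \oo] -->
  P [set w | forall x y, (obs xs ys w x == obs xs ys w y) = (cl x == cl y)].
Proof.
apply: cvg_prob_eventually; first exact: measurable_cell_pattern.
move=> w.
have /choice[M hM] : forall p : ('I_n1 + 'I_n2) * ('I_n1 + 'I_n2), exists M,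
    forall m, (M <= m)%N ->
    (code U m (obs xs ys w p.1) == code U m (obs xs ys w p.2)) =
    (obs xs ys w p.1 == obs xs ys w p.2).
  move=> [x y] /=; have [->|/eqP xy] := eqVneq (obs xs ys w x) (obs xs ys w y).
    by exists 0%N => m _; rewrite eqxx.
  have [M hM] := code_sep U_sep xy; exists M => m Mm.
  by apply/negbTE/eqP; exact: hM.
(* There are finitely many pairs of observations, so one level separates all pairs with distinct
   values. *)
exists (\max_p M p) => m Mm; split => h x y; rewrite -h.
  by rewrite -(hM (x, y) m)//; apply: leq_trans Mm; exact: leq_bigmax.
by rewrite (hM (x, y) m)//; apply: leq_trans Mm; exact: leq_bigmax.
Qed.

End cell_patterns.

(** * Ratios as Gamma mixtures of Laplace moments, and passage to the limit *)

Section gamma_mixture.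
Local Open Scope ereal_scope.
Context d (T : measurableType d) (R : realType) (P : probability T R).
Local Notation D := (`]0%R, +oo[%classic : set R).
Local Notation leb := (@lebesgue_measure R).

Let D_gt0 (s : R) : D s -> (0 < s)%R.
Proof. by rewrite /= in_itv/= andbT. Qed.

(** [f] is known to be nonnegative only for v > 0, so Tonelli is applied to [f] cut off by the
    indicator of [D]. *)
Lemma tonelli_itv (f : T -> R -> R) :
  measurable_fun setT (fun p : T * R => f p.1 p.2) ->
  (forall w v, (0 < v)%R -> (0 <= f w v)%R) ->
  \int[P]_w \int[leb]_(v in D) (f w v)%:E =
    \int[leb]_(v in D) \int[P]_w (f w v)%:E /\
  measurable_fun D (fun v => \int[P]_w (f w v)%:E).
Proof.
move=> mf f0.
pose g (p : T * R) := (f p.1 p.2 * \1_D p.2)%:E.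
have g0 p : 0 <= g p.
  rewrite lee_fin; have [Dp|Dp] := pselect (D p.2).
    by rewrite mulr_ge0// f0//; exact: D_gt0.
  by rewrite indicE memNset// mulr0.
have mg : measurable_fun setT g.
  apply/measurable_EFinP; apply: measurable_funM => //.
  have m1 : measurable_fun setT (\1_D : R -> R) by exact: measurable_indic.
  exact: (measurableT_comp m1 measurable_snd).
have gE w v : D v -> g (w, v) = (f w v)%:E.
  by move=> Dv; rewrite /g/= indicE mem_set// mulr1.
have gN w v : ~ D v -> g (w, v) = 0.
  by move=> Dv; rewrite /g/= indicE memNset// mulr0.
have mG := @measurable_fun_fubini_tonelli_G _ _ T R R P g mg g0.
split; last first.
  apply: (eq_measurable_fun (fubini_G P g)).
    move=> v /set_mem Dv; rewrite /fubini_G; apply: eq_integral => w _.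
    exact: gE.
  exact: measurable_funTS.
have := @fubini_tonelli _ _ T _ R P leb g mg g0.
have -> : \int[P]_w \int[leb]_v g (w, v) =
    \int[P]_w \int[leb]_(v in D) (f w v)%:E.
  apply: eq_integral => w _; rewrite [RHS]integral_mkcond.
  apply: eq_integral => v _; rewrite patchE; case: ifPn => [/set_mem/gE//|].
  by move/negP => Dv; apply: gN => ?; apply: Dv; rewrite inE.
move=> ->; rewrite [RHS]integral_mkcond.
apply: eq_integral => v _; rewrite patchE; case: ifPn => [/set_mem Dv|/negP Dv].
  by apply: eq_integral => w _; rewrite gE.
by apply: integral0_eq => w _; apply: gN => ?; apply: Dv; rewrite inE.
Qed.

Variables (M1 M2 : T -> R) (n1 n2 : nat).
Hypothesis mM1 : measurable_fun setT M1.
Hypothesis mM2 : measurable_fun setT M2.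
Hypothesis M1_gt0 : forall w, (0 < M1 w)%R.
Hypothesis M2_gt0 : forall w, (0 < M2 w)%R.

(** In this section [n1] and [n2] are the sample sizes minus one, that is, the exponents in the
    Gamma integrals. *)
Let H (A : T -> R) (u v : R) w : R :=
  (u ^+ n1 * v ^+ n2 * (expR (- (u * M1 w)) * expR (- (v * M2 w)) * A w))%R.

Let mexpM (M : T -> R) : measurable_fun setT M ->
  measurable_fun setT (fun p : T * R => expR (- (p.2 * M p.1))%R).
Proof.
move=> mM.
have mM' : measurable_fun setT (fun p : T * R => M p.1).
  exact: (measurableT_comp mM measurable_fst).
have mE : measurable_fun setT (fun x : R => expR (- x)).
  exact: continuous_measurable_fun continuous_expRN.
apply: (measurableT_comp mE); apply: measurable_funM => //.
Qed.

Let msection (f : T * R -> R) v : measurable_fun setT f ->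
  measurable_fun setT (fun w => f (w, v)).
Proof. by move=> mf; exact: measurableT_comp. Qed.

Let mpow (n : nat) : measurable_fun setT (fun p : T * R => (p.2 ^+ n)%R).
Proof.
have mX : measurable_fun setT (fun x : R => (x ^+ n)%R) by exact: exprn_measurable.
exact: (measurableT_comp mX measurable_snd).
Qed.

Let mT (f : T -> R) : measurable_fun setT f ->
  measurable_fun setT (fun p : T * R => f p.1).
Proof. by move=> mf; exact: (measurableT_comp mf measurable_fst). Qed.

Let mHu (A : T -> R) (v : R) : measurable_fun setT A ->
  measurable_fun setT (fun p : T * R => H A p.2 v p.1).
Proof.
move=> mA; apply: measurable_funM.
  by apply: measurable_funM => //; exact: mpow.
apply: measurable_funM; last exact: mT.
apply: measurable_funM; first exact: mexpM.
exact: mT (msection _ (mexpM mM2)).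
Qed.

Let mH (A : T -> R) (u : R) (v : R) : measurable_fun setT A -> measurable_fun setT (H A u v).
Proof. by move=> mA; exact: (msection u (mHu v mA)). Qed.

Let f1 (A : T -> R) w (v : R) : R :=
  (n1`!%:R / M1 w ^+ n1.+1 * (v ^+ n2 * expR (- (v * M2 w)) * A w))%R.

Let mf1 (A : T -> R) : measurable_fun setT A ->
  measurable_fun setT (fun p : T * R => f1 A p.1 p.2).
Proof.
move=> mA; apply: measurable_funM.
  apply: (@mT (fun w => n1`!%:R / M1 w ^+ n1.+1)%R).
  apply: measurable_funM => //.
  rewrite (_ : (fun w => _) = fun w => ((M1 w `^ (-1)) ^+ n1.+1)%R); last first.
    by apply/funext => w; rewrite powR_inv1 ?exprVn// ltW.
  apply: measurable_funX.
  exact: (measurableT_comp (@measurable_powR R (-1)) mM1).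
apply: measurable_funM; last exact: mT.
by apply: measurable_funM; [exact: mpow|exact: mexpM].
Qed.

Let gammaM n (M : R) : (0 < M)%R ->
  \int[leb]_(u in D) (u ^+ n * expR (- (u * M)))%:E = (n`!%:R / M ^+ n.+1)%:E.
Proof.
move=> M0; apply: etrans (gamma_integral n M0).
by apply: eq_integral => u _; rewrite (mulrC u).
Qed.

Let mgamma n (M : R) :
  measurable_fun D (fun u : R => (u ^+ n * expR (- (u * M)))%:E).
Proof.
apply/measurable_EFinP; apply: measurable_funTS; apply: measurable_funM.
  exact: exprn_measurable.
have mE : measurable_fun setT (fun x : R => expR (- x)).
  exact: continuous_measurable_fun continuous_expRN.
by apply: (measurableT_comp mE); exact: measurable_funM.
Qed.

Let H_ge0 (A : T -> R) (u : R) (v : R) (w : T) : (forall w, 0 <= A w)%R -> (0 < u)%R -> (0 < v)%R ->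
  (0 <= H A u v w)%R.
Proof.
move=> A0 u0 v0; rewrite mulr_ge0//.
  by rewrite mulr_ge0// exprn_ge0// ltW.
by rewrite mulr_ge0// mulr_ge0// expR_ge0.
Qed.

Let f1_ge0 (A : T -> R) (v : R) (w : T) : (forall w, 0 <= A w)%R -> (0 < v)%R -> (0 <= f1 A w v)%R.
Proof.
move=> A0 v0; rewrite mulr_ge0//.
  by rewrite divr_ge0// exprn_ge0// ltW.
by rewrite mulr_ge0// mulr_ge0 ?expR_ge0// exprn_ge0// ltW.
Qed.

Let int_u (A : T -> R) (v : R) (w : T) : (forall w, 0 <= A w)%R -> (0 < v)%R ->
  \int[leb]_(u in D) (H A u v w)%:E = (f1 A w v)%:E.
Proof.
move=> A0 v0; rewrite /f1 EFinM -gammaM// -ge0_integralZr//.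
- by apply: eq_integral => u _; rewrite -EFinM /H; congr (_%:E); ring.
- exact: mgamma.
- by move=> u /D_gt0 u0; rewrite lee_fin mulr_ge0 ?expR_ge0// exprn_ge0// ltW.
- by rewrite lee_fin mulr_ge0// mulr_ge0 ?expR_ge0// exprn_ge0// ltW.
Qed.

Let int_v (A : T -> R) (w : T) : (forall w, 0 <= A w)%R ->
  \int[leb]_(v in D) (f1 A w v)%:E =
  (n1`!%:R * n2`!%:R * (A w / (M1 w ^+ n1.+1 * M2 w ^+ n2.+1)))%:E.
Proof.
move=> A0.
rewrite (_ : (_ * _)%R = n2`!%:R / M2 w ^+ n2.+1 * (n1`!%:R / M1 w ^+ n1.+1 * A w))%R; last first.
  by field; rewrite !expf_neq0 ?gt_eqF.
rewrite EFinM -gammaM// -ge0_integralZr//.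
- by apply: eq_integral => u _; rewrite -EFinM /f1; congr (_%:E); ring.
- exact: mgamma.
- by move=> u /D_gt0 u0; rewrite lee_fin mulr_ge0 ?expR_ge0// exprn_ge0// ltW.
- by rewrite lee_fin mulr_ge0// divr_ge0// exprn_ge0// ltW.
Qed.

Let swap_u (A : T -> R) (v : R) : measurable_fun setT A -> (forall w, 0 <= A w)%R -> (0 < v)%R ->
  \int[leb]_(u in D) \int[P]_w (H A u v w)%:E = \int[P]_w (f1 A w v)%:E /\
  measurable_fun D (fun u => \int[P]_w (H A u v w)%:E).
Proof.
move=> mA A0 v0.
have [<- mHD] := @tonelli_itv (fun w u => H A u v w) (mHu v mA)
  (fun w u u0 => H_ge0 w A0 u0 v0).
by split => //; apply: eq_integral => w _; rewrite int_u.
Qed.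

Lemma gamma_mixture (A : T -> R) : measurable_fun setT A -> (forall w, 0 <= A w)%R ->
  \int[leb]_(v in D) \int[leb]_(u in D) \int[P]_w (H A u v w)%:E =
  \int[P]_w (n1`!%:R * n2`!%:R * (A w / (M1 w ^+ n1.+1 * M2 w ^+ n2.+1)))%:E /\
  measurable_fun D (fun v => \int[leb]_(u in D) \int[P]_w (H A u v w)%:E).
Proof.
move=> mA A0.
have [tv mv] := @tonelli_itv (f1 A) (mf1 mA) (fun w v => f1_ge0 w A0).
have e v : D v -> \int[leb]_(u in D) \int[P]_w (H A u v w)%:E =
    \int[P]_w (f1 A w v)%:E.
  by move=> /D_gt0 v0; have [] := swap_u mA A0 v0.
split.
  transitivity (\int[leb]_(v in D) \int[P]_w (f1 A w v)%:E).
    by apply: eq_integral => v /set_mem; exact: e.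
  by rewrite -tv; apply: eq_integral => w _; rewrite int_v.
have e' : {in D, (fun v => \int[P]_w (f1 A w v)%:E) =1
    (fun v => \int[leb]_(u in D) \int[P]_w (H A u v w)%:E)}.
  move=> v /set_mem Dv.
  by apply/esym; exact: e.
exact: (eq_measurable_fun _ e' mv).
Qed.

Variables (A_ : nat -> T -> R) (F : R -> R -> R).
Hypothesis mA : forall m, measurable_fun setT (A_ m).
Hypothesis A_ge0 : forall m w, (0 <= A_ m w)%R.
Hypothesis A_le : forall m w, (A_ m w <= M1 w ^+ n1.+1 * M2 w ^+ n2.+1)%R.
Hypothesis A_F : forall u v : R, (0 < u)%R -> (0 < v)%R ->
  \int[P]_w (expR (- (u * M1 w)) * expR (- (v * M2 w)) * A_ m w)%:E
    @[m --> \oo] --> (F u v)%:E.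

(** Envelope of all [A_ m]. By [gamma_mixture] its mixture has total integral n1! n2!, so it
    dominates at each level of the iterated integral. *)
Let B w := (M1 w ^+ n1.+1 * M2 w ^+ n2.+1)%R.

Let mB : measurable_fun setT B.
Proof. by apply: measurable_funM; apply: measurable_funX. Qed.

Let B_ge0 (w : T) : (0 <= B w)%R.
Proof. by rewrite mulr_ge0// exprn_ge0// ltW. Qed.

(** At fixed u and v the exponentials compensate the powers of the masses: [exp_moment_bound] bounds
    the integrand by a constant. *)
Let HB_fin (u : R) (v : R) : (0 < u)%R -> (0 < v)%R ->
  \int[P]_w (H B u v w)%:E \is a fin_num.
Proof.
move=> u0 v0; apply: integrable_fin_num => //.
pose C : R := (u ^+ n1 * v ^+ n2 *
  (n1.+1`!%:R / u ^+ n1.+1 * (n2.+1`!%:R / v ^+ n2.+1)))%R.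
have ic := finite_measure_integrable_cst P C measurableT.
apply: le_integrable ic => //; first by apply/measurable_EFinP; exact: mH.
move=> w _; rewrite /= lee_fin ger0_norm ?H_ge0//.
have bu := exp_moment_bound n1.+1 u0 (ltW (M1_gt0 w)).
have bv := exp_moment_bound n2.+1 v0 (ltW (M2_gt0 w)).
apply: le_trans (ler_norm _); rewrite /C /H ler_wpM2l//.
  by rewrite mulr_ge0// exprn_ge0// ltW.
rewrite /B mulrACA [X in (X * _)%R]mulrC [X in (_ * X)%R]mulrC ler_pM//.
  by rewrite mulr_ge0 ?expR_ge0// exprn_ge0// ltW.
by rewrite mulr_ge0 ?expR_ge0// exprn_ge0// ltW.
Qed.

(** Once u is integrated out, the power of [M1] in [B] cancels, and the remaining power of [M2] is
    bounded with the help of exp(-v M2). *)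
Let f1B_fin (v : R) : (0 < v)%R -> \int[P]_w (f1 B w v)%:E \is a fin_num.
Proof.
move=> v0; apply: integrable_fin_num => //.
pose C : R := (n1`!%:R * (v ^+ n2 * (n2.+1`!%:R / v ^+ n2.+1)))%R.
have ic := finite_measure_integrable_cst P C measurableT.
apply: le_integrable ic => //.
  by apply/measurable_EFinP; exact: (msection v (mf1 mB)).
move=> w _; rewrite /= lee_fin ger0_norm ?f1_ge0//.
have bv := exp_moment_bound n2.+1 v0 (ltW (M2_gt0 w)).
apply: le_trans (ler_norm _).
have -> : f1 B w v = (n1`!%:R * (v ^+ n2 *
    (M2 w ^+ n2.+1 * expR (- (v * M2 w)))))%R.
  rewrite /f1 /B; have : (M1 w ^+ n1.+1 != 0)%R by rewrite expf_neq0// gt_eqF.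
  by move: (M1 w ^+ n1.+1)%R => x x0; field.
by rewrite ler_wpM2l// ler_wpM2l// exprn_ge0// ltW.
Qed.

Let J m u v := \int[P]_w (H (A_ m) u v w)%:E.
Let JB u v := \int[P]_w (H B u v w)%:E.

Let J_le (m : nat) (u : R) (v : R) : (0 < u)%R -> (0 < v)%R -> `|J m u v| <= JB u v.
Proof.
move=> u0 v0; rewrite gee0_abs; last first.
  by apply: integral_ge0 => w _; rewrite lee_fin H_ge0.
apply: ge0_le_integral => //.
- by move=> w _; rewrite lee_fin H_ge0.
- by apply/measurable_EFinP; exact: mH.
- by apply/measurable_EFinP; exact: mH.
- move=> w _; rewrite lee_fin /H ler_wpM2l//.
    by rewrite mulr_ge0// exprn_ge0// ltW.
  by rewrite ler_wpM2l// mulr_ge0 ?expR_ge0.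
Qed.

Let J_cvg (u : R) (v : R) : (0 < u)%R -> (0 < v)%R ->
  J m u v @[m --> \oo] --> (u ^+ n1 * v ^+ n2 * F u v)%:E.
Proof.
move=> u0 v0; rewrite EFinM.
have uv0 : (0 <= u ^+ n1 * v ^+ n2)%R by rewrite mulr_ge0// exprn_ge0// ltW.
rewrite (_ : J ^~ u ^~ v = (fun m => (u ^+ n1 * v ^+ n2)%:E *
    \int[P]_w (expR (- (u * M1 w)) * expR (- (v * M2 w)) * A_ m w)%:E)); last first.
  apply/funext => m; rewrite /J -ge0_integralZl_EFin//.
  - by move=> w _; rewrite lee_fin mulr_ge0// mulr_ge0 ?expR_ge0.
  - apply/measurable_EFinP; apply: measurable_funM => //; apply: measurable_funM.
      exact: (msection u (mexpM mM1)).
    exact: (msection v (mexpM mM2)).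
by apply: cvgeZl => //; exact: A_F.
Qed.

Let inner_cvg (v : R) : (0 < v)%R ->
  \int[leb]_(u in D) J m u v @[m --> \oo] -->
  \int[leb]_(u in D) (u ^+ n1 * v ^+ n2 * F u v)%:E.
Proof.
move=> v0; have [JBE mJB] := swap_u mB B_ge0 v0.
apply: (@dominated_cvg _ _ _ leb D (measurable_itv _) (fun m u => J m u v) _
  (JB ^~ v)).
- by move=> m; have [] := swap_u (mA m) (A_ge0 m) v0.
- by move=> u /D_gt0 u0; exact: J_cvg.
- by move=> u /D_gt0 u0; exact: HB_fin.
- apply/integrableP; split => //.
  have -> : \int[leb]_(u in D) `|JB u v| = \int[leb]_(u in D) JB u v.
    apply: eq_integral => u /set_mem/D_gt0 u0; rewrite gee0_abs//.
    by apply: integral_ge0 => w _; rewrite lee_fin H_ge0.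
  by rewrite JBE -ge0_fin_numE ?f1B_fin//; apply: integral_ge0 => w _; rewrite lee_fin f1_ge0.
- by move=> m u /D_gt0 u0; exact: J_le.
Qed.

(** Dominated convergence twice: in u at fixed v ([inner_cvg]), then in v. Both dominating functions
    come from the mixture of [B]. *)
Lemma cvg_gamma_mixture :
  \int[P]_w (n1`!%:R * n2`!%:R * (A_ m w / (M1 w ^+ n1.+1 * M2 w ^+ n2.+1)))%:E
    @[m --> \oo] -->
  \int[leb]_(v in D) \int[leb]_(u in D) (u ^+ n1 * v ^+ n2 * F u v)%:E.
Proof.
rewrite (_ : (fun m => _) = (fun m =>
    \int[leb]_(v in D) \int[leb]_(u in D) J m u v)); last first.
  by apply/funext => m; have [->] := gamma_mixture (mA m) (A_ge0 m).
have [JBE mJB] := gamma_mixture mB B_ge0.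
have JB0 u v : (0 < u)%R -> (0 < v)%R -> 0 <= JB u v.
  by move=> u0 v0; apply: integral_ge0 => w _; rewrite lee_fin H_ge0.
have J0 m u v : (0 < u)%R -> (0 < v)%R -> 0 <= J m u v.
  by move=> u0 v0; apply: integral_ge0 => w _; rewrite lee_fin H_ge0.
apply: (@dominated_cvg _ _ _ leb D (measurable_itv _)
  (fun m v => \int[leb]_(u in D) J m u v) _
  (fun v => \int[leb]_(u in D) JB u v)).
- by move=> m; have [] := gamma_mixture (mA m) (A_ge0 m).
- by move=> v /D_gt0 v0; exact: inner_cvg.
- by move=> v /D_gt0 v0; have [-> _] := swap_u mB B_ge0 v0; exact: f1B_fin.
- apply/integrableP; split => //.
  have -> : \int[leb]_(v in D) `|\int[leb]_(u in D) JB u v| =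
      \int[leb]_(v in D) \int[leb]_(u in D) JB u v.
    apply: eq_integral => v /set_mem/D_gt0 v0; rewrite gee0_abs//.
    by apply: integral_ge0 => u /D_gt0 u0; exact: JB0.
  rewrite JBE.
  rewrite (eq_integral (cst (n1`!%:R * n2`!%:R)%:E)); last first.
    by move=> w _; rewrite /B divff ?mulr1// mulf_neq0// expf_neq0// gt_eqF.
  have -> : \int[P]_w cst (n1`!%:R * n2`!%:R)%:E w =
      (n1`!%:R * n2`!%:R)%:E * P setT by exact: integral_cst.
  by rewrite probability_setT mule1 ltry.
- move=> m v /D_gt0 v0; rewrite gee0_abs; last first.
    by apply: integral_ge0 => u /D_gt0 u0; exact: J0.
  apply: ge0_le_integral => //.
  + by move=> u /D_gt0 u0; exact: J0.
  + by have [] := swap_u (mA m) (A_ge0 m) v0.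
  + by have [] := swap_u mB B_ge0 v0.
  + by move=> u /D_gt0 u0; apply: le_trans (J_le m u0 v0); rewrite gee0_abs// J0.
Qed.

End gamma_mixture.

(** * The polynomial contributed by one cell *)

Section cell_poly.
Context {R : realType}.
Implicit Types t : nat -> R.

(** The range ['I_N] does not depend on the exponent, so all cells share one index type and a
    product over cells expands into a sum over finite functions. Excess terms vanish with their
    binomial coefficients. *)
Lemma exprD_wide (N n : nat) (x y : R) : (n < N)%N ->
  (x + y) ^+ n = \sum_(i < N) 'C(n, i)%:R * (y ^+ i * x ^+ (n - i)).
Proof.
move=> nN; rewrite exprDn (big_ord_widen N (fun i => x ^+ (n - i) * y ^+ i *+ 'C(n, i)))//.
rewrite big_mkcond; apply: eq_bigr => i _; case: ltnP => [_|ni].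
  by rewrite mulr_natl (mulrC (x ^+ _)).
by rewrite bin_small// mul0r.
Qed.

(** Up to an exponential factor, the tilted expectation of (S0 + S1)^a (S0 + S2)^b as a polynomial
    in the P0-mass of the cell: [q] records the powers taken from S1 and S2, and S0 supplies the
    rest. Where a truncated subtraction would be wrong, the binomial coefficient is 0. *)
Definition cell_poly (N : nat) t1 t2 t0 (a b : nat) : {poly R} :=
  \sum_(q : 'I_N * 'I_N) ('C(a, q.1)%:R * 'C(b, q.2)%:R) *:
    (levy_poly t0 (a - q.1 + (b - q.2)) * levy_poly t1 q.1 * levy_poly t2 q.2).

Lemma coef0_cell_poly N t1 t2 t0 a b : (0 < a + b)%N ->
  (cell_poly N t1 t2 t0 a b)`_0 = 0.
Proof.
move=> ab; rewrite /cell_poly coef_sum big1// => -[i j] _ /=.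
rewrite coefZ !coef0M !coef0_levy_poly.
have [->|_] := eqVneq (i : nat) 0%N; last by rewrite mulr0 mul0r mulr0.
have [->|_] := eqVneq (j : nat) 0%N; last by rewrite !mulr0.
by rewrite !subn0 gtn_eqF// mul0r mul0r mulr0.
Qed.

(** One of the three Bell polynomials gives its linear part and the other two their constant
    coefficient, nonzero only at index 0. So a single measure supplies all powers: mu1 if b = 0, mu2
    if a = 0, or mu0. *)
Lemma coef1_cell_poly N t1 t2 t0 a b : (a < N)%N -> (b < N)%N -> (0 < a + b)%N ->
  (cell_poly N t1 t2 t0 a b)`_1 =
  (b == 0)%:R * t1 a + (a == 0)%:R * t2 b + t0 (a + b)%N.
Proof.
move=> aN bN ab; have N0 : (0 < N)%N by exact: leq_ltn_trans aN.
have coef1M (p q : {poly R}) : (p * q)`_1 = p`_0 * q`_1 + p`_1 * q`_0.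
  by rewrite coefM big_ord_recl big_ord1 /= subn0.
rewrite /cell_poly coef_sum.
pose F1 (q : 'I_N * 'I_N) : R := (('C(a, q.1)%:R * 'C(b, q.2)%:R) *
  ((a - q.1 + (b - q.2) == 0)%N%:R * ((q.1 != 0 :> nat)%:R * t1 q.1) * (q.2 == 0 :> nat)%:R)).
pose F2 (q : 'I_N * 'I_N) : R := (('C(a, q.1)%:R * 'C(b, q.2)%:R) *
  ((a - q.1 + (b - q.2) == 0)%N%:R * (q.1 == 0 :> nat)%:R * ((q.2 != 0 :> nat)%:R * t2 q.2))).
pose F0 (q : 'I_N * 'I_N) : R := (('C(a, q.1)%:R * 'C(b, q.2)%:R) *
  (((a - q.1 + (b - q.2) != 0)%N%:R * t0 (a - q.1 + (b - q.2))%N) * (q.1 == 0 :> nat)%:R * (q.2 == 0 :> nat)%:R)).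
rewrite (eq_bigr (fun q => F1 q + F2 q + F0 q)); last first.
  move=> q _; rewrite coefZ !coef1M !coef0M !coef0_levy_poly !coef1_levy_poly.
  rewrite /F1 /F2 /F0 -!mulrDr; congr (_ * _); ring.
rewrite !big_split/=; congr (_ + _ + _).
- rewrite (bigD1 (Ordinal aN, Ordinal N0))//= big1 ?addr0; last first.
    move=> [i j]; rewrite xpair_eqE negb_and -!val_eqE /= /F1/=.
    have [->|_] := eqVneq (j : nat) 0%N; last by rewrite !mulr0.
    rewrite orbF => ia; have [ai|ai] := ltnP a i.
      by rewrite bin_small// !mul0r.
    have -> : (a - i + (b - 0) == 0)%N = false.
      by apply/negbTE; rewrite addn_eq0 negb_and -lt0n subn_gt0 ltn_neqAle ia ai.
    by rewrite !mul0r mulr0.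
  rewrite /F1/= subnn subn0 add0n binn bin0 ?eqxx !mul1r mulr1.
  have [b0|_] := eqVneq b 0%N; rewrite ?mul0r// mul1r.
  by rewrite -lt0n; move: ab; rewrite b0 addn0 => ->; rewrite mul1r.
- rewrite (bigD1 (Ordinal N0, Ordinal bN))//= big1 ?addr0; last first.
    move=> [i j]; rewrite xpair_eqE negb_and -!val_eqE /= /F2/=.
    have [->|_] := eqVneq (i : nat) 0%N; last by rewrite mulr0 mul0r mulr0.
    rewrite orFb => jb; have [bj|bj] := ltnP b j.
      by rewrite (bin_small bj) mulr0 mul0r.
    have -> : (a - 0 + (b - j) == 0)%N = false.
      by apply/negbTE; rewrite addn_eq0 negb_and orbC -lt0n subn_gt0 ltn_neqAle jb bj.
    by rewrite !mul0r mulr0.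
  rewrite /F2/= subnn subn0 addn0 binn bin0 !mul1r mulr1.
  have [a0|_] := eqVneq a 0%N; rewrite ?mul0r// mul1r.
  by rewrite -lt0n; move: ab; rewrite a0 add0n => ->; rewrite mul1r.
- rewrite (bigD1 (Ordinal N0, Ordinal N0))//= big1 ?addr0; last first.
    move=> [i j]; rewrite xpair_eqE negb_and -!val_eqE /= /F0/=.
    by move=> /orP[/negbTE ->|/negbTE ->]; rewrite !mulr0 ?mul0r ?mulr0.
  by rewrite /F0/= !subn0 !bin0 -lt0n ab !mul1r !mulr1.
Qed.

Lemma prod_ord3 (F : 'I_3 -> R) :
  \prod_e F e = F ord0 * F (@Ordinal 3 1 isT) * F (@Ordinal 3 2 isT).
Proof.
rewrite !big_ord_recl big_ord0 mulr1 mulrA; congr (_ * F _ * F _); exact: val_inj.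
Qed.

End cell_poly.

(** * Joint tilted moments of three independent CRMs over the cells *)

Section independent_crms.
Context d (T : measurableType d) d' (Y : measurableType d') (R : realType).
Variables (P : probability T R) (mu : 'I_3 -> R.-ker T ~> Y).
Variables (a : 'I_3 -> R) (rho : R -> R) (P0 : probability Y R).
Hypothesis a_ge0 : forall e, 0 <= a e.
Local Notation D := (`]0%R, +oo[%classic : set R).
Local Notation leb := (@lebesgue_measure R).
Hypothesis rho_meas : measurable_fun D rho.
Hypothesis rho_ge0 : forall s : R, 0 < s -> 0 <= rho s.
Hypothesis rho_int : (\int[leb]_(s in D) (Num.min 1 s * rho s)%:E < +oo)%E.
Hypothesis crm : forall e, poissonian_crm P (a e) rho P0 (mu e).
Hypothesis indep :
  mutual_independence P (fun e => sigma_random_measure (mu e)).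

Variables (K : finType) (c : K -> set Y).
Hypothesis mc : forall k, measurable (c k).
Hypothesis tc : trivIset setT c.

(** Two layers of independence: [indep] across the three measures, and complete randomness of each
    measure across the disjoint cells. *)
Lemma crm_cells_independent (A : 'I_3 * K -> set (\bar R)) :
  (forall p, measurable (A p)) ->
  (P (\bigcap_(p in setT) (fun w => mu p.1 w (c p.2)) @^-1` A p) =
   \prod_p P ((fun w => mu p.1 w (c p.2)) @^-1` A p))%E.
Proof.
move=> mA.
pose V e k : set T := (fun w => mu e w (c k)) @^-1` A (e, k).
pose B e : set T := \bigcap_(k in setT) V e k.
have -> : \bigcap_(p in setT) (fun w => mu p.1 w (c p.2)) @^-1` A p =
    \bigcap_(e in [set` [set: 'I_3]%SET]) B e.
  apply/seteqP; split => [w wA e _ k _|w wB [e k] _].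
    exact: (wA (e, k)).
  by apply: (wB e) => //=; rewrite finset.inE.
rewrite indep; last first.
  move=> e _.
  (* Membership in the generated sigma-algebra is read as measurability, so that closure under
     finite intersections is available. *)
  suff : measurable (B e : set (g_sigma_algebraType
      (\bigcup_(B in measurable) preimage_set_system setT
        (fun w => mu e w B) measurable))) by [].
  apply: fin_bigcap_measurable => // k _.
  apply: sub_sigma_algebra; exists (c k) => //.
  by exists (A (e, k)) => //; rewrite setTI.
have PB e : (P (B e) = \prod_k P (V e k))%E.
  have [cr _] := crm e.
  have mck (i : 'I_#|K|) : measurable (c (enum_val i)) by [].
  have tck : trivIset setT (fun i : 'I_#|K| => c (enum_val i)).
    apply/trivIsetP => i j _ _ ij; move/trivIsetP : tc; apply => //.
    by rewrite (inj_eq enum_val_inj).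
  have := cr #|K| _ mck tck finset.setT (fun i => V e (enum_val i)).
  have -> : \bigcap_(i in [set` [set: 'I_#|K|]%SET]) V e (enum_val i) = B e.
    apply/seteqP; split => [w wV k _|w wV i _].
      have := wV (enum_rank k); rewrite enum_rankK; apply.
      by rewrite /= finset.inE.
    exact: wV.
  move=> ->; last first.
    by move=> i _; exists (A (e, enum_val i)) => //; rewrite setTI.
  rewrite [RHS](reindex (fun i : 'I_#|K| => enum_val i))/=; last first.
    by apply: onW_bij; exact: enum_val_bij.
  by apply: eq_bigl => i; rewrite finset.inE.
rewrite (eq_bigl xpredT); last by move=> e; rewrite finset.inE.
rewrite (eq_bigr _ (fun e _ => PB e)) pair_big/=.
by apply: eq_bigr => -[e k] _.
Qed.

Let S e k w : R := fine (mu e w (c k)).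
Let x k : R := fine (P0 (c k)).

Lemma mixed_moment (nn : 'I_3 * K -> nat) (uu : 'I_3 -> R) :
  (forall e, 0 < uu e) ->
  (\int[P]_w (\prod_p (S p.1 p.2 w ^+ nn p * expR (- (uu p.1 * S p.1 p.2 w))))%:E =
   (\prod_p ((levy_poly (fun q => a p.1 * tau rho q (uu p.1)) (nn p)).[x p.2] *
     expR (- (x p.2 * (a p.1 * psi rho (uu p.1))))))%:E)%E.
Proof.
move=> uu0.
(* The absolute value makes [g] nonnegative on all of the extended reals, as [integral_prod_indep]
   requires; on masses it changes nothing. *)
pose g (p : 'I_3 * K) (y : \bar R) : \bar R :=
  (`|fine y| ^+ nn p * expR (- (uu p.1 * fine y)))%:E.
have S0 e k w : 0 <= S e k w by exact: fine_ge0.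
have gE p w : g p (mu p.1 w (c p.2)) =
    (S p.1 p.2 w ^+ nn p * expR (- (uu p.1 * S p.1 p.2 w)))%:E.
  by rewrite /g ger0_norm// S0.
transitivity (\int[P]_w \prod_p g p (mu p.1 w (c p.2)))%E.
  by apply: eq_integral => w _; rewrite -prodEFin; apply: eq_bigr => p _; rewrite gE.
have mE : measurable_fun setT (fun x : R => expR (- x)).
  exact: continuous_measurable_fun continuous_expRN.
rewrite (integral_prod_indep (V := fun p w => mu p.1 w (c p.2)) (g := g)).
- rewrite -prodEFin; apply: eq_bigr => p _.
  rewrite -(crm_moment (a_ge0 _) rho_meas rho_ge0 rho_int (crm _) (mc _) _ (uu0 _)).
  by apply: eq_integral => w _; rewrite gE.
- by move=> p; exact: measurable_kernel.
- exact: crm_cells_independent.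
- move=> p; apply/measurable_EFinP; apply: measurable_funM.
    apply: measurable_funX; apply: measurableT_comp => //.
  apply: (measurableT_comp mE); apply: measurable_funM => //.
- by move=> p y; rewrite lee_fin mulr_ge0 ?expR_ge0// exprn_ge0.
Qed.

Hypothesis x_sum1 : \sum_k x k = 1.

(** Binomial expansion in every cell separates S0, S1 and S2, [mixed_moment] evaluates each term,
    and the sums are folded back into one [cell_poly] per cell. *)
Lemma cells_moment (N : nat) (u v : R) (al be : K -> nat) :
  0 < u -> 0 < v ->
  (forall k, (al k < N)%N) -> (forall k, (be k < N)%N) ->
  let e1 := @Ordinal 3 1 isT in let e2 := @Ordinal 3 2 isT in
  (\int[P]_w (\prod_k ((S ord0 k w + S e1 k w) ^+ al k *
                       (S ord0 k w + S e2 k w) ^+ be k *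
      (expR (- (u * (S ord0 k w + S e1 k w))) *
       expR (- (v * (S ord0 k w + S e2 k w))))))%:E =
  (expR (- (a ord0 * psi rho (u + v) + a e1 * psi rho u + a e2 * psi rho v)) *
   \prod_k (cell_poly N (fun q => a e1 * tau rho q u)
     (fun q => a e2 * tau rho q v) (fun q => a ord0 * tau rho q (u + v))
     (al k) (be k)).[x k])%:E)%E.
Proof.
move=> u0 v0 alN beN e1 e2.
(* Regrouping the exponents gives S0 the rate u + v, S1 the rate u and S2 the rate v. *)
pose uu (e : 'I_3) := match val e with 0%N => u + v | 1%N => u | _ => v end.
pose nu k (q : 'I_N * 'I_N) (e : 'I_3) : nat := match val e with
  0%N => al k - q.1 + (be k - q.2) | 1%N => q.1 | _ => q.2 end%N.
pose Cb k (q : 'I_N * 'I_N) : R := 'C(al k, q.1)%:R * 'C(be k, q.2)%:R.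
have uu0 e : 0 < uu e by rewrite /uu; case: e => -[|[|?]] //= _; exact: addr_gt0.
have S0 e k w : 0 <= S e k w by exact: fine_ge0.
have Cb0 k q : 0 <= Cb k q by rewrite mulr_ge0.
pose G k (q : 'I_N * 'I_N) e w : R :=
  S e k w ^+ nu k q e * expR (- (uu e * S e k w)).
have G0 k q e w : 0 <= G k q e w by rewrite mulr_ge0 ?expR_ge0// exprn_ge0.
have step1 k w : (S ord0 k w + S e1 k w) ^+ al k *
    (S ord0 k w + S e2 k w) ^+ be k *
      (expR (- (u * (S ord0 k w + S e1 k w))) *
       expR (- (v * (S ord0 k w + S e2 k w)))) =
    \sum_(q : 'I_N * 'I_N) Cb k q * \prod_e G k q e w.
  rewrite (exprD_wide _ _ (alN k)) (exprD_wide _ _ (beN k)).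
  rewrite big_distrlr/= pair_big/= mulr_suml; apply: eq_bigr => q _.
  rewrite prod_ord3 /G /Cb /uu /nu/=.
  rewrite (_ : - (u * _) = - (u * S ord0 k w) + - (u * S e1 k w)); last by ring.
  rewrite (_ : - (v * _) = - (v * S ord0 k w) + - (v * S e2 k w)); last by ring.
  rewrite (_ : - ((u + v) * _) = - (u * S ord0 k w) + - (v * S ord0 k w)); last by ring.
  by rewrite !expRD exprD -/e1 -/e2; ring.
pose L e n := levy_poly (fun q => a e * tau rho q (uu e)) n.
pose m k q e : R := (L e (nu k q e)).[x k] * expR (- (x k * (a e * psi rho (uu e)))).
have step2 (s : {ffun K -> 'I_N * 'I_N}) :
    (\int[P]_w (\prod_k (Cb k (s k) * \prod_e G k (s k) e w))%:E =
     (\prod_k (Cb k (s k) * \prod_e m k (s k) e))%:E)%E.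
  have := mixed_moment (fun p => nu p.2 (s p.2) p.1) uu0.
  have reorg (f : K -> 'I_3 -> R) : \prod_k \prod_e f k e =
      \prod_(p : 'I_3 * K) f p.2 p.1.
    by rewrite exchange_big/= pair_big.
  rewrite [X in _ = X%:E -> _](_ : _ = \prod_k \prod_e m k (s k) e); last first.
    by rewrite reorg.
  move=> h; rewrite big_split/= EFinM -h -ge0_integralZl_EFin//.
  - apply: eq_integral => w _; rewrite -EFinM big_split/=; congr (_ * _)%:E.
    by rewrite reorg.
  - by move=> w _; rewrite lee_fin prodr_ge0// => p _; exact: G0.
  - apply/measurable_EFinP; apply: measurable_prod => p _.
    exact: measurable_exp_moment.
  - by rewrite prodr_ge0.
transitivity (\int[P]_w \sum_(s : {ffun K -> 'I_N * 'I_N})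
    (\prod_k (Cb k (s k) * \prod_e G k (s k) e w))%:E)%E.
  apply: eq_integral => w _; rewrite sumEFin -(bigA_distr_bigA
    (fun k q => Cb k q * \prod_e G k q e w)).
  by congr (_%:E); apply: eq_bigr => k _; exact: step1.
rewrite ge0_integral_sum//; last 2 first.
- move=> s; apply/measurable_EFinP; apply: measurable_prod => k _.
  apply: measurable_funM => //; apply: measurable_prod => e _.
  exact: measurable_exp_moment.
- move=> s w _; rewrite lee_fin prodr_ge0// => k _.
  by rewrite mulr_ge0// prodr_ge0.
rewrite (eq_bigr _ (fun s _ => step2 s)) sumEFin; congr (_%:E).
rewrite -(bigA_distr_bigA (fun k q => Cb k q * \prod_e m k q e)).
(* As the cell masses sum to 1, exp(-Psi) spreads over the cells and matches the exponential factor
   of each. *)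
pose Psi := a ord0 * psi rho (u + v) + a e1 * psi rho u + a e2 * psi rho v.
have -> : expR (- Psi) = \prod_k expR (- (x k * Psi)).
  by rewrite -expR_sum sumrN -mulr_suml x_sum1 mul1r.
rewrite -big_split/=; apply: eq_bigr => k _.
rewrite /cell_poly horner_sum mulr_sumr; apply: eq_bigr => q _.
rewrite hornerZ !hornerM mulrCA; congr (_ * _).
have -> : expR (- (x k * Psi)) = expR (- (x k * (a ord0 * psi rho (u + v)))) *
    expR (- (x k * (a e1 * psi rho u))) * expR (- (x k * (a e2 * psi rho v))).
  rewrite -!expRD; congr expR; rewrite /Psi.
  by move: (psi rho (u + v)) (psi rho u) (psi rho v) => w0 w1 w2; ring.
have perm (E0 E1 E2 L0 L1 L2 : R) :
    E0 * E1 * E2 * (L0 * L1 * L2) = L0 * E0 * (L1 * E1) * (L2 * E2) by ring.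
by rewrite prod_ord3 /m /L /nu /uu/= -/e1 -/e2 [RHS]perm.
Qed.

End independent_crms.

(** * Positivity of the total mass *)

Section crm_positivity.
Context d (T : measurableType d) d' (Y : measurableType d') (R : realType).
Variables (P : probability T R) (mu : R.-ker T ~> Y).
Variables (a : R) (rho : R -> R) (P0 : probability Y R).
Hypothesis a_gt0 : 0 < a.
Local Notation D := (`]0%R, +oo[%classic : set R).
Local Notation leb := (@lebesgue_measure R).
Hypothesis rho_meas : measurable_fun D rho.
Hypothesis rho_ge0 : forall s : R, 0 < s -> 0 <= rho s.
Hypothesis rho_int : (\int[leb]_(s in D) (Num.min 1 s * rho s)%:E < +oo)%E.
Hypothesis rho_inf : (\int[leb]_(s in D) (rho s)%:E = +oo)%E.
Hypothesis crm : poissonian_crm P a rho P0 mu.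

(** exp(-u mu) is 1 where the total mass is 0, so that event has probability at most exp(-a psi(u)),
    which tends to 0 as u grows. *)
Lemma crm_ae_pos : P [set w | mu w setT = 0%E] = 0%E.
Proof.
set Z := [set w | _].
have mk : measurable_fun setT (fun w => mu w setT) by exact: measurable_kernel.
have mZ : measurable Z by rewrite -[Z]setTI; exact: mk (emeasurable_set1 _).
have PZf : P Z \is a fin_num by rewrite fin_num_measure.
have bound (u : R) : 0 < u -> fine (P Z) <= expR (- (a * psi rho u)).
  move=> u0; rewrite -lee_fin fineK//.
  have := crm_laplace (ltW a_gt0) rho_meas rho_ge0 rho_int crm measurableT u0.
  rewrite probability_setT /= mulr1 => <-.
  have PE : P Z = (\int[P]_w (\1_Z w)%:E)%E by rewrite integral_indic ?setIT.
  rewrite PE; apply: ge0_le_integral => //.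
  - by apply/measurable_EFinP; exact: measurable_indic.
  - exact: measurableT_comp (measurable_laplace u) mk.
  - move=> w _; rewrite indicE.
    have [Zw|Zw] := pselect (Z w).
      by rewrite Zw mem_set// mule0 oppe0 expeR0.
    by rewrite memNset// expeR_ge0.
rewrite -[LHS](fineK PZf); congr (_%:E); apply/eqP.
rewrite eq_le fine_ge0// andbT leNgt; apply/negP => PZ0.
(* Beyond this threshold exp(-a psi) is at most P(Z) / e, which is below P(Z). *)
have /cvgey_ge/(_ ((1 - ln (fine (P Z))) / a)) [n _ /(_ n (leqnn _))] :=
  psi_cvgy rho_meas rho_ge0 rho_int rho_inf.
rewrite /= lee_fin ler_pdivrMr// mulrC => h.
have := bound n.+1%:R (ltr0Sn _ _); rewrite leNgt => /negP; apply.
rewrite -[ltRHS](lnK PZ0)// ltr_expR; lra.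
Qed.

End crm_positivity.

(** * Measurability of psi and tau *)

Section levy_measurability.
Context {R : realType}.
Variable rho : R -> R.
Local Notation D := (`]0%R, +oo[%classic : set R).
Local Notation leb := (@lebesgue_measure R).
Hypothesis rho_meas : measurable_fun D rho.
Hypothesis rho_ge0 : forall s : R, 0 < s -> 0 <= rho s.
Hypothesis rho_int : (\int[leb]_(s in D) (Num.min 1 s * rho s)%:E < +oo)%E.

Let measurable_is_derive (f g : R -> R) :
  (forall u : R, 0 < u -> is_derive u 1 f (g u)) -> measurable_fun D f.
Proof.
move=> fg; apply: open_continuous_measurable_fun.
  exact: interval_open.
move=> u; rewrite inE/= in_itv/= andbT => u0.
apply: differentiable_continuous; apply/derivable1_diffP.
by have [] := fg u u0.
Qed.

Lemma measurable_psi : measurable_fun D (psi rho).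
Proof.
by apply: measurable_is_derive => u u0; exact: (is_derive_psi rho_meas rho_ge0 rho_int u0).
Qed.

Lemma measurable_tau q : (0 < q)%N -> measurable_fun D (tau rho q).
Proof.
move=> q0; apply: measurable_is_derive => u u0.
exact: (is_derive_tau rho_meas rho_ge0 rho_int q0 u0).
Qed.

End levy_measurability.

(** * Products and sums over injective assignments *)

Section finite_products.
Context {R : realType}.
Variables (I K : finType).

Lemma prod_injective (b : I -> K) (f : K -> R) : injective b ->
  (forall k, k \notin codom b -> f k = 1) -> \prod_k f k = \prod_r f (b r).
Proof.
move=> b_inj f1; rewrite [RHS](partition_big b xpredT)//=.
apply: eq_bigr => k _; have [/codomP[r ->]|kb] := boolP (k \in codom b).
  by rewrite (big_pred1 r)// => r'; rewrite (inj_eq b_inj).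
rewrite f1// big_pred0// => r; apply: contraNF kb => /eqP <-.
exact: codom_f.
Qed.

(** This bound yields the envelope of the limit argument: drop injectivity, factorize over clusters,
    and bound the sum over cells cluster by cluster. *)
Lemma sum_distinct_le (s t : K -> R) (fX fY : I -> nat) :
  (forall k, 0 <= s k) -> (forall k, 0 <= t k) ->
  (forall r, (0 < fX r + fY r)%N) ->
  \sum_(b : {ffun I -> K} | injectiveb b)
    \prod_r (s (b r) ^+ fX r * t (b r) ^+ fY r) <=
  (\sum_k s k) ^+ (\sum_r fX r)%N * (\sum_k t k) ^+ (\sum_r fY r)%N.
Proof.
move=> s0 t0 f0.
have sS k : s k <= \sum_k s k by rewrite (bigD1 k)//= lerDl sumr_ge0.
have tT k : t k <= \sum_k t k by rewrite (bigD1 k)//= lerDl sumr_ge0.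
have pw n (x y : R) : 0 <= x -> x <= y -> x ^+ n <= y ^+ n.
  by move=> x0 xy; apply: lerXn2r; rewrite ?nnegrE// (le_trans x0).
apply: (@le_trans _ _ (\sum_(b : {ffun I -> K})
    \prod_r (s (b r) ^+ fX r * t (b r) ^+ fY r))).
  rewrite [leRHS](bigID (fun b : {ffun I -> K} => injectiveb b))/= lerDl.
  apply: sumr_ge0 => b _; apply: prodr_ge0 => r _.
  by rewrite mulr_ge0// exprn_ge0.
rewrite -(bigA_distr_bigA (fun r k => s k ^+ fX r * t k ^+ fY r)).
rewrite -!prodrXr -big_split/=; apply: ler_prod => r _.
apply/andP; split.
  by apply: sumr_ge0 => k _; rewrite mulr_ge0// exprn_ge0.
(* One factor is kept to be summed over the cells and all others are bounded by their totals; it is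
   an [s] factor if there is one, otherwise a [t] factor. *)
have [a0|a0] := posnP (fX r).
  have := f0 r; rewrite a0; case: (fY r) => [//|b] _.
  rewrite expr0 mul1r exprS mulr_suml; apply: ler_sum => k _.
  by rewrite expr0 mul1r exprS ler_wpM2l// pw.
case: (fX r) a0 => [//|a] _.
rewrite exprS -mulrA mulr_suml; apply: ler_sum => k _.
by rewrite exprS -mulrA ler_wpM2l// ler_pM ?exprn_ge0// pw.
Qed.

End finite_products.

Lemma cell_poly00 (R : realType) N (t1 t2 t0 : nat -> R) : (0 < N)%N ->
  cell_poly N t1 t2 t0 0 0 = 1.
Proof.
move=> N0; rewrite /cell_poly (bigD1 (Ordinal N0, Ordinal N0))//= big1 ?addr0.
  by rewrite !bin0 !levy_poly0 !mulr1 scale1r.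
move=> [i j]; rewrite xpair_eqE negb_and -!val_eqE /= => /orP[i0|j0].
  by rewrite (@bin_small 0 i) ?lt0n// mul0r scale0r.
by rewrite (@bin_small 0 j) ?lt0n// mulr0 scale0r.
Qed.

(** * From linear coefficients to the sum over i and l *)

Section integrand_expansion.
Context {R : realType}.
Variables (c z : R) (rho : R -> R) (n1 n2 k1 k2 k0 : nat).
Variables (nn1 : 'I_k1 -> nat) (nn2 : 'I_k2 -> nat) (q1 q2 : 'I_k0 -> nat).
Hypothesis nn1_gt0 : forall j, (0 < nn1 j)%N.
Hypothesis nn2_gt0 : forall j, (0 < nn2 j)%N.
Hypothesis q1_gt0 : forall j, (0 < q1 j)%N.
Hypothesis q2_gt0 : forall j, (0 < q2 j)%N.

Lemma sum_bool_le k (i : 'I_k -> bool) : (\sum_(j < k) i j <= k)%N.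
Proof.
rewrite -[leqRHS]card_ord -sum1_card; apply: leq_sum => j _.
by case: (i j).
Qed.

Let prod_weight k (i : {ffun 'I_k -> bool}) :
  \prod_(j < k) (if i j then 1 - z else z) =
  (1 - z) ^+ (\sum_(j < k) i j)%N * z ^+ (k - \sum_(j < k) i j)%N.
Proof.
have -> : (k - \sum_(j < k) i j)%N = (\sum_(j < k) (~~ i j))%N.
  apply/eqP; rewrite -(eqn_add2r (\sum_(j < k) i j)) subnK ?sum_bool_le//.
  rewrite -big_split/= -[X in X == _]card_ord -sum1_card; apply/eqP.
  by apply: eq_bigr => j _; case: (i j).
rewrite -!prodrXr -big_split/=; apply: eq_bigr => j _.
by case: (i j); rewrite ?expr1 ?expr0 ?mulr1 ?mul1r.
Qed.

Let prod_expand k (x y : 'I_k -> R) :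
  \prod_(j < k) (c * z * x j + c * (1 - z) * y j) =
  c ^+ k * \sum_(i : {ffun 'I_k -> bool})
    ((1 - z) ^+ (\sum_(j < k) i j)%N * z ^+ (k - \sum_(j < k) i j)%N) *
    \prod_(j < k) (if i j then y j else x j).
Proof.
transitivity (\prod_(j < k) \sum_(b : bool)
    c * ((if b then 1 - z else z) * (if b then y j else x j))).
  by apply: eq_bigr => j _; rewrite big_bool/=; ring.
rewrite bigA_distr_bigA/= mulr_sumr; apply: eq_bigr => i _.
by rewrite -prod_weight !big_split/= prodr_const card_ord.
Qed.

(** By [coef1_cell_poly], an X-only cluster keeps the terms of mu1 and mu0, a Y-only cluster those
    of mu2 and mu0, and a shared cluster that of mu0 alone, whence the factor (1 - z)^k0. *)
Lemma integrand_expansion N (u v : R) :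
  (forall r, (freqX (k2 := k2) nn1 q1 r < N)%N) ->
  (forall r, (freqY (k1 := k1) nn2 q2 r < N)%N) ->
  u ^+ (n1 - 1) * v ^+ (n2 - 1) *
  (expR (- (c * (1 - z) * psi rho (u + v) + c * z * psi rho u +
            c * z * psi rho v)) *
   \prod_r (cell_poly N (fun q => c * z * tau rho q u)
     (fun q => c * z * tau rho q v) (fun q => c * (1 - z) * tau rho q (u + v))
     (freqX nn1 q1 r) (freqY nn2 q2 r))`_1) =
  c ^+ (k1 + k2 + k0) * \sum_(i : {ffun 'I_k1 -> bool})
    \sum_(l : {ffun 'I_k2 -> bool})
     ((1 - z) ^+ (k0 + \sum_(j < k1) i j + \sum_(j < k2) l j)
      * z ^+ (k1 + k2 - \sum_(j < k1) i j - \sum_(j < k2) l j)) *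
     integrand c z rho n1 n2 nn1 nn2 q1 q2 i l u v.
Proof.
move=> fXN fYN.
rewrite big_sumType/= big_sumType/=.
have -> : \prod_(j < k1) (cell_poly N (fun q => c * z * tau rho q u)
     (fun q => c * z * tau rho q v) (fun q => c * (1 - z) * tau rho q (u + v))
     (nn1 j) 0)`_1 =
    \prod_(j < k1) (c * z * tau rho (nn1 j) u + c * (1 - z) * tau rho (nn1 j) (u + v)).
  apply: eq_bigr => j _; rewrite coef1_cell_poly ?addn0//.
  - by rewrite eqxx mul1r gtn_eqF// mul0r addr0.
  - exact: (fXN (inl (inl j))).
  - exact: (fYN (inl (inl j))).
have -> : \prod_(j < k2) (cell_poly N (fun q => c * z * tau rho q u)
     (fun q => c * z * tau rho q v) (fun q => c * (1 - z) * tau rho q (u + v))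
     0 (nn2 j))`_1 =
    \prod_(j < k2) (c * z * tau rho (nn2 j) v + c * (1 - z) * tau rho (nn2 j) (u + v)).
  apply: eq_bigr => j _; rewrite coef1_cell_poly ?add0n//.
  - by rewrite eqxx mul1r gtn_eqF// mul0r add0r.
  - exact: (fXN (inl (inr j))).
  - exact: (fYN (inl (inr j))).
have -> : \prod_(r < k0) (cell_poly N (fun q => c * z * tau rho q u)
     (fun q => c * z * tau rho q v) (fun q => c * (1 - z) * tau rho q (u + v))
     (q1 r) (q2 r))`_1 =
    c ^+ k0 * (1 - z) ^+ k0 * \prod_(r < k0) tau rho (q1 r + q2 r) (u + v).
  rewrite -exprMn -[X in _ ^+ X]card_ord -prodr_const -big_split/=.
  apply: eq_bigr => r _; rewrite coef1_cell_poly.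
  - by rewrite !gtn_eqF// !mul0r !add0r.
  - exact: (fXN (inr r)).
  - exact: (fYN (inr r)).
  - by rewrite addn_gt0 q1_gt0.
rewrite !prod_expand.
set A := \sum_(i : {ffun 'I_k1 -> bool}) _; set B := \sum_(i : {ffun 'I_k2 -> bool}) _.
set C := \prod_(r < k0) _; set E := expR _; set U := u ^+ _; set V := v ^+ _.
transitivity (c ^+ (k1 + k2 + k0) * (A * B * (U * V * E * (1 - z) ^+ k0 * C))).
  by rewrite !exprD; ring.
congr (_ * _); rewrite {}/A {}/B big_distrlr/= mulr_suml; apply: eq_bigr => i _.
rewrite mulr_suml; apply: eq_bigr => l _.
have tX : \prod_(j < k1) (if i j then tau rho (nn1 j) (u + v) else tau rho (nn1 j) u) =
    \prod_(j < k1) tau rho (nn1 j) (u + (i j)%:R * v).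
  apply: eq_bigr => j _; case: (i j) => /=; first by rewrite mul1r.
  by rewrite mul0r addr0.
have tY : \prod_(j < k2) (if l j then tau rho (nn2 j) (u + v) else tau rho (nn2 j) v) =
    \prod_(j < k2) tau rho (nn2 j) ((l j)%:R * u + v).
  apply: eq_bigr => j _; case: (l j) => /=; first by rewrite mul1r.
  by rewrite mul0r add0r.
rewrite tX tY /integrand -/U -/V -/C.
have -> : expR (- (c * z * (psi rho u + psi rho v)) - c * (1 - z) * psi rho (u + v)) = E.
  rewrite /E; congr expR.
  by move: (psi rho u) (psi rho v) (psi rho (u + v)) => x y w; ring.
(* The truncated subtractions are genuine, because each sum of booleans is at most its number of
   terms. *)
have -> : (k1 + k2 - \sum_(j < k1) i j - \sum_(j < k2) l j =
    (k1 - \sum_(j < k1) i j) + (k2 - \sum_(j < k2) l j))%N.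
  have := sum_bool_le i; have := sum_bool_le l.
  move: (\sum_(j < k1) i j)%N (\sum_(j < k2) l j)%N => x y; lia.
rewrite !exprD.
move: (\prod_(j < k1) tau _ _ _) (\prod_(j < k2) tau _ _ _) => X Y.
ring.
Qed.

End integrand_expansion.

(** * Measurability and linearity of the double integrals *)

Section double_integrals.
Local Open Scope ereal_scope.
Context {R : realType}.
Local Notation D := (`]0%R, +oo[%classic : set R).
Local Notation leb := (@lebesgue_measure R).

Let D_gt0 (s : R) : D s -> (0 < s)%R.
Proof. by rewrite /= in_itv/= andbT. Qed.

Let mDD : measurable (D `*` D).
Proof. by apply: measurableX; exact: measurable_itv. Qed.

Lemma measurable_iterated (f : R -> R -> R) :
  measurable_fun (D `*` D) (fun p : R * R => f p.1 p.2) ->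
  (forall u v, (0 < u)%R -> (0 < v)%R -> (0 <= f u v)%R) ->
  (forall v, (0 < v)%R -> measurable_fun D (fun u => (f u v)%:E)) /\
  measurable_fun D (fun v => \int[leb]_(u in D) (f u v)%:E).
Proof.
move=> mf f0; split.
  move=> v v0; apply/measurable_EFinP.
  apply: (measurable_comp (f := fun p : R * R => f p.1 p.2) (F := D `*` D)
    (g := fun u => (u, v))) => //.
  - by move=> _ [u Du <-]; split => //=; rewrite in_itv/= v0.
  - by apply: measurable_funTS; exact: measurable_fun_pair.
pose g (p : R * R) := ((fun p => (f p.1 p.2)%:E) \_ (D `*` D)) p.
have g0 p : 0 <= g p.
  apply: erestrict_ge0 => q [/D_gt0 q1 /D_gt0 q2]; rewrite lee_fin.
  exact: f0.
have mg : measurable_fun setT g.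
  have mf' : measurable_fun (D `*` D) (fun p : R * R => (f p.1 p.2)%:E).
    exact/measurable_EFinP.
  by apply/(measurable_restrictT _ _).1.
have mG := @measurable_fun_fubini_tonelli_G _ _ _ R R leb g mg g0.
have e : {in D, (fun v : R => \int[leb]_u g (u, v)) =1
    (fun v => \int[leb]_(u in D) (f u v)%:E)}.
  move=> v /set_mem Dv; rewrite [RHS]integral_mkcond.
  apply: eq_integral => u _; rewrite /g !patchE.
  by have [Du|Du] := pselect (D u);
    [rewrite !mem_set|rewrite !memNset//; case].
have mG' : measurable_fun D (fun v : R => \int[leb]_u g (u, v)).
  exact: measurable_funTS mG.
exact: (eq_measurable_fun _ e mG').
Qed.

Variables (c z : R) (rho : R -> R) (n1 n2 k1 k2 k0 : nat).
Variables (nn1 : 'I_k1 -> nat) (nn2 : 'I_k2 -> nat) (q1 q2 : 'I_k0 -> nat).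
Hypothesis rho_meas : measurable_fun D rho.
Hypothesis rho_ge0 : forall s : R, (0 < s)%R -> (0 <= rho s)%R.
Hypothesis rho_int : \int[leb]_(s in D) (Num.min 1 s * rho s)%:E < +oo.
Hypothesis nn1_gt0 : forall j, (0 < nn1 j)%N.
Hypothesis nn2_gt0 : forall j, (0 < nn2 j)%N.
Hypothesis q1_gt0 : forall j, (0 < q1 j)%N.

Lemma integrand_ge0 i l (u v : R) : (0 < u)%R -> (0 < v)%R ->
  (0 <= integrand c z rho n1 n2 nn1 nn2 q1 q2 i l u v)%R.
Proof.
move=> u0 v0; have t0 q w : (0 <= tau rho q w)%R by exact: tau_ge0.
rewrite /integrand !mulr_ge0 ?expR_ge0 ?exprn_ge0 ?(ltW u0) ?(ltW v0)//;
  by apply: prodr_ge0 => j _.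
Qed.

Lemma measurable_integrand i l : measurable_fun (D `*` D)
  (fun p : R * R => integrand c z rho n1 n2 nn1 nn2 q1 q2 i l p.1 p.2).
Proof.
have mfst : measurable_fun (D `*` D) (fst : R * R -> R).
  by apply: measurable_funTS; exact: measurable_fst.
have msnd : measurable_fun (D `*` D) (snd : R * R -> R).
  by apply: measurable_funTS; exact: measurable_snd.
have mcomp (f : R -> R) (g : R * R -> R) : measurable_fun D f ->
    measurable_fun (D `*` D) g ->
    (forall p, (D `*` D) p -> D (g p)) -> measurable_fun (D `*` D) (fun p => f (g p)).
  move=> mf mg gD; apply: (measurable_comp (F := D)) mf mg => //.
  by move=> _ [p Dp <-]; exact: gD.
have mpsi := measurable_psi rho_meas rho_ge0 rho_int.
have mtau := measurable_tau rho_meas rho_ge0 rho_int.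
have msum (a b : R) : measurable_fun (D `*` D) (fun p : R * R => a * p.1 + b * p.2)%R.
  by apply: measurable_funD; apply: measurable_funM.
have D1 p : (D `*` D) p -> D p.1 by case.
have D2 p : (D `*` D) p -> D p.2 by case.
(* The arguments u + v, u + i_j v and l_j u + v all have the form a u + b v with booleans not both
   false, so they stay in [D], where psi and tau are measurable. *)
have Dab (a b : bool) p : a || b -> (D `*` D) p -> D (a%:R * p.1 + b%:R * p.2)%R.
  move=> ab [/D_gt0 p1 /D_gt0 p2]; rewrite /= in_itv/= andbT.
  by case: a b ab => -[]//= _; rewrite ?mul1r ?mul0r ?addr0 ?add0r// addr_gt0.
have mX n : measurable_fun setT (fun x : R => (x ^+ n)%R) by exact: exprn_measurable.
have mE : measurable_fun setT (@expR R) by exact: measurable_expR.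
rewrite /integrand; apply: measurable_funM; first apply: measurable_funM; first apply: measurable_funM; first apply: measurable_funM.
- by apply: measurable_funM; [exact: (measurableT_comp (mX _) mfst)|exact: (measurableT_comp (mX _) msnd)].
- apply: (measurableT_comp mE); apply: measurable_funB.
    apply: measurable_funN; apply: measurable_funM; first exact: measurable_cst.
    by apply: measurable_funD; exact: mcomp.
  apply: measurable_funM; first exact: measurable_cst.
  have h := mcomp _ _ mpsi (msum 1 1)%R (fun p Dp => Dab true true p isT Dp).
  by apply: eq_measurable_fun h => p _; rewrite !mul1r.
- apply: measurable_prod => j _.
  have h := mcomp _ _ (mtau _ (nn1_gt0 j)) (msum 1 (i j)%:R)%R (fun p Dp => Dab true (i j) p isT Dp).
  by apply: eq_measurable_fun h => p _; rewrite !mul1r.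
- apply: measurable_prod => j _.
  have h := mcomp _ _ (mtau _ (nn2_gt0 j)) (msum (l j)%:R 1)%R (fun p Dp => Dab (l j) true p (orbT _) Dp).
  by apply: eq_measurable_fun h => p _; rewrite !mul1r.
- apply: measurable_prod => r _.
  have q0 : (0 < q1 r + q2 r)%N by rewrite addn_gt0 q1_gt0.
  have h := mcomp _ _ (mtau _ q0) (msum 1 1)%R (fun p Dp => Dab true true p isT Dp).
  by apply: eq_measurable_fun h => p _; rewrite !mul1r.
Qed.

Lemma integral_integrand_sum (I L : finType) (i : I -> {ffun 'I_k1 -> bool})
    (l : L -> {ffun 'I_k2 -> bool}) (C : R) (w : I -> L -> R) :
  (0 <= C)%R -> (forall a b, 0 <= w a b)%R ->
  \int[leb]_(v in D) \int[leb]_(u in D)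
    (C * \sum_a \sum_b w a b *
      integrand c z rho n1 n2 nn1 nn2 q1 q2 (i a) (l b) u v)%:E =
  C%:E * \sum_a \sum_b (w a b)%:E *
    \int[leb]_(v in D) \int[leb]_(u in D)
      (integrand c z rho n1 n2 nn1 nn2 q1 q2 (i a) (l b) u v)%:E.
Proof.
move=> C0 w0.
pose g (p : I * L) u v := integrand c z rho n1 n2 nn1 nn2 q1 q2 (i p.1) (l p.2) u v.
have g0 p u v : (0 < u)%R -> (0 < v)%R -> (0 <= g p u v)%R by exact: integrand_ge0.
have mg p := measurable_iterated (measurable_integrand (i p.1) (l p.2)) (g0 p).
rewrite [X in _ = _ * X]pair_big/=.
have Ig0 p v : (0 < v)%R -> 0 <= \int[leb]_(u in D) (g p u v)%:E.
  by move=> v0; apply: integral_ge0 => u /D_gt0 u0; rewrite lee_fin g0.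
transitivity (\int[leb]_(v in D) \sum_(p : I * L)
    ((C * w p.1 p.2)%:E * \int[leb]_(u in D) (g p u v)%:E)).
  apply: eq_integral => v /set_mem/D_gt0 v0.
  transitivity (\int[leb]_(u in D) \sum_(p : I * L)
      ((C * w p.1 p.2)%:E * (g p u v)%:E)).
    apply: eq_integral => u _; rewrite pair_big/= mulr_sumr -sumEFin.
    by apply: eq_bigr => p _; rewrite -EFinM mulrA.
  rewrite ge0_integral_sum//.
  - apply: eq_bigr => p _; rewrite ge0_integralZl//.
    + exact: (mg p).1.
    + by move=> u /D_gt0 u0; rewrite lee_fin g0.
    + by rewrite lee_fin mulr_ge0.
  - by move=> p; apply: measurable_funeM; exact: (mg p).1.
  - move=> p u /D_gt0 u0; apply: mule_ge0; rewrite lee_fin; last exact: g0.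
    exact: mulr_ge0.
rewrite ge0_integral_sum//; last 2 first.
- by move=> p; apply: measurable_funeM; exact: (mg p).2.
- by move=> p v /D_gt0 v0; rewrite mule_ge0 ?Ig0// lee_fin mulr_ge0.
rewrite ge0_sume_distrr; last first.
  move=> p _; rewrite mule_ge0 ?lee_fin//; apply: integral_ge0 => v /D_gt0 v0.
  exact: (Ig0 p).
apply: eq_bigr => p _; rewrite ge0_integralZl//.
- by rewrite EFinM muleA.
- exact: (mg p).2.
- by move=> v /D_gt0 v0; exact: Ig0.
- by rewrite lee_fin mulr_ge0.
Qed.

End double_integrals.

(** * Probability that the observations have a given kernel *)

Section pattern_probability.
Context d (T : measurableType d) d' (Y : measurableType d') (R : realType).
Variables (P : probability T R) (mu : 'I_3 -> R.-ker T ~> Y).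
Variables (a : 'I_3 -> R) (rho : R -> R) (P0 : probability Y R).
Let e1 := @Ordinal 3 1 isT.
Let e2 := @Ordinal 3 2 isT.
Hypothesis a_ge0 : forall e, 0 <= a e.
Hypothesis a01_gt0 : 0 < a ord0 + a e1.
Hypothesis a02_gt0 : 0 < a ord0 + a e2.
Local Notation D := (`]0%R, +oo[%classic : set R).
Local Notation leb := (@lebesgue_measure R).
Hypothesis rho_meas : measurable_fun D rho.
Hypothesis rho_ge0 : forall s : R, 0 < s -> 0 <= rho s.
Hypothesis rho_int : (\int[leb]_(s in D) (Num.min 1 s * rho s)%:E < +oo)%E.
Hypothesis rho_inf : (\int[leb]_(s in D) (rho s)%:E = +oo)%E.
Hypothesis crm : forall e, poissonian_crm P (a e) rho P0 (mu e).
Hypothesis indep :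
  mutual_independence P (fun e => sigma_random_measure (mu e)).

Let mmu e (B : set Y) : measurable B -> measurable_fun setT (fun w => mu e w B).
Proof. by move=> mB; exact: measurable_kernel. Qed.

Let mfmu e (B : set Y) : measurable B ->
  measurable_fun setT (fun w => fine (mu e w B)).
Proof. by move=> mB; apply: measurableT_comp => //; exact: mmu. Qed.

(** For z = 0 or z = 1 one of the two intensities may be zero; the component with positive intensity
    already has positive mass. *)
Let pair_pos e : 0 < a ord0 + a e ->
  P [set w | mu ord0 w setT = 0 /\ mu e w setT = 0]%E = 0%E.
Proof.
move=> ae; have mZ i : measurable [set w | mu i w setT = 0%E].
  by rewrite -[X in measurable X]setTI; exact: mmu (emeasurable_set1 _).
have [i ai zi] : exists2 i, 0 < a i & [set w | mu ord0 w setT = 0 /\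
    mu e w setT = 0]%E `<=` [set w | mu i w setT = 0%E].
  have [a0|a0] := ltP 0 (a ord0); first by exists ord0 => // w [].
  by exists e => [|w []//]; lra.
apply: (subset_measure0 _ (mZ i)) => //.
  rewrite (_ : [set w | _] = [set w | mu ord0 w setT = 0%E] `&`
    [set w | mu e w setT = 0%E])//.
  exact: measurableI.
exact: (crm_ae_pos ai rho_meas rho_ge0 rho_int rho_inf (crm i)).
Qed.

(** Outside a null set all totals are finite and both denominators positive, so [fine] is faithful
    and the normalization applies. *)
Let good_set : exists G : set T, [/\ measurable G, P (~` G) = 0%E &
  forall w, G w -> [/\ forall e, mu e w setT \is a fin_num,
    0 < fine (mu ord0 w setT) + fine (mu e1 w setT) &
    0 < fine (mu ord0 w setT) + fine (mu e2 w setT)]].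
Proof.
pose F e : set T := [set w | mu e w setT = +oo%E].
pose Z e : set T := [set w | mu ord0 w setT = 0%E] `&` [set w | mu e w setT = 0%E].
have mF e : measurable (F e).
  by rewrite -[X in measurable X]setTI; exact: mmu (emeasurable_set1 _).
have mZ0 e : measurable [set w | mu e w setT = 0%E].
  by rewrite -[X in measurable X]setTI; exact: mmu (emeasurable_set1 _).
have mZ e : measurable (Z e) by exact: measurableI.
pose null (B : set T) := measurable B /\ P B = 0%E.
have nullU B C : null B -> null C -> null (B `|` C).
  move=> [mB B0] [mC C0]; split; first exact: measurableU.
  exact: null_set_setU.
have nF e : null (F e).
  split => //.
  exact: (crm_ae_finite (a_ge0 e) rho_meas rho_ge0 rho_int (crm e)).
have nZ e : 0 < a ord0 + a e -> null (Z e).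
  by move=> ae; split; [exact: mZ|exact: pair_pos ae].
have [mB PB] : null (F ord0 `|` F e1 `|` F e2 `|` Z e1 `|` Z e2).
  apply: (nullU); last exact: nZ a02_gt0.
  apply: (nullU); last exact: nZ a01_gt0.
  by apply: (nullU); [apply: (nullU)|]; exact: nF.
exists (~` (F ord0 `|` F e1 `|` F e2 `|` Z e1 `|` Z e2)); split.
- exact: measurableC.
- by rewrite setCK.
move=> w Gw.
have Ff e : mu e w setT \is a fin_num.
  rewrite ge0_fin_numE// ltey; apply/eqP => Fw; apply: Gw; left; left.
  have : [\/ e = ord0, e = e1 | e = e2].
    by case: e {Fw} => -[|[|[|]]] // i; [apply: Or31|apply: Or32|apply: Or33];
      exact: val_inj.
  move=> [ee|ee|ee]; rewrite ee in Fw.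
  - by left; left.
  - by left; right.
  - by right.
have tot e : ~ Z e w -> 0 < fine (mu ord0 w setT) + fine (mu e w setT).
  move=> Zw; rewrite lt_neqAle addr_ge0 ?fine_ge0// andbT eq_sym.
  rewrite paddr_eq0 ?fine_ge0//; apply/negP => /andP[/eqP z0 /eqP ze].
  by apply: Zw; split => /=; [rewrite -(fineK (Ff ord0)) z0|rewrite -(fineK (Ff e)) ze].
split => //.
- by apply: tot => Zw; apply: Gw; left; right.
- by apply: tot => Zw; apply: Gw; right.
Qed.

Variables (p1 p2 : R.-pker T ~> Y) (n1 n2 : nat).
Hypothesis norm1 : normalization_of (kadd (mu e1) (mu ord0)) p1.
Hypothesis norm2 : normalization_of (kadd (mu e2) (mu ord0)) p2.
Variables (xs : 'I_n1.+1 -> {RV P >-> Y}) (ys : 'I_n2.+1 -> {RV P >-> Y}).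
Hypothesis xys : cond_independent_samples p1 p2 xs ys.
Variable U : nat -> set Y.
Hypothesis mU : forall i, measurable (U i).
Hypothesis U_sep : forall x y, x <> y -> exists i, U i x /\ ~ U i y.
Hypothesis P0_points : forall x, P0 [set x] = 0%E.
Variables (I : finType) (cl : 'I_n1.+1 + 'I_n2.+1 -> I) (fX fY : I -> nat).
Hypothesis cl_surj : forall r, exists a, cl a = r.
Hypothesis cl_X : forall r, #|[pred i | cl (inl i) == r]| = fX r.
Hypothesis cl_Y : forall r, #|[pred j | cl (inr j) == r]| = fY r.
Hypothesis f_gt0 : forall r, (0 < fX r + fY r)%N.
Hypothesis sum_fX : (\sum_r fX r = n1.+1)%N.
Hypothesis sum_fY : (\sum_r fY r = n2.+1)%N.

Let N := (n1 + n2).+3.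

Let fX_lt (Q : pred I) : (\sum_(r | Q r) fX r < N)%N.
Proof.
rewrite ltnS (leq_trans _ (_ : n1.+1 <= _)%N)//; last first.
  by rewrite -addSn (leq_trans (leq_addr n2 _))// leqnSn.
by rewrite -sum_fX [leqRHS](bigID Q)/= leq_addr.
Qed.

Let fY_lt (Q : pred I) : (\sum_(r | Q r) fY r < N)%N.
Proof.
rewrite ltnS (leq_trans _ (_ : n2.+1 <= _)%N)//; last first.
  by rewrite -addnS (leq_trans (leq_addl n1 _))// leqnSn.
by rewrite -sum_fY [leqRHS](bigID Q)/= leq_addr.
Qed.

Let cp u v := cell_poly N (fun q => a e1 * tau rho q u)
  (fun q => a e2 * tau rho q v) (fun q => a ord0 * tau rho q (u + v)).
Let Psi u v :=
  a ord0 * psi rho (u + v) + a e1 * psi rho u + a e2 * psi rho v.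

Section fixed_level.
Variable m : nat.
Let K := {ffun 'I_m -> bool}.
Let S e (k : K) w : R := fine (mu e w (cell U k)).
Let x (k : K) : R := fine (P0 (cell U k)).

Let mc (k : K) : measurable (cell U k). Proof. exact: measurable_cell. Qed.

Let tc : trivIset setT (fun k : K => cell U k).
Proof.
apply/trivIsetP => k k' _ _ /eqP kk'; apply/seteqP; split => // y [/= yk yk'].
by apply: kk'; rewrite -yk -yk'.
Qed.

Let mS e k : measurable_fun setT (S e k). Proof. exact: mfmu. Qed.

Let S0 e k w : 0 <= S e k w. Proof. exact: fine_ge0. Qed.

(** The numerator of the conditional probability of the pattern, once the normalized masses are
    brought to the common denominator M1^(n1+1) M2^(n2+1). *)
Definition cluster_mass (w : T) : R :=
  \sum_(b : {ffun I -> K} | injectiveb b)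
    \prod_r ((S ord0 (b r) w + S e1 (b r) w) ^+ fX r *
             (S ord0 (b r) w + S e2 (b r) w) ^+ fY r).

Lemma measurable_cluster_mass : measurable_fun setT cluster_mass.
Proof.
rewrite /cluster_mass; under eq_fun do rewrite -big_filter.
apply: measurable_sum => b; apply: measurable_prod => r _.
by apply: measurable_funM; apply: measurable_funX; apply: measurable_funD.
Qed.

Lemma cluster_mass_ge0 w : 0 <= cluster_mass w.
Proof.
apply: sumr_ge0 => b _; apply: prodr_ge0 => r _.
by rewrite mulr_ge0// exprn_ge0// addr_ge0.
Qed.

Let sum_S e w : mu e w setT \is a fin_num ->
  \sum_k S e k w = fine (mu e w setT).
Proof.
move=> fw; apply: EFin_inj; rewrite fineK// (measure_cells mU m) -sumEFin.
apply: eq_bigr => k _; rewrite fineK// ge0_fin_numE//.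
rewrite (@le_lt_trans _ _ (mu e w setT))//; first by rewrite le_measure// inE.
by rewrite -ge0_fin_numE.
Qed.

Lemma cluster_mass_le w : (forall e, mu e w setT \is a fin_num) ->
  cluster_mass w <=
  (fine (mu ord0 w setT) + fine (mu e1 w setT)) ^+ n1.+1 *
  (fine (mu ord0 w setT) + fine (mu e2 w setT)) ^+ n2.+1.
Proof.
move=> fw; rewrite -!sum_S// -!big_split/= -sum_fX -sum_fY.
by apply: sum_distinct_le => // k; rewrite addr_ge0.
Qed.

Let norm_cell (p : R.-pker T ~> Y) e w k :
  normalization_of (kadd (mu e) (mu ord0)) p ->
  (forall e, mu e w setT \is a fin_num) ->
  0 < fine (mu ord0 w setT) + fine (mu e w setT) ->
  fine (p w (cell U k)) = (S ord0 k w + S e k w) /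
    (fine (mu ord0 w setT) + fine (mu e w setT)).
Proof.
move=> np fw tot.
have kaddE B : measurable B ->
    kadd (mu e) (mu ord0) w B = (fine (mu ord0 w B) + fine (mu e w B))%:E.
  move=> mB; rewrite addrC EFinD !fineK//.
  - exact: measure_addE.
  - rewrite ge0_fin_numE// (@le_lt_trans _ _ (mu ord0 w setT))//.
      by rewrite le_measure// inE.
    by rewrite -ge0_fin_numE.
  - rewrite ge0_fin_numE// (@le_lt_trans _ _ (mu e w setT))//.
      by rewrite le_measure// inE.
    by rewrite -ge0_fin_numE.
rewrite np//; last by rewrite kaddE// lte_fin tot ltry.
by rewrite !kaddE// inver gt_eqF.
Qed.

Lemma prob_cell_pattern_mass (G : set T) (M1 M2 : T -> R) :
  measurable G -> P (~` G) = 0%E ->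
  measurable_fun setT M1 -> measurable_fun setT M2 ->
  (forall w, 0 < M1 w) -> (forall w, 0 < M2 w) ->
  (forall w, G w -> [/\ forall e, mu e w setT \is a fin_num,
    M1 w = fine (mu ord0 w setT) + fine (mu e1 w setT) &
    M2 w = fine (mu ord0 w setT) + fine (mu e2 w setT)]) ->
  P (cell_pattern xs ys U cl m) =
  (\int[P]_w (\1_G w * cluster_mass w / (M1 w ^+ n1.+1 * M2 w ^+ n2.+1))%:E)%E.
Proof.
move=> mG PG mM1 mM2 M1_gt0 M2_gt0 GM.
rewrite (prob_cell_pattern xys mU cl_surj cl_X cl_Y) -big_filter.
have mp (p : R.-pker T ~> Y) (k : K) n :
    measurable_fun setT (fun w => fine (p w (cell U k)) ^+ n).
  apply: measurable_funX; apply: measurableT_comp => //.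
  exact: measurable_kernel.
have mpp (b : {ffun I -> K}) : measurable_fun setT (fun w =>
    (\prod_r (fine (p1 w (cell U (b r))) ^+ fX r)) *
    (\prod_r (fine (p2 w (cell U (b r))) ^+ fY r))).
  by apply: measurable_funM; apply: measurable_prod => r _.
have pp0 (b : {ffun I -> K}) w : 0 <=
    (\prod_r (fine (p1 w (cell U (b r))) ^+ fX r)) *
    (\prod_r (fine (p2 w (cell U (b r))) ^+ fY r)).
  by rewrite mulr_ge0// prodr_ge0// => r _; rewrite exprn_ge0// fine_ge0.
rewrite -ge0_integral_sum//; last 2 first.
- move=> b; apply/measurable_EFinP; exact: mpp.
- by move=> b w _; rewrite lee_fin.
have mG1 : measurable_fun setT (\1_G : T -> R) by exact: measurable_indic.
have minv (M : T -> R) : measurable_fun setT M -> (forall w, 0 < M w) ->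
    measurable_fun setT (fun w => (M w)^-1).
  move=> mM M0; rewrite (_ : (fun w => _) = fun w => M w `^ (-1)).
    exact: (measurableT_comp (@measurable_powR R (-1)) mM).
  by apply/funext => w; rewrite powR_inv1// ltW.
apply: ge0_ae_eq_integral => //.
- apply: emeasurable_sum => b; apply/measurable_EFinP; exact: mpp.
- apply/measurable_EFinP; apply: measurable_funM.
    by apply: measurable_funM => //; exact: measurable_cluster_mass.
  apply: minv; first by apply: measurable_funM; apply: measurable_funX.
  by move=> w; rewrite mulr_gt0// exprn_gt0.
- by move=> w _; apply: sume_ge0 => b _; rewrite lee_fin.
- move=> w _; rewrite lee_fin divr_ge0 ?mulr_ge0 ?cluster_mass_ge0// exprn_ge0// ltW//.
exists (~` G); split => //; first exact: measurableC.
move=> w /= /not_implyP[_]; apply: contra_notP => /contrapT Gw.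
have [fw ME1 ME2] := GM w Gw.
rewrite sumEFin big_filter; congr (_%:E).
rewrite indicE mem_set// mul1r /cluster_mass mulr_suml; apply: eq_bigr => b _.
rewrite -big_split/=.
have -> : (M1 w ^+ n1.+1 * M2 w ^+ n2.+1)^-1 =
    \prod_r ((M1 w)^-1 ^+ fX r * (M2 w)^-1 ^+ fY r).
  by rewrite big_split/= !prodrXr sum_fX sum_fY !exprVn invfM.
rewrite -big_split/=; apply: eq_bigr => r _.
rewrite (norm_cell _ norm1)// -?ME1// (norm_cell _ norm2)// -?ME2//.
by rewrite !exprMn mulrACA.
Qed.

(** On [G] the totals are sums over the cells, so the exponentials of M1 and M2 also split over the
    cells and [cells_moment] applies to each injective [b]. *)
Lemma laplace_cluster_mass (G : set T) (M1 M2 : T -> R) (u v : R) :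
  0 < u -> 0 < v ->
  measurable G -> P (~` G) = 0%E ->
  measurable_fun setT M1 -> measurable_fun setT M2 ->
  (forall w, G w -> [/\ forall e, mu e w setT \is a fin_num,
    M1 w = fine (mu ord0 w setT) + fine (mu e1 w setT) &
    M2 w = fine (mu ord0 w setT) + fine (mu e2 w setT)]) ->
  (\int[P]_w (expR (- (u * M1 w)) * expR (- (v * M2 w)) *
     (\1_G w * cluster_mass w))%:E =
   (expR (- Psi u v) * \sum_(b : {ffun I -> K} | injectiveb b)
     \prod_r (cp u v (fX r) (fY r)).[x (b r)])%:E)%E.
Proof.
move=> u0 v0 mG PG mM1 mM2 GM.
(* Exponents indexed by cells rather than clusters, as [cells_moment] requires: for injective [b]
   they are the frequencies of cluster r at the cell [b r] and 0 at cells outside the image. *)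
pose al (b : {ffun I -> K}) k := (\sum_(r | b r == k) fX r)%N.
pose be (b : {ffun I -> K}) k := (\sum_(r | b r == k) fY r)%N.
have alE (b : {ffun I -> K}) r : injective b -> al b (b r) = fX r.
  by move=> b_inj; rewrite /al (big_pred1 r)// => r'; rewrite (inj_eq b_inj).
have beE (b : {ffun I -> K}) r : injective b -> be b (b r) = fY r.
  by move=> b_inj; rewrite /be (big_pred1 r)// => r'; rewrite (inj_eq b_inj).
have al0 (b : {ffun I -> K}) k : k \notin codom b -> al b k = 0%N.
  move=> kb; rewrite /al big_pred0// => r; apply: contraNF kb => /eqP <-.
  exact: codom_f.
have be0 (b : {ffun I -> K}) k : k \notin codom b -> be b k = 0%N.
  move=> kb; rewrite /be big_pred0// => r; apply: contraNF kb => /eqP <-.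
  exact: codom_f.
pose h (b : {ffun I -> K}) w := \prod_k
  ((S ord0 k w + S e1 k w) ^+ al b k * (S ord0 k w + S e2 k w) ^+ be b k *
    (expR (- (u * (S ord0 k w + S e1 k w))) *
     expR (- (v * (S ord0 k w + S e2 k w))))).
have h0 b w : 0 <= h b w.
  apply: prodr_ge0 => k _.
  by rewrite mulr_ge0// mulr_ge0 ?expR_ge0// exprn_ge0// addr_ge0.
have mexp (M : T -> R) (s : R) : measurable_fun setT M ->
    measurable_fun setT (fun w => expR (- (s * M w))).
  move=> mM; have mE : measurable_fun setT (fun x : R => expR (- x)).
    exact: continuous_measurable_fun continuous_expRN.
  by apply: (measurableT_comp mE); apply: measurable_funM.
have mh b : measurable_fun setT (h b).
  apply: measurable_prod => k _; apply: measurable_funM.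
    by apply: measurable_funM; apply: measurable_funX; apply: measurable_funD.
  apply: measurable_funM.
    by apply: (mexp (fun w => S ord0 k w + S e1 k w)); apply: measurable_funD.
  by apply: (mexp (fun w => S ord0 k w + S e2 k w)); apply: measurable_funD.
transitivity (\int[P]_w \sum_(b : {ffun I -> K} | injectiveb b) (h b w)%:E)%E.
  under [RHS]eq_integral do rewrite -big_filter.
  apply: ge0_ae_eq_integral => //.
  - apply/measurable_EFinP; apply: measurable_funM.
      by apply: measurable_funM; exact: mexp.
    by apply: measurable_funM; [exact: measurable_indic|exact: measurable_cluster_mass].
  - by apply: emeasurable_sum => b; exact/measurable_EFinP.
  - by move=> w _; rewrite lee_fin !mulr_ge0 ?expR_ge0 ?cluster_mass_ge0.
  - by move=> w _; apply: sume_ge0 => b _; rewrite lee_fin.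
  exists (~` G); split => //; first exact: measurableC.
  move=> w /= /not_implyP[_]; apply: contra_notP => /contrapT Gw.
  have [fw ME1 ME2] := GM w Gw.
  rewrite sumEFin big_filter indicE mem_set// mul1r /cluster_mass mulr_sumr.
  congr (_%:E); apply: eq_bigr => b /injectiveP b_inj.
  rewrite /h [RHS]big_split mulrC; apply: congr2.
    rewrite (prod_injective b_inj).
      by apply: eq_bigr => r _; rewrite alE// beE.
    by move=> k kb; rewrite al0// be0// !expr0 mulr1.
  rewrite ME1 ME2 -!sum_S// -!big_split/= [RHS]big_split/= -!expR_sum.
  by rewrite !sumrN -!mulr_sumr.
under eq_integral do rewrite -big_filter.
rewrite ge0_integral_sum//; last 2 first.
- by move=> b; exact/measurable_EFinP.
- by move=> b w _; rewrite lee_fin.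
rewrite big_filter mulr_sumr -sumEFin; apply: eq_bigr => b /injectiveP b_inj.
rewrite (cells_moment a_ge0 rho_meas rho_ge0 rho_int crm indep mc tc
  (sum_cell_mass mU P0 m) u0 v0 (fun k => fX_lt (fun r => b r == k))
  (fun k => fY_lt (fun r => b r == k))).
congr (_ * _)%:E; rewrite (prod_injective b_inj).
  apply: eq_bigr => r _; rewrite -/(al b (b r)) -/(be b (b r)) alE// beE//.
(* A cell assigned to no cluster contributes the constant polynomial 1. *)
move=> k kb; rewrite -/(al b k) -/(be b k) al0// be0// cell_poly00//.
by rewrite hornerE.
Qed.

End fixed_level.

(** Both sides are limits of the same sequence: [cvg_prob_cell_pattern] identifies the limit as the
    left side, [cvg_gamma_mixture] as the right side. *)
Lemma pattern_probability :
  ((n1`!%:R * n2`!%:R)%:E *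
   P [set w | forall x y, (obs xs ys w x == obs xs ys w y) = (cl x == cl y)] =
   \int[leb]_(v in D) \int[leb]_(u in D) (u ^+ n1 * v ^+ n2 *
     (expR (- Psi u v) * \prod_r (cp u v (fX r) (fY r))`_1))%:E)%E.
Proof.
have [G [mG PG GG]] := good_set.
pose tot e w : R := fine (mu ord0 w setT) + fine (mu e w setT).
(* The total on [G] and 1 elsewhere: positive at every point, as the Gamma integrals require. The
   factor [\1_G] in [A_] removes the points where it is not the true total. *)
pose M e w : R := \1_G w * tot e w + (1 - \1_G w).
have mtot e : measurable_fun setT (tot e).
  by apply: measurable_funD; exact: mfmu.
have mM e : measurable_fun setT (M e).
  apply: measurable_funD; first exact: measurable_funM.
  exact: measurable_funB.
have ME e w : G w -> M e w = tot e w.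
  by move=> Gw; rewrite /M indicE mem_set// mul1r subrr addr0.
have MN e w : ~ G w -> M e w = 1.
  by move=> Gw; rewrite /M indicE memNset// mul0r add0r subr0.
have M_gt0 e : (forall w, G w -> 0 < tot e w) -> forall w, 0 < M e w.
  move=> te w; have [Gw|Gw] := pselect (G w); last by rewrite MN.
  by rewrite ME//; exact: te.
have M1_gt0 : forall w, 0 < M e1 w by apply: M_gt0 => w /GG[].
have M2_gt0 : forall w, 0 < M e2 w by apply: M_gt0 => w /GG[].
have GM w : G w -> [/\ forall e, mu e w setT \is a fin_num,
    M e1 w = tot e1 w & M e2 w = tot e2 w].
  by move=> Gw; split; [case: (GG w Gw)|exact: ME|exact: ME].
pose A_ m w : R := \1_G w * cluster_mass m w.
have mA m : measurable_fun setT (A_ m).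
  by apply: measurable_funM => //; exact: measurable_cluster_mass.
have A_ge0 m w : 0 <= A_ m w by rewrite mulr_ge0// cluster_mass_ge0.
have A_le m w : A_ m w <= M e1 w ^+ n1.+1 * M e2 w ^+ n2.+1.
  have [Gw|Gw] := pselect (G w).
    rewrite /A_ indicE mem_set// mul1r !ME//; apply: cluster_mass_le.
    by case: (GG w Gw).
  by rewrite /A_ indicE memNset// mul0r !MN// !expr1n mulr1.
have A_F u v : 0 < u -> 0 < v ->
    (\int[P]_w (expR (- (u * M e1 w)) * expR (- (v * M e2 w)) * A_ m w)%:E)%E
      @[m --> \oo] -->
    (expR (- Psi u v) * \prod_r (cp u v (fX r) (fY r))`_1)%:E.
  move=> u0 v0.
  rewrite (_ : (fun m => _) = (fun m => (expR (- Psi u v) *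
      \sum_(b : {ffun I -> {ffun 'I_m -> bool}} | injectiveb b)
      \prod_r (cp u v (fX r) (fY r)).[fine (P0 (cell U (b r)))])%:E)); last first.
    apply/funext => m.
    exact: (laplace_cluster_mass m u0 v0 mG PG (mM _) (mM _) GM).
  apply: cvg_EFin; first exact: nearW.
  apply: cvgM; first exact: cvg_cst.
  have h0 (m : nat) (k : {ffun 'I_m -> bool}) : 0 <= fine (P0 (cell U k)).
    exact: fine_ge0.
  have h1 := sum_cell_mass mU P0.
  have h2 := cvg_sum_sqr_cell_mass mU U_sep P0_points.
  have h3 r : (cp u v (fX r) (fY r))`_0 = 0 by exact: coef0_cell_poly.
  exact: (@cvg_distinct_cell_sum R I (fun m => {ffun 'I_m -> bool})
    (fun m k => fine (P0 (cell U k))) _ h0 h1 h2 h3).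
have lim1 : (\int[P]_w (n1`!%:R * n2`!%:R *
      (A_ m w / (M e1 w ^+ n1.+1 * M e2 w ^+ n2.+1)))%:E)%E @[m --> \oo] -->
    (\int[leb]_(v in D) \int[leb]_(u in D) (u ^+ n1 * v ^+ n2 *
     (expR (- Psi u v) * \prod_r (cp u v (fX r) (fY r))`_1))%:E)%E.
  exact: (cvg_gamma_mixture (mM e1) (mM e2) M1_gt0 M2_gt0 mA A_ge0 A_le A_F).
have lim2 : P (cell_pattern xs ys U cl m) @[m --> \oo] -->
    P [set w | forall x y, (obs xs ys w x == obs xs ys w y) = (cl x == cl y)].
  exact: (cvg_prob_cell_pattern mU cl_surj U_sep).
have lim3 : ((n1`!%:R * n2`!%:R)%:E * P (cell_pattern xs ys U cl m))%E
    @[m --> \oo] --> ((n1`!%:R * n2`!%:R)%:E *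
   P [set w | forall x y, (obs xs ys w x == obs xs ys w y) = (cl x == cl y)])%E.
  by apply: (cvgeZl _ lim2).
apply: (cvg_unique _ lim3 _) => //.
rewrite (_ : (fun m => _) = (fun m => \int[P]_w (n1`!%:R * n2`!%:R *
    (A_ m w / (M e1 w ^+ n1.+1 * M e2 w ^+ n2.+1)))%:E))%E; first exact: lim1.
apply/funext => m.
rewrite (prob_cell_pattern_mass m mG PG (mM e1) (mM e2) M1_gt0 M2_gt0 GM).
rewrite -ge0_integralZl_EFin//.
- move=> w _; rewrite lee_fin divr_ge0 ?A_ge0// mulr_ge0// exprn_ge0//.
    exact: ltW.
  exact: ltW.
- apply/measurable_EFinP; apply: measurable_funM; first exact: mA.
  rewrite (_ : (fun w => _) = fun w => (M e1 w ^+ n1.+1 * M e2 w ^+ n2.+1) `^ (-1)).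
    apply: (measurableT_comp (@measurable_powR R (-1))).
    by apply: measurable_funM; apply: measurable_funX.
  by apply/funext => w; rewrite powR_inv1// mulr_ge0// exprn_ge0//; exact: ltW.
Qed.

End pattern_probability.

(** * From the pattern probability to the partition probability function *)

Lemma nonatomic_set1 d (Y : measurableType d) (R : realType)
    (nu : {measure set Y -> \bar R}) (x : Y) :
  measurable [set x] -> nonatomic nu -> nu [set x] = 0%E.
Proof.
move=> mx na; apply/eqP; rewrite eq_le measure_ge0 andbT leNgt; apply/negP => x0.
(* A subset of a point has mass 0 or the mass of the point, never anything strictly between. *)
have [B [mB /subset_set1[->|->]]] := na _ mx x0; rewrite ?measure0 ?ltxx//.
Qed.

Theorem proposition2 (R : realType)
  (X : completeMetricType R) (X_separable : separable X)
  (P0 : probability (borel X) R) (P0_nonatomic : nonatomic P0)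
  (c z : R) (c_gt0 : 0 < c) (z01 : 0 <= z <= 1)
  (rho : R -> R) (rho_meas : measurable_fun (`]0, +oo[ : set R) rho)
  (rho_ge0 : forall s, 0 < s -> 0 <= rho s)
  (rho_int : (\int[@lebesgue_measure R]_(s in `]0%R, +oo[)
                (Num.min 1 s * rho s)%:E < +oo)%E)
  (rho_inf : (\int[@lebesgue_measure R]_(s in `]0%R, +oo[)
                (rho s)%:E = +oo)%E)
  (d : measure_display) (T : measurableType d) (P : probability T R)
  (p1 p2 : R.-pker T ~> borel X)
  (p_GM : GM_dependent_NCRM P c z rho P0 p1 p2)
  (n1 n2 : nat) (n1_ge1 : (1 <= n1)%N) (n2_ge1 : (1 <= n2)%N)
  (xs : 'I_n1 -> {RV P >-> borel X}) (ys : 'I_n2 -> {RV P >-> borel X})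
  (xys : cond_independent_samples p1 p2 xs ys)
  (k1 k2 k0 : nat)
  (k1_bound : (1 <= k1 + k0 <= n1)%N) (k2_bound : (1 <= k2 + k0 <= n2)%N)
  (nn1 : 'I_k1 -> nat) (nn2 : 'I_k2 -> nat) (q1 q2 : 'I_k0 -> nat)
  (Delta1 : Delta n1 nn1 q1) (Delta2 : Delta n2 nn2 q2)
  (ptn : {set {set 'I_n1 + 'I_n2}})
  (ptn_freq : has_frequencies nn1 nn2 q1 q2 ptn) :
  P [set w | preim_partition (obs xs ys w) finset.setT = ptn] =
  ((c ^+ (k1 + k2 + k0) / (Gamma (n1%:R : R) * Gamma (n2%:R : R)))%:E *
   \sum_(i : {ffun 'I_k1 -> bool}) \sum_(l : {ffun 'I_k2 -> bool})
     ((1 - z) ^+ (k0 + \sum_(j < k1) i j + \sum_(j < k2) l j)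
      * z ^+ (k1 + k2 - \sum_(j < k1) i j - \sum_(j < k2) l j))%:E *
     \int[@lebesgue_measure R]_(v in `]0%R, +oo[)
       \int[@lebesgue_measure R]_(u in `]0%R, +oo[)
         (integrand c z rho n1 n2 nn1 nn2 q1 q2 i l u v)%:E)%E.
Proof.
move: n1_ge1 n2_ge1 xs ys xys k1_bound k2_bound Delta1 Delta2 ptn ptn_freq.
(* Sample sizes become successors, so that Gamma(n) is a factorial and the exponents n - 1 are [n1]
   and [n2]. *)
case: n1 => [//|n1] _; case: n2 => [//|n2] _ xs ys xys _ _.
move=> [nn1_gt0 q1_gt0 sum1] [nn2_gt0 q2_gt0 sum2] ptn ptn_freq.
have [mu0 [mu1 [mu2 [[crm0 crm1 crm2] indep norm1 norm2]]]] := p_GM.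
have [U [oU U_sep]] := separable_separating_family X_separable.
have mU i : measurable (U i : set (borel X)) by exact: sub_sigma_algebra.
have P0_points (x : borel X) : P0 [set x] = 0%E.
  (* A point is the intersection of the cells containing it, hence measurable. *)
  apply: (nonatomic_set1 _ P0_nonatomic); rewrite -(@bigcap_cell _ (borel X) U U_sep x).
  by apply: bigcapT_measurable => m; exact: (@measurable_cell _ (borel X) U mU).
have [cl [clP cl_surj cl_X cl_Y]] := cluster_map ptn_freq.
pose fX := @freqX k1 k2 k0 nn1 q1; pose fY := @freqY k1 k2 k0 nn2 q2.
have f_gt0 r : (0 < fX r + fY r)%N.
  by case: r => [[j|j]|r]; rewrite /fX /fY/= addn_gt0 ?nn1_gt0 ?nn2_gt0 ?q1_gt0 ?orbT.
have sum_fX : (\sum_r fX r = n1.+1)%N.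
  by rewrite !big_sumType/= big1_eq addn0.
have sum_fY : (\sum_r fY r = n2.+1)%N.
  by rewrite !big_sumType/= big1_eq add0n.
(* Index 0 is the shared component. For both samples the intensities add up to c, which is positive
   whatever [z] is. *)
pose a (e : 'I_3) : R := if val e is 0 then c * (1 - z) else c * z.
pose mu (e : 'I_3) := tnth [tuple mu0; mu1; mu2] e.
have [z0 z1] := andP z01.
have a_ge0 e : 0 <= a e.
  by rewrite /a; case: (val e) => [|_]; rewrite mulr_ge0 ?subr_ge0// ltW.
have a_gt0 : 0 < c * (1 - z) + c * z by rewrite -mulrDr subrK mulr1.
have crm e : poissonian_crm P (a e) rho P0 (mu e).
  by case: e => -[|[|[|]]].
have fX_lt r : (fX r < (n1 + n2).+3)%N.
  have : (fX r <= n1.+1)%N by rewrite -sum_fX (bigD1 r)//= leq_addr.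
  by lia.
have fY_lt r : (fY r < (n1 + n2).+3)%N.
  have : (fY r <= n2.+1)%N by rewrite -sum_fY (bigD1 r)//= leq_addr.
  by lia.
have -> : [set w | preim_partition (obs xs ys w) finset.setT = ptn] =
    [set w | forall x y, (obs xs ys w x == obs xs ys w y) = (cl x == cl y)].
  by apply/seteqP; split => w /clP.
set p := P _.
have -> : p = ((n1`!%:R * n2`!%:R)^-1%:E * ((n1`!%:R * n2`!%:R)%:E * p))%E.
  by rewrite muleA -EFinM mulVf ?gt_eqF// mul1e.
rewrite !GammaE [c ^+ _ / _]mulrC [X in _ = (X * _)%E]EFinM -[RHS]muleA; apply: congr2 => //.
apply: (etrans (@pattern_probability _ T _ (borel X) R P mu a rho P0 a_ge0 a_gt0 a_gt0
  rho_meas rho_ge0 rho_int rho_inf crm indep p1 p2 n1 n2 norm1 norm2 xs ys xys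
  U mU U_sep P0_points _ cl fX fY cl_surj cl_X cl_Y f_gt0 sum_fX sum_fY)).
have w_ge0 (i : {ffun 'I_k1 -> bool}) (l : {ffun 'I_k2 -> bool}) :
    0 <= (1 - z) ^+ (k0 + \sum_(j < k1) i j + \sum_(j < k2) l j)
      * z ^+ (k1 + k2 - \sum_(j < k1) i j - \sum_(j < k2) l j).
  by rewrite mulr_ge0// exprn_ge0// subr_ge0.
(* The finite sums are moved inside the integrals, where the identity becomes the pointwise
   [integrand_expansion]. *)
rewrite -(@integral_integrand_sum _ c z rho n1.+1 n2.+1 k1 k2 k0 nn1 nn2 q1 q2
  rho_meas rho_ge0 rho_int nn1_gt0 nn2_gt0 q1_gt0 _ _ id id _ _
  (exprn_ge0 _ (ltW c_gt0)) w_ge0).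
apply: eq_integral => v _; apply: eq_integral => u _; congr (_%:E).
rewrite -(@integrand_expansion _ c z rho n1.+1 n2.+1 k1 k2 k0 nn1 nn2 q1 q2
  nn1_gt0 nn2_gt0 q1_gt0 q2_gt0 _ u v fX_lt fY_lt) !subn1.
reflexivity.
Qed.
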